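(* The series $Q(3,0,t,1,1;0,y)$, which counts properly $3$-colored near-triangulations by edges ($t$) and outer degree ($y$), is algebraic of degree $6$ over $\mathbb{Q}(t,y)$. Let $Q_i(t)=[y^i]Q(3,0,t,1,1;0,y)$. Then $Q_1(t)=0$, and for $i\ge2$, $Q_i(t)$ is of degree at most $2$ over $\mathbb{Q}(t)$ and admits a rational parametrization: letting $S\equiv S(t)$ be the unique power series in $t$ satisfying $S=t^3(1+2S)^2$ (so $S$ has constant term $0$), $t^iQ_i(t)$ is a rational function of $S$, and in particular $$Q_2(t)=2t(1+S-S^2),\qquad Q_3(t)=2S(1-S).$$
   Context: Planar maps are connected planar graphs properly embedded in the oriented sphere up to orientation-preserving homeomorphism (loops and multiple edges allowed), rooted by a distinguished corner whose vertex/face are the root-vertex/root-face (other faces are internal); degrees count edges with multiplicity; the atomic map is included; $e,v,f$ count edges, vertices, faces; $d_f$ is the root-face degree. The Potts polynomial is $P_G(q,\nu)=\sum_{c:V(G)\to\{1,\dots,q\}}\nu^{m(c)}$, $m(c)$ = number of monochromatic edges (loops always monochromatic); $P_G(q,0)$ is the chromatic polynomial. A quasi-triangulation is a rooted planar map whose internal faces are digons incident to the root-vertex or triangles; $\mathrm{dig}(Q)$, $\mathrm{ddig}(Q)$ count internal digons and internal digons doubly incident to the root-vertex. $Q(q,\nu,t,w,z;x,y)=\frac1q\sum_Q t^{e(Q)}w^{v(Q)-1}z^{f(Q)-1}x^{\mathrm{dig}(Q)}y^{d_f(Q)}2^{\mathrm{ddig}(Q)}P_Q(q,\nu)$. A near-triangulation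 is a rooted planar map all of whose internal faces have degree 3; $Q(q,\nu,t,1,1;0,y)$ is the generating function of near-triangulations weighted by $P/q$. *)

(* Defs.v *)
From HB Require Import structures.
From mathcomp Require Import all_boot all_order all_algebra all_fingroup.
Set Implicit Arguments. Unset Strict Implicit. Unset Printing Implicit Defensive.
Import Order.TTheory GRing.Theory Num.Theory.
Local Open Scope ring_scope.

Definition series := nat -> rat.
Definition seriesEq (F G : series) : Prop := forall n, F n = G n.
Definition sconst (c : rat) : series := fun n => if n == 0%N then c else 0.
Definition sX : series := fun n => (n == 1%N)%:R.
Definition sadd (F G : series) : series := fun n => F n + G n.
Definition sscale (c : rat) (F : series) : series := fun n => c * F n.
Definition smul (F G : series) : series :=
  fun n => \sum_(k < n.+1) F k * G (n - k)%N.
Fixpoint spow (F : series) (k : nat) : series :=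
  if k is k'.+1 then smul F (spow F k') else sconst 1.
Definition sshift (i : nat) (F : series) : series :=
  fun n => if (i <= n)%N then F (n - i)%N else 0.
Definition ser_of_poly (q : {poly rat}) : series := fun n => q`_n.
Definition sevalQ (a : {poly rat}) (F : series) : series :=
  fun n => \sum_(k < size a) a`_k * spow F k n.
Definition sevalQt (p : {poly {poly rat}}) (F : series) : series :=
  fun n => \sum_(k < size p) smul (ser_of_poly p`_k) (spow F k) n.

(* bivariate series in t,y : F n m = coefficient of t^n y^m *)
Definition bseries := nat -> nat -> rat.
Definition bseriesEq (F G : bseries) : Prop := forall n m, F n m = G n m.
Definition bzero : bseries := fun _ _ => 0.
Definition bconst1 : bseries := fun n m => ((n == 0%N) && (m == 0%N))%:R.
Definition bmul (F G : bseries) : bseries :=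
  fun n m => \sum_(a < n.+1) \sum_(b < m.+1) F a b * G (n - a)%N (m - b)%N.
Fixpoint bpow (F : bseries) (k : nat) : bseries :=
  if k is k'.+1 then bmul F (bpow F k') else bconst1.
Definition bser_of_poly (q : {poly {poly rat}}) : bseries := fun n m => (q`_n)`_m.
Definition bevalQty (P : {poly {poly {poly rat}}}) (F : bseries) : bseries :=
  fun n m => \sum_(k < size P) bmul (bser_of_poly P`_k) (bpow F k) n m.

(* A rooted planar map with N = n.+1 >= 1 edges is encoded by a pair of
   permutations (s, a) of the darts 'I_(2N): s = rotation around vertices
   (counter-clockwise), a = fixed-point-free involution (edges);
   faces are the cycles of the permutation d |-> s (a d) = (a * s) d;
   the root corner is dart ord0.  Vertices / edges / faces = cycles of
   s / a / (a * s); degrees are cycle lengths. *)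
Definition ndarts (n : nat) := n.*2.+2.

Definition facep n (s a : {perm 'I_(ndarts n)}) : {perm 'I_(ndarts n)} := a * s.

Definition is_planar_map n (s a : {perm 'I_(ndarts n)}) : bool :=
  [&& [forall d, a (a d) == d], [forall d, a d != d],
      [forall d, connect [rel x y | (y == s x) || (y == a x)] ord0 d]
    & (#|porbits s| + #|porbits (facep s a)| == n.+1 + 2)%N].

Definition root_deg n (s a : {perm 'I_(ndarts n)}) : nat :=
  #|porbit (facep s a) ord0|.

Definition near_tri n (s a : {perm 'I_(ndarts n)}) : bool :=
  [forall d, (d \notin porbit (facep s a) ord0) ==>
             (#|porbit (facep s a) d| == 3)%N].

(* P_Q(3,0): number of proper 3-colourings of the vertices, encoded as
   colourings of darts constant on vertices (s-cycles) and such that the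
   two ends of each edge get different colours (loops never proper). *)
Definition ncol3 n (s a : {perm 'I_(ndarts n)}) : nat :=
  #|[set c : {ffun 'I_(ndarts n) -> 'I_3} |
       [forall d, c (s d) == c d] && [forall d, c (a d) != c d]]|.

(* [t^n y^i] Q(3,0,t,1,1;0,y) = (1/3) sum over rooted near-triangulations
   with n edges and root-face degree i of P(3,0).  Each rooted map with
   N >= 1 edges corresponds to exactly (2N-1)! labelled rotation systems
   with root dart ord0 (rooted maps have no nontrivial automorphisms).
   The case n = 0 is the atomic map (root-face degree 0, P = 3). *)
Definition Qcoef (i n : nat) : rat :=
  match n with
  | 0%N => (i == 0%N)%:R
  | n'.+1 =>
      ((3 * (n'.*2.+1)`!)%N%:R)^-1 *
      (\sum_(s : {perm 'I_(ndarts n')})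
         \sum_(a : {perm 'I_(ndarts n')} |
                 [&& is_planar_map s a, near_tri s a & root_deg s a == i])
            ncol3 s a)%N%:R
  end.

Definition Qty : bseries := fun n i => Qcoef i n.
Definition Qi (i : nat) : series := fun n => Qcoef i n.

Definition S_eq (S : series) : Prop :=
  seriesEq S (smul (spow sX 3) (spow (sadd (sconst 1) (sscale 2 S)) 2)).

(* Main.v *)
(* A proper 3-colouring of a near-triangulation is read through the differences
   in Z/3 of the colours at the two ends of each dart: they are 1 or -1, opposite
   on the two darts of an edge, and equal on the three darts of a triangle.  One
   thus counts the ways of gluing a polygon with signed sides to triangles of both
   signs, and peeling off the first unglued side gives a recursion on sign words:
   the side is glued either to a new triangle, or to another side of the polygon,
   which then splits in two.

   Write X = [1] + [-1], Y = [1] - [-1], extend the generating functions of sign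
   words linearly, and let F_k (= Q_k) and G_ab be the series of X^k and
   Y X^a Y X^b.  The recursion and the invariance under rotation become
     2 F_(k+1) = t F_(k+2) + t G_(k,0) + 4 t sum_(i+j=k-1) F_i F_j,
     2 G_(a,b) = - t (G_(a+1,b) + G_(a,b+1)) - 4 t F_a F_b.
   The kernel 2 y1 y2 + t (y1 + y2) of the second equation can be cancelled after
   a change of unknown which separates the variables y1 and y2; this yields an
   equation Psi(M) = c y^2 for M = sum_k F_k y^k, where Psi is a cubic polynomial
   over Q[t,y] and c only depends on t.  A rational parametrisation of the cubic shows that
   c = - 4 t^3 - (8 t^3 - 1) S; eliminating S, which is quadratic over Q(t), gives
   an equation of degree 6.  It has minimal degree because S is irrational and
   because the cubic has no root in K(y), K being any field that contains t and c. *)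

Require Import Defs.
From HB Require Import structures.
From mathcomp Require Import all_boot all_order all_algebra all_fingroup.
From mathcomp Require Import zify ring boolp.
Set Implicit Arguments. Unset Strict Implicit. Unset Printing Implicit Defensive.
Import Order.TTheory GRing.Theory Num.Theory.

Local Open Scope group_scope.

(** * Genus bound *)

Section Gluing.
Variable D : finType.
Implicit Types (s a phi : {perm D}) (x y r b d : D).

(** Maps are labelled here. Once the face permutation [phi] is fixed, a coloured map is an
    involution [a] with a colouring, and the number of gluings depends on [phi] only through the
    sign words of the polygons and the number m of hidden triangles, with a factor 3^m m!.
    Multiplied by the number of face permutations of the same cycle type, this factor gives the
    (2N-1)! of [Qcoef]. Planarity is numerical: [genus_bound] holds for every gluing, and equality
    in it forces an identification inside a polygon to disconnect the two pieces. Rotation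
    invariance is invisible in the recursion, which singles out a first letter; it is recovered from
    the set of gluings, which ignores where a polygon starts. The constant c of the cubic first
    contains the unknown F_2. A parametrised solution of the cubic has an explicit constant, and
    uniqueness, proved without fixing the constant, identifies series and constants at once. *)

Lemma mem_porbit_fconnect s x y : (y \in porbit s x) = fconnect s x y.
Proof.
apply/porbitP/idP=> [[i ->]|]; first by rewrite permX fconnect_iter.
by move/iter_findex=> <-; exists (findex s x y); rewrite permX.
Qed.

Lemma connect_symW (e : rel D) :
  (forall x y, e x y -> connect e y x) -> connect_sym e.
Proof.
move=> sym_e.
suff sub x y : connect e x y -> connect e y x by move=> x y; apply/idP/idP => /sub.
case/connectP=> p; elim: p x => [x _ -> //|z p IH x] /= /andP[xz zp] y_last.
by apply: connect_trans (sym_e _ _ xz); apply: IH.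
Qed.

(** A path may use the added edge [{r, b}] several times, but two consecutive crossings cancel or
    shorten, so one oriented crossing at most remains. *)
Lemma connect_edge (e e' : rel D) r b :
  (forall x y, e x y ->
     [|| connect e' x y, (x == r) && (y == b) | (x == b) && (y == r)]) ->
  forall x y, connect e x y ->
  [|| connect e' x y, connect e' x r && connect e' b y
    | connect e' x b && connect e' r y].
Proof.
move=> sub x y /connectP[p]; elim: p x => [x _ ->|z p IH x] /=.
  by rewrite connect0.
case/andP=> /sub xz zp /(IH _ zp) {IH zp}; case/or3P: xz => [xz|/andP[/eqP-> /eqP->]|/andP[/eqP-> /eqP->]].
- case/or3P=> [zy|/andP[zr ->]|/andP[zb ->]]; apply/or3P.
  + by constructor 1; apply: connect_trans zy.
  + by constructor 2; rewrite andbT (connect_trans xz).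
  + by constructor 3; rewrite andbT (connect_trans xz).
- by rewrite !connect0; case/or3P=> [->|/andP[_ ->]|/andP[_ ->]]; rewrite ?orbT.
- by rewrite !connect0; case/or3P=> [->|/andP[_ ->]|/andP[_ ->]]; rewrite ?orbT.
Qed.

Definition map_rel s a : rel D := [rel x y | (y == s x) || (y == a x)].

Lemma connect_s s a x : connect (map_rel s a) x (s x).
Proof. by apply: connect1; rewrite /map_rel /= eqxx. Qed.

Lemma connect_a s a x : connect (map_rel s a) x (a x).
Proof. by apply: connect1; rewrite /map_rel /= eqxx orbT. Qed.

Lemma map_rel_sym s a : involutive a -> connect_sym (map_rel s a).
Proof.
move=> aK; apply: connect_symW => x y /orP[] /eqP ->.
  have: fconnect s (s x) x by rewrite fconnect_sym ?fconnect1 //; exact: perm_inj.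
  by apply: connect_sub => u v /eqP <-; apply: connect1; rewrite /map_rel /= eqxx.
by rewrite -{2}[x]aK; apply: connect_a.
Qed.

Lemma map_rel_face s a : involutive a ->
  forall x, connect (map_rel s a) x ((a * s) x).
Proof.
move=> aK x; rewrite permM.
exact: connect_trans (connect_a _ _ _) (connect_s _ _ _).
Qed.

(* Deleting the edge {r, a r} leaves the vertex permutation [a * phi]
   unchanged and turns the two darts into fixed points of the involution. *)
Section Delete.
Variables (a phi : {perm D}) (r b : D).
Hypotheses (aK : involutive a) (ar : a r = b) (neq_rb : r != b).
Let a' := a * tperm r b.
Let phi' := tperm r b * phi.

Lemma del_ab : a b = r. Proof. by rewrite -ar aK. Qed.

Lemma del_vertex : a' * phi' = a * phi.
Proof. by rewrite /a' /phi' mulgA -(mulgA a) tperm2 mulg1. Qed.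

Lemma del_aE x : a' x = if (x == r) || (x == b) then x else a x.
Proof.
rewrite permM; case: eqP => [->|/eqP nxr] /=; first by rewrite ar tpermR.
case: eqP => [->|/eqP nxb]; first by rewrite del_ab tpermL.
rewrite tpermD //.
  by apply: contraNneq nxb => e; rewrite -[x]aK -e ar.
by apply: contraNneq nxr => e; rewrite -[x]aK -e del_ab.
Qed.

Lemma del_aK : involutive a'.
Proof.
move=> x; rewrite !del_aE; case nx: ((x == r) || (x == b)); first by rewrite nx.
case: ifP => [/orP[]/eqP e|_]; last exact: aK.
  by move: nx; rewrite -[x]aK e ar eqxx orbT.
by move: nx; rewrite -[x]aK e del_ab eqxx.
Qed.

Let e := map_rel (a * phi) a.
Let e' := map_rel (a * phi) a'.

Lemma del_connect_sub x y : connect e' x y -> connect e x y.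
Proof.
apply: connect_sub => {x y} x y /orP[] /eqP ->.
  exact: connect_s.
by rewrite del_aE; case: ifP => // _; apply: connect_a.
Qed.

Lemma del_connect x y : connect e x y ->
  [|| connect e' x y, connect e' x r && connect e' b y
    | connect e' x b && connect e' r y].
Proof.
apply: connect_edge => {x y} x y /orP[] /eqP ->.
  by rewrite connect_s.
case: (eqVneq x r) => [->|nxr]; first by rewrite ar !eqxx orbT.
case: (eqVneq x b) => [->|nxb]; first by rewrite del_ab !eqxx !orbT.
have -> : a x = a' x by rewrite del_aE (negPf nxr) (negPf nxb).
by rewrite connect_a.
Qed.

Lemma del_live : [set d | a' d != d] = [set d | a d != d] :\ r :\ b.
Proof.
apply/setP => d; rewrite !inE del_aE.
by case: (d == r); case: (d == b); rewrite ?eqxx.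
Qed.

Lemma del_card_live : #|[set d | a d != d]| = #|[set d | a' d != d]|.+2.
Proof.
rewrite del_live (cardsD1 r) inE ar eq_sym neq_rb.
by rewrite (cardsD1 b ([set _ | _] :\ r)) !inE del_ab eq_sym neq_rb.
Qed.

Lemma del_porbits : #|porbits phi'| + (r \notin porbit phi b).*2 =
  #|porbits phi| + 1.
Proof. by rewrite porbits_mul_tperm neq_rb. Qed.

Lemma del_connect_porbit x y : y \in porbit phi' x -> connect e' x y.
Proof.
rewrite mem_porbit_fconnect; apply: connect_sub => u v /eqP <-.
have -> : phi' = a' * (a * phi).
  have a'a' : a' * a' = 1 by apply/permP => z; rewrite permM del_aK perm1.
  by rewrite -del_vertex (mulgA a') a'a' mul1g.
exact/map_rel_face/del_aK.
Qed.
End Delete.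

Lemma del_porbits_sep (phi : {perm D}) r b : r != b ->
  r \notin porbit (tperm r b * phi) b ->
  #|porbits phi| + 1 = #|porbits (tperm r b * phi)|.
Proof.
move=> nrb sep; have := porbits_mul_tperm (tperm r b * phi) r b.
rewrite /= mulgA tperm2 mul1g sep nrb; lia.
Qed.

(** Induction on the edges, a deletion keeping the vertex permutation. If the two ends stay
    connected, the number of faces changes by one; if they separate, one face becomes two and one
    more representative in [hs] pays for it. This is Euler's inequality, [size hs] bounding the
    number of components. *)
Lemma genus_bound n phi a (hs : seq D) : involutive a ->
  #|[set d | a d != d]| = n.*2 ->
  (forall d, exists2 h, h \in hs & connect (map_rel (a * phi) a) d h) ->
  #|porbits (a * phi)| + #|porbits phi| <= n + (size hs).*2.
Proof.
elim: n phi a hs => [|n IH] phi a hs aK card_a cover.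
  have a1 : a = 1.
    apply/permP => x; rewrite perm1; apply/eqP/negPn/negP => nx.
    by move/eqP: card_a; rewrite cards_eq0 => /eqP/setP/(_ x); rewrite !inE nx.
  rewrite a1 mul1g addnn add0n leq_double.
  have sub : porbits phi \subset [seq porbit phi h | h <- hs].
    apply/subsetP => _ /imsetP[d _ ->]; have [h hhs dh] := cover d.
    apply/mapP; exists h => //; apply/eqP; rewrite eq_porbit_mem porbit_sym.
    rewrite mem_porbit_fconnect; move: dh; apply: connect_sub => u v.
    rewrite /map_rel /= a1 mul1g perm1 => /orP[] /eqP ->; last exact: connect0.
    exact: fconnect1.
  apply: leq_trans (subset_leq_card sub) _.
  by apply: leq_trans (card_size _) _; rewrite size_map.
have /set0Pn[r] : [set d | a d != d] != set0 by rewrite -cards_eq0 card_a.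
rewrite inE eq_sym; move b_def: (a r) => b neq_rb.
pose a' := a * tperm r b; pose phi' := tperm r b * phi.
have a'K : involutive a' by apply: del_aK.
have card_a' : #|[set d | a' d != d]| = n.*2.
  by have := del_card_live aK b_def neq_rb; rewrite card_a -/a' doubleS => -[].
have s'E : a' * phi' = a * phi by apply: del_vertex.
have sym' : connect_sym (map_rel (a * phi) a') by apply: map_rel_sym.
have conn d h := @del_connect a phi r b aK b_def d h; rewrite -/a' in conn.
have [rb|nrb] := boolP (connect (map_rel (a * phi) a') r b).
  have := IH phi' a' hs a'K card_a'; rewrite s'E => /(_ _) leq'.
  have {}leq' : #|porbits (a * phi)| + #|porbits phi'| <= n + (size hs).*2.
    apply: leq' => d; have [h hhs dh] := cover d; exists h => //.
    case/or3P: (conn _ _ dh) => [//|/andP[dr bh]|/andP[db rh]].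
      exact: connect_trans dr (connect_trans rb bh).
    by apply: connect_trans db (connect_trans _ rh); rewrite sym'.
  have := del_porbits phi neq_rb; rewrite -/phi'; lia.
have sep : r \notin porbit phi' b.
  apply: contra nrb => rb; rewrite sym'.
  exact: (del_connect_porbit aK b_def).
have := del_porbits_sep neq_rb sep; rewrite -/phi' => porbE.
have [h0 h0hs rh0] := cover r.
(* [h0] now represents only one of the two separated pieces; the new representative is the end of
   the deleted edge that lies in the other piece. *)
suff [z leq'] : exists z, forall d, exists2 h, h \in z :: hs &
    connect (map_rel (a * phi) a') d h.
  have := IH phi' a' (z :: hs) a'K card_a'; rewrite s'E => /(_ leq') /=.
  move=> le'; rewrite -(leq_add2r 1) -addnA porbE.
  by apply: leq_trans le' _; lia.
case/or3P: (conn _ _ rh0) => [rh|/andP[_ bh]|/andP[rb _]]; last by rewrite rb in nrb.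
  exists b => d; have [h hhs dh] := cover d.
  case/or3P: (conn _ _ dh) => [dh'|/andP[dr _]|/andP[db _]].
  - by exists h; rewrite ?inE ?hhs ?orbT.
  - by exists h0; rewrite ?inE ?h0hs ?orbT ?(connect_trans dr).
  - by exists b; rewrite ?inE ?eqxx.
exists r => d; have [h hhs dh] := cover d.
case/or3P: (conn _ _ dh) => [dh'|/andP[dr _]|/andP[db _]].
- by exists h; rewrite ?inE ?hhs ?orbT.
- by exists r; rewrite ?inE ?eqxx.
- by exists h0; rewrite ?inE ?h0hs ?orbT ?(connect_trans db).
Qed.

End Gluing.

(** * Recursion on sign words *)

Notation word := (seq 'I_3).
Local Open Scope nat_scope.

(** An empty word is a polygon whose sides are all glued: it must neither block the recursion nor
    consume edges. *)
Definition nonnil (ws : seq word) := [seq w <- ws | w != [::]].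

(* Number of ways of filling polygons with sides labelled by [ws], using n edges
   in all, with components that are spheres containing exactly one polygon: the
   first side e is glued either to a triangle with sides -e, or to another side -e
   of its polygon. *)
Fixpoint glue n (ws : seq word) : nat :=
  if n is n'.+1 then
    if nonnil ws is (e :: w) :: ws' then
      glue n' (((- e)%R :: (- e)%R :: w) :: ws') +
      \sum_(i < size w | nth ord0 w i == (- e)%R)
         glue n' (take i w :: drop i.+1 w :: ws')
    else 0
  else nonnil ws == [::].

Lemma nonnil_cat ws1 ws2 : nonnil (ws1 ++ ws2) = nonnil ws1 ++ nonnil ws2.
Proof. exact: filter_cat. Qed.

Lemma nonnil_id ws : nonnil (nonnil ws) = nonnil ws.
Proof. exact: filter_id. Qed.

Lemma glue_nonnil n ws : glue n (nonnil ws) = glue n ws.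
Proof. by case: n => [|n] /=; rewrite nonnil_id. Qed.

Lemma glue_nonnil_cat n ws1 ws2 : glue n (ws1 ++ nonnil ws2) = glue n (ws1 ++ ws2).
Proof. by rewrite -glue_nonnil nonnil_cat nonnil_id -nonnil_cat glue_nonnil. Qed.

Lemma nonnil_head ws w ws' : nonnil ws = w :: ws' -> w != [::].
Proof.
move=> defw; have: w \in nonnil ws by rewrite defw mem_head.
by rewrite mem_filter => /andP[].
Qed.

Lemma glueS n ws e w ws' : nonnil ws = (e :: w) :: ws' ->
  glue n.+1 ws = glue n (((- e)%R :: (- e)%R :: w) :: ws') +
      \sum_(i < size w | nth ord0 w i == (- e)%R)
         glue n (take i w :: drop i.+1 w :: ws').
Proof. by move=> /= ->. Qed.

(** Distinct polygons never interact, since each move replaces a word by words coming from the same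
    polygon; only the edges are shared out. *)
Lemma glue_cat n ws1 ws2 :
  glue n (ws1 ++ ws2) = \sum_(k < n.+1) glue k ws1 * glue (n - k) ws2.
Proof.
elim: n ws1 => [|n IH] ws1.
  by rewrite big_ord1 /= nonnil_cat; case: (nonnil ws1) => //=; case: eqP.
case def1: (nonnil ws1) => [|w ws].
  have g0 : glue 0 ws1 = 1 by rewrite /= def1.
  have gS k : glue k.+1 ws1 = 0 by rewrite /= def1.
  rewrite big_ord_recl g0 mul1n subn0.
  rewrite big1 ?addn0 => [|i _]; last by rewrite lift0 gS mul0n.
  by rewrite -[LHS]glue_nonnil nonnil_cat def1 glue_nonnil.
case: w def1 (nonnil_head def1) => // e w def1 _.
have g0 : glue 0 ws1 = 0 by rewrite /= def1.
rewrite big_ord_recl g0 mul0n add0n.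
rewrite (@glueS _ _ e w (ws ++ nonnil ws2)); last by rewrite nonnil_cat def1.
rewrite -!cat_cons glue_nonnil_cat IH.
under [X in _ + X = _]eq_bigr => i _ do rewrite -!cat_cons glue_nonnil_cat IH.
rewrite exchange_big -big_split; apply: eq_bigr => k _.
by rewrite lift0 subSS (glueS _ def1) mulnDl big_distrl.
Qed.

(** Colours close up around a polygon. Both moves respect this: a glued pair [e], [- e] contributes
    zero, and [e] equals the sum of two letters [- e] in Z/3. *)
Lemma glue_closed n ws : glue n ws != 0 ->
  {in ws, forall w : word, (\sum_(x <- w) x = 0)%R}.
Proof.
elim: n ws => [|n IH] ws.
  rewrite /= eqb0 negbK => /eqP nil w wws; case: (eqVneq w [::]) => [->|nw].
    by rewrite big_nil.
  by have: w \in nonnil ws by [rewrite mem_filter nw]; rewrite nil.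
case def: (nonnil ws) => [|w ws']; first by rewrite /= def.
case: w def (nonnil_head def) => // e w def _.
rewrite (glueS _ def) addn_eq0 negb_and => nz v vws.
have : (v == [::]) || (v \in nonnil ws) by rewrite mem_filter vws andbT orbN.
rewrite def inE => /or3P[/eqP->|/eqP-> {v vws}|vws']; first by rewrite big_nil.
  case/orP: nz => [/IH/(_ _ (mem_head _ _))|].
    rewrite !big_cons => /(canRL (addKr _)); rewrite addr0 opprK => sw.
    by apply/eqP; move: sw => /(canRL (addKr _)) ->; case: e {def}  => -[|[|[|]]].
  rewrite sum_nat_eq0 negb_forall => /existsP[i].
  rewrite negb_imply => /andP[/eqP wi /IH nz].
  have wE : w = take i w ++ nth ord0 w i :: drop i.+1 w.
    by rewrite -drop_nth ?cat_take_drop.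
  rewrite big_cons {}wE big_cat big_cons wi /= nz ?mem_head // add0r addrA subrr.
  by rewrite add0r nz // !inE eqxx orbT.
case/orP: nz => [/IH nz|]; first by apply: nz; rewrite inE vws' orbT.
rewrite sum_nat_eq0 negb_forall => /existsP[i].
by rewrite negb_imply => /andP[_ /IH nz]; apply: nz; rewrite !inE vws' !orbT.
Qed.

Lemma sumn_size_nonnil ws : sumn (map size (nonnil ws)) = sumn (map size ws).
Proof. by elim: ws => //= -[|x v] ws /= ->. Qed.

(** An edge has two sides, and each of the [m] triangles met on the way brings three. *)
Lemma glue_parity n ws : glue n ws != 0 ->
  exists m, sumn (map size ws) + 3 * m = n.*2.
Proof.
elim: n ws => [|n IH] ws.
  by rewrite /= eqb0 negbK -sumn_size_nonnil => /eqP -> /=; exists 0.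
case def: (nonnil ws) => [|w ws']; first by rewrite /= def.
case: w def (nonnil_head def) => // e w def _.
rewrite (glueS _ def) addn_eq0 negb_and -sumn_size_nonnil def /= => /orP[/IH[m /= sz]|].
  by exists m.+1; lia.
rewrite sum_nat_eq0 negb_forall => /existsP[i].
rewrite negb_imply => /andP[_ /IH[m] /=]; rewrite size_take size_drop ltn_ord => sz.
by exists m; have := ltn_ord i; lia.
Qed.

Local Open Scope group_scope.

(** * Gluing one edge *)

Section Polygons.
Variable D : finType.
Implicit Types (a phi : {perm D}) (L : {set D}) (x y r b d : D).
Implicit Types (p q : seq D) (ps : seq (seq D)) (c : D -> 'I_3).

Lemma fpath_transfer (f g : D -> D) x x' l z :
  fpath f x (rcons l z) -> g x' = f x -> {in l, g =1 f} ->
  fpath g x' (rcons l z).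
Proof.
elim: l x x' => [|y l IH] x x' /=; first by move=> ? ->.
case/andP=> /eqP fxy fl -> fg; rewrite fxy eqxx; apply: (IH y) => //.
  by rewrite fg ?mem_head.
by move=> u ul; rewrite fg // inE ul orbT.
Qed.

Lemma mem_porbit_cycle phi p x : fcycle phi p -> x \in p -> porbit phi x =i p.
Proof. by move=> cyc xp y; rewrite mem_porbit_fconnect (fconnect_cycle cyc xp). Qed.

Lemma fcycle_closed phi p x : fcycle phi p -> x \in p -> phi x \in p.
Proof. by move=> cyc xp; rewrite -(mem_porbit_cycle cyc xp) (mem_porbit phi 1). Qed.

Lemma fcycle_rotate phi p q r :
  fcycle phi (p ++ r :: q) = fpath phi r (rcons (q ++ p) r).
Proof.
by rewrite -(rot_cycle (size p)) rot_size_cat.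
Qed.

Definition step phi c d := (c (phi d) - c d)%R.
(** Glued darts stay in the cycles of the face permutation, as fixed points of the remaining
    involution, so that [D] never changes. Lying outside [L], they are skipped when the word is
    read. *)
Definition face_word phi L c p : word := [seq step phi c d | d <- p & d \in L].

(* [phi] turns around faces, [a] exchanges the two darts of an edge, so [a * phi]
   turns around vertices.  Only the darts of [L] remain to be glued.  The polygons
   [ps] are the faces revealed so far; the other faces are triangles.  Since there
   is one polygon per component, Euler's relation [gl_euler] makes each component a
   sphere. *)
Record polygons phi L ps c : Prop := {
  pol_uniq : uniq (flatten ps);
  pol_cycle : {in ps, forall p, fcycle phi p};
  pol_nil : [::] \notin ps;
  pol_out : forall d, d \notin flatten ps -> d \in L /\ #|porbit phi d| = 3;
  pol_col : {in flatten ps, forall d, (c (phi d) != c d) = (d \in L)} }.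

Record gluing phi L ps c0 n a c : Prop := {
  gl_inv : involutive a;
  gl_live : forall d, (a d != d) = (d \in L);
  gl_vertex : forall d, c (phi d) = c (a d);
  gl_edge : {in L, forall d, c (a d) != c d};
  gl_col : {in flatten ps, c =1 c0};
  gl_cover : forall d,
    exists2 x, x \in flatten ps & connect (map_rel (a * phi) a) d x;
  gl_sep : {in flatten ps &, forall x y,
    connect (map_rel (a * phi) a) x y -> y \in porbit phi x};
  gl_euler : #|porbits (a * phi)| + #|porbits phi| = n + (size ps).*2 }.

Definition gluings phi L ps c0 n : {set {perm D} * {ffun D -> 'I_3}} :=
  [set ac : {perm D} * {ffun D -> 'I_3} | `[< gluing phi L ps c0 n ac.1 ac.2 >]].

Lemma polygons_porbit phi L ps c p x : polygons phi L ps c ->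
  p \in ps -> x \in p -> porbit phi x =i p.
Proof. by move=> pol pps; apply/mem_porbit_cycle/(pol_cycle pol). Qed.

Lemma polygons_closed phi L ps c x : polygons phi L ps c ->
  x \in flatten ps -> phi x \in flatten ps.
Proof.
move=> pol /flattenP[p pps xp]; apply/flattenP; exists p => //.
by apply: fcycle_closed => //; apply: pol_cycle pol _ pps.
Qed.

Lemma del_phiE phi r b x : (tperm r b * phi) x =
  if x == r then phi b else if x == b then phi r else phi x.
Proof.
rewrite permM; case: eqP => [->|/eqP nxr]; first by rewrite tpermL.
case: eqP => [->|/eqP nxb]; first by rewrite tpermR.
by rewrite tpermD // eq_sym.
Qed.

Lemma eq_in_porbit phi phi' x :
  {in porbit phi x, phi' =1 phi} -> porbit phi' x = porbit phi x.
Proof.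
move=> eqf; apply/setP => y.
have itE i : (phi' ^+ i) x = (phi ^+ i) x.
  elim: i => [|i IH]; first by rewrite !expg0.
  by rewrite !expgSr !permM IH eqf // mem_porbit.
by apply/porbitP/porbitP => -[i ->]; exists i; rewrite itE.
Qed.

Lemma undel_inv a r b : involutive a -> a r = r -> a b = b ->
  involutive (a * tperm r b).
Proof.
move=> aK ar ab x; rewrite !permM.
case: (tpermP r b (a x)) => [e|e|/eqP nxr /eqP nxb].
- by rewrite ab tpermR -[RHS]aK e ar.
- by rewrite ar tpermL -[RHS]aK e ab.
- rewrite aK tpermD //; apply/eqP => e.
    by move: nxr; rewrite -e ar eqxx.
  by move: nxb; rewrite -e ab eqxx.
Qed.

Section DeleteEdge.
Variables (phi a : {perm D}) (L : {set D}) (r b : D).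
Hypotheses (aK : involutive a) (ar : a r = b) (neq_rb : r != b).
Hypotheses (rL : r \in L) (bL : b \in L).
Let a' := a * tperm r b.
Let phi' := tperm r b * phi.
Let L' := L :\ r :\ b.

Lemma del_liveP : (forall d, (a d != d) = (d \in L)) <->
  (forall d, (a' d != d) = (d \in L')).
Proof.
have ab : a b = r by rewrite -ar aK.
split=> live d; have := live d; rewrite (del_aE aK ar) !inE.
  by case: (d == r); case: (d == b); rewrite ?eqxx.
have [->|_] := eqVneq d r; first by rewrite ar (eq_sym b) neq_rb rL.
by have [->|_] //= := eqVneq d b; rewrite ab neq_rb bL.
Qed.

Lemma del_vertexP c : (forall d, c (phi d) = c (a d)) <->
  (forall d, c (phi' d) = c (a' d)).
Proof.
have ab : a b = r by rewrite -ar aK.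
split=> vtx d; rewrite ?del_phiE ?(del_aE aK ar).
  have [->|_] /= := eqVneq d r; first by rewrite vtx ab.
  by have [->|_] //= := eqVneq d b; rewrite vtx ar.
have := vtx (tperm r b d); rewrite del_phiE (del_aE aK ar).
case: tpermP => [->|->|/eqP/negPf-> /eqP/negPf->] //=.
  by rewrite [b == r]eq_sym (negPf neq_rb) !eqxx ar.
by rewrite !eqxx ab.
Qed.

Lemma del_edgeP c : c b != c r -> {in L, forall d, c (a d) != c d} <->
  {in L', forall d, c (a' d) != c d}.
Proof.
have ab : a b = r by rewrite -ar aK.
move=> cbr; split=> edge d.
  rewrite !inE (del_aE aK ar) => /and3P[/negPf-> /negPf-> dL] /=; exact: edge.
move=> dL; have [->|ndr] := eqVneq d r; first by rewrite ar.
have [->|ndb] := eqVneq d b; first by rewrite ab eq_sym.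
have := edge d; rewrite !inE (del_aE aK ar) (negPf ndr) (negPf ndb) /=.
exact.
Qed.
End DeleteEdge.

Lemma del_phi_id phi r b x : x != r -> x != b -> (tperm r b * phi) x = phi x.
Proof. by move=> nxr nxb; rewrite del_phiE (negPf nxr) (negPf nxb). Qed.

Lemma del_face_word phi L r b c p : r \notin p -> b \notin p ->
  face_word (tperm r b * phi) (L :\ r :\ b) c p = face_word phi L c p.
Proof.
move=> rp bp; have nx x : x \in p -> (x != r) * (x != b).
  by move=> xp; split; apply: contraTneq xp => ->.
rewrite /face_word; have -> : [seq x <- p | x \in L :\ r :\ b] = [seq x <- p | x \in L].
  by apply: eq_in_filter => x xp; rewrite !inE !nx.
apply/eq_in_map => x; rewrite mem_filter => /andP[_ xp].
by rewrite /step del_phi_id ?nx.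
Qed.

Lemma face_word_cat phi L c p q :
  face_word phi L c (p ++ q) = face_word phi L c p ++ face_word phi L c q.
Proof. by rewrite /face_word filter_cat map_cat. Qed.

Lemma polygons_eq_porbit phi L ps c x y : polygons phi L ps c ->
  x \in flatten ps -> y \in porbit phi x -> y \in flatten ps.
Proof.
move=> pol /flattenP[p pps xp]; rewrite (polygons_porbit pol pps xp) => yp.
by apply/flattenP; exists p.
Qed.

(** * Gluing two sides of the same polygon *)

Section Split.
Variables (phi : {perm D}) (L : {set D}) (ps1 ps2 : seq (seq D)).
Variables (p1 q1 q2 : seq D) (r b : D) (c0 : D -> 'I_3).
Let p := p1 ++ r :: q1 ++ b :: q2.
Let ps := ps1 ++ p :: ps2.
Let ps' := ps1 ++ (b :: q1) :: (p1 ++ r :: q2) :: ps2.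
Let phi' := tperm r b * phi.
Let L' := L :\ r :\ b.
Hypotheses (pol : polygons phi L ps c0) (rL : r \in L) (bL : b \in L).
Hypotheses (c0b : c0 b = c0 (phi r)) (c0r : c0 (phi b) = c0 r).

Lemma split_perm : perm_eq (flatten ps') (flatten ps).
Proof.
clear pol rL bL c0b c0r.
apply/seq.permP => P; rewrite /ps /ps' /p !flatten_cat /= !count_cat /= !count_cat /=.
lia.
Qed.

Lemma split_mem : flatten ps' =i flatten ps.
Proof. exact/perm_mem/split_perm. Qed.

Lemma split_notin x : x \in [:: r; b] ->
  [/\ x \notin flatten ps1, x \notin flatten ps2, x \notin p1, x \notin q1
    & x \notin q2] /\ r != b.
Proof.
clear rL bL c0b c0r.
have cnt y : count_mem y (flatten ps) <= 1.
  by rewrite count_uniq_mem ?leq_b1 //; apply: pol_uniq pol.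
have neq_rb : r != b.
  apply: contraTneq (cnt r) => rb; rewrite /ps /p !flatten_cat /= !count_cat /=.
  by rewrite !count_cat /= -rb !eqxx; lia.
have cntE := cnt x; rewrite /ps /p !flatten_cat /= !count_cat /= !count_cat /= in cntE.
rewrite !inE => xrb.
have xrb1 : ((r == x) + (b == x) = 1)%N.
  case/orP: xrb => /eqP ->; rewrite eqxx; first by rewrite eq_sym (negPf neq_rb).
  by rewrite (negPf neq_rb).
split=> //; split; apply/count_memPn; move: xrb1 cntE;
  move: (r == x) (b == x) (count_mem x p1) (count_mem x q1) (count_mem x q2)
    (count_mem x (flatten ps1)) (count_mem x (flatten ps2)); lia.
Qed.

Let neq_rb : r != b. Proof. by case: (@split_notin r); rewrite ?inE ?eqxx. Qed.
Let p_ps : p \in ps. Proof. by rewrite mem_cat mem_head orbT. Qed.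
Let rp : r \in p. Proof. by rewrite mem_cat mem_head orbT. Qed.
Let bp : b \in p. Proof. by rewrite mem_cat !inE mem_cat mem_head !orbT. Qed.
Let r_fl : r \in flatten ps. Proof. by apply/flattenP; exists p. Qed.
Let b_fl : b \in flatten ps. Proof. by apply/flattenP; exists p. Qed.

Let phi'_id x : x != r -> x != b -> phi' x = phi x.
Proof. exact: del_phi_id. Qed.

Lemma split_cycle1 : fcycle phi' (b :: q1).
Proof.
have := pol_cycle pol p_ps; rewrite fcycle_rotate -catA cat_cons -cat_rcons.
rewrite rcons_cat cat_path => /andP[path1 _].
apply: (fpath_transfer path1); first by rewrite del_phiE eq_sym (negPf neq_rb) eqxx.
have [[_ _ _ rq _] _] := @split_notin r (mem_head _ _).
have [|[_ _ _ bq _] _] := @split_notin b; first by rewrite !inE eqxx orbT.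
by move=> x xq; apply: phi'_id; apply: contraTneq xq => ->.
Qed.

Lemma split_cycle2 : fcycle phi' (p1 ++ r :: q2).
Proof.
have := pol_cycle pol p_ps; rewrite !fcycle_rotate -catA cat_cons -cat_rcons.
rewrite rcons_cat cat_path last_rcons => /andP[_ path2].
apply: (fpath_transfer path2); first by rewrite del_phiE eqxx.
have [[_ _ rp1 _ rq] _] := @split_notin r (mem_head _ _).
have [|[_ _ bp1 _ bq] _] := @split_notin b; first by rewrite !inE eqxx orbT.
move=> x; rewrite mem_cat => xqp; apply: phi'_id; apply: contraTneq xqp => ->.
  by rewrite negb_or rq rp1.
by rewrite negb_or bq bp1.
Qed.

Lemma split_other_id p0 x : p0 \in ps1 ++ ps2 -> x \in p0 -> phi' x = phi x.
Proof.
have [[rps1 rps2 _ _ _] _] := @split_notin r (mem_head _ _).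
have [|[bps1 bps2 _ _ _] _] := @split_notin b; first by rewrite !inE eqxx orbT.
rewrite mem_cat => p0ps xp0.
have: x \in flatten ps1 ++ flatten ps2.
  rewrite mem_cat; case/orP: p0ps => p0ps; apply/orP; [left|right];
    by apply/flattenP; exists p0.
rewrite mem_cat => xps; apply: phi'_id; apply: contraTneq xps => ->.
  by rewrite negb_or rps1.
by rewrite negb_or bps1.
Qed.

Lemma split_polygons : polygons phi' L' ps' c0.
Proof.
have other p0 : p0 \in ps1 ++ ps2 -> fcycle phi' p0.
  move=> p0ps; have := pol_cycle pol (_ : p0 \in ps).
  rewrite mem_cat inE orbCA -mem_cat p0ps orbT => /(_ isT).
  have := split_other_id p0ps; case: p0 {p0ps} => // x p0 id_p0 path0.
  apply: (fpath_transfer path0); first by rewrite id_p0 ?mem_head.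
  by move=> y yp0; rewrite id_p0 // inE yp0 orbT.
split.
- by rewrite (perm_uniq split_perm); apply: pol_uniq pol.
- move=> p0; rewrite mem_cat !inE => p0ps'.
  have : [|| p0 == b :: q1, p0 == p1 ++ r :: q2 | p0 \in ps1 ++ ps2].
    by rewrite mem_cat; move: p0ps'; do 4!case: (_ \in _) || case: (_ == _).
  case/or3P=> [/eqP->|/eqP->|]; [exact: split_cycle1|exact: split_cycle2|exact: other].
- have := pol_nil pol; rewrite !mem_cat !inE !negb_or => /and3P[-> _ ->].
  by case: (p1).
- move=> d; rewrite split_mem => d_out; have [dL d3] := pol_out pol d_out.
  have nd x : x \in flatten ps -> d != x by move=> xfl; apply: contraNneq d_out => ->.
  rewrite !inE dL !nd //; split=> //; rewrite -d3; congr #|pred_of_set _|.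
  apply: eq_in_porbit => x xd; rewrite phi'_id //.
    by apply: contraNneq d_out => xr; apply: (polygons_eq_porbit pol r_fl); rewrite -xr porbit_sym.
  by apply: contraNneq d_out => xb; apply: (polygons_eq_porbit pol b_fl); rewrite -xb porbit_sym.
move=> d; rewrite split_mem => dfl; rewrite !inE.
have [->|ndr] := eqVneq d r; first by rewrite /phi' del_phiE eqxx c0r eqxx andbF.
have [->|ndb] := eqVneq d b.
  by rewrite /phi' del_phiE (eq_sym b) (negPf neq_rb) eqxx c0b eqxx.
by rewrite phi'_id //=; apply: pol_col pol _ dfl.
Qed.

Lemma split_sub x y : x \in flatten ps -> y \in porbit phi' x -> y \in porbit phi x.
Proof.
move=> xfl; have := xfl; rewrite -split_mem => /flattenP[p0 p0ps' xp0].
rewrite (polygons_porbit split_polygons p0ps' xp0) => yp0.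
have sub : p0 \in ps1 ++ ps2 \/ {subset p0 <= p}.
  move: p0ps'; rewrite !mem_cat !inE => /or4P[->|/eqP->|/eqP->|->]; rewrite ?orbT; try by left.
    by right=> z; rewrite !(mem_cat, inE) => /orP[] ->; rewrite ?orbT.
  by right=> z; rewrite !(mem_cat, inE) => /or3P[] ->; rewrite ?orbT.
case: sub => [p0ps|sub]; last by rewrite (polygons_porbit pol p_ps) ?sub.
by rewrite (polygons_porbit pol (_ : p0 \in ps)) // mem_cat inE orbCA -mem_cat p0ps orbT.
Qed.

Lemma split_gluing n a c : #|L| = n.+1.*2 -> involutive a -> a r = b ->
  gluing phi L ps c0 n.+1 a c <-> gluing phi' L' ps' c0 n (a * tperm r b) c.
Proof.
move=> cardL aK ar; set a' := a * tperm r b.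
have a'K : involutive a' by apply: del_aK.
have s'E : a' * phi' = a * phi by apply: del_vertex.
have ab : a b = r by rewrite -ar aK.
have conn d h := @del_connect D a phi r b aK ar d h; rewrite -/a' in conn.
have conn' d h := @del_connect_sub D a phi r b aK ar d h; rewrite -/a' in conn'.
have face' x y : y \in porbit phi' x -> connect (map_rel (a * phi) a') x y.
  exact: (del_connect_porbit aK ar).
have face x y : y \in porbit phi x -> connect (map_rel (a * phi) a) x y.
  rewrite mem_porbit_fconnect; apply: connect_sub => u v /eqP <-.
  have -> : phi u = (a * (a * phi)) u by rewrite !permM aK.
  exact: map_rel_face.
have sym : connect_sym (map_rel (a * phi) a) by apply: map_rel_sym.
have sym' : connect_sym (map_rel (a * phi) a') by apply: map_rel_sym.
have porbE : (#|porbits phi'| = #|porbits phi| + 1)%N.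
  have := del_porbits phi neq_rb; rewrite -/phi'.
  have -> : r \in porbit phi b by rewrite (polygons_porbit pol p_ps bp).
  by rewrite addn0.
have sizeE : size ps' = (size ps).+1 by rewrite !size_cat /= !addnS.
split=> [[_ live vtx edge col cover sep euler]|[_ live vtx edge col cover sep euler]].
  have live' := (del_liveP aK ar neq_rb rL bL).1 live.
  (* If the ends remained connected, the polygons of [ps] would still meet every component, and
     [genus_bound] would contradict Euler's relation: an edge is lost while a face is gained. *)
  have nrb : ~~ connect (map_rel (a * phi) a') r b.
    apply/negP => rb.
    have := @genus_bound D n phi' a' (map (head r) ps) a'K.
    have -> : [set d | a' d != d] = L' by apply/setP => d; rewrite inE live'.
    rewrite (cardsD1 r) (cardsD1 b (L :\ r)) rL !inE (eq_sym b) neq_rb bL /= in cardL.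
    case: cardL => cardL; rewrite s'E size_map => /(_ cardL) bound.
    suff : #|porbits (a * phi)| + #|porbits phi'| <= n + (size ps).*2 by lia.
    apply: bound => d; have [x /flattenP[p0 p0ps xp0] dx] := cover d.
    exists (head r p0); first exact: map_f.
    have hp0 : head r p0 \in p0 by case: (p0) xp0 => // y p0' _; apply: mem_head.
    have xh : connect (map_rel (a * phi) a) x (head r p0).
      by apply: face; rewrite (polygons_porbit pol p0ps xp0).
    have := conn _ _ (connect_trans dx xh).
    case/or3P=> [//|/andP[dr bh]|/andP[db rh]].
      exact: connect_trans dr (connect_trans rb bh).
    by apply: connect_trans db (connect_trans _ rh); rewrite sym'.
  split=> //.
  - exact: (del_vertexP _ aK ar neq_rb c).1.
  - have cbr : c b != c r by rewrite -ar; apply: edge.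
    exact: (del_edgeP L aK ar cbr).1.
  - by move=> d; rewrite split_mem => /col.
  - move=> d; have [x xfl dx] := cover d; rewrite s'E.
    case/or3P: (conn _ _ dx) => [dx'|/andP[dr _]|/andP[db _]].
    + by exists x; rewrite ?split_mem.
    + by exists r; rewrite ?split_mem.
    + by exists b; rewrite ?split_mem.
  - move=> x y; rewrite !split_mem s'E => xfl yfl xy.
    have yx : y \in porbit phi x by apply: sep => //; apply: conn'.
    have [xp|xnp] := boolP (x \in p).
      move: yx; rewrite (polygons_porbit pol p_ps xp) => yp.
      have inp z : z \in p -> (z \in b :: q1) || (z \in p1 ++ r :: q2).
        rewrite !(mem_cat, inE); case: (z \in p1); case: (z == r); case: (z \in q1);
          case: (z == b); case: (z \in q2) => //.
      have P1 : b :: q1 \in ps' by rewrite mem_cat mem_head orbT.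
      have P2 : p1 ++ r :: q2 \in ps' by rewrite mem_cat !inE eqxx !orbT.
      have r2 : r \in p1 ++ r :: q2 by rewrite mem_cat mem_head orbT.
      have to1 z : z \in b :: q1 -> connect (map_rel (a * phi) a') b z.
        by move=> zq; apply: face'; rewrite (polygons_porbit split_polygons P1 (mem_head _ _)).
      have to2 z : z \in p1 ++ r :: q2 -> connect (map_rel (a * phi) a') r z.
        by move=> zq; apply: face'; rewrite (polygons_porbit split_polygons P2 r2).
      case/orP: (inp _ xp) => x12; case/orP: (inp _ yp) => y12.
      + by rewrite (polygons_porbit split_polygons P1 x12).
      + case/negP: nrb; apply: connect_trans (to2 _ y12) _.
        by apply: connect_trans (_ : connect _ y x) _; rewrite sym' // to1.
      + case/negP: nrb; apply: connect_trans (to2 _ x12) _.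
        by apply: connect_trans xy _; rewrite sym' to1.
      + by rewrite (polygons_porbit split_polygons P2 x12).
    have [p0 p0ps xp0] := flattenP xfl.
    have p0ps12 : p0 \in ps1 ++ ps2.
      move: p0ps; rewrite !mem_cat inE => /or3P[->//|/eqP p0E|->]; last by rewrite orbT.
      by rewrite p0E (negPf xnp) in xp0.
    rewrite (@eq_in_porbit phi phi') // => z.
    by rewrite (polygons_porbit pol p0ps xp0); apply: split_other_id.
  - by rewrite s'E porbE sizeE; lia.
have live0 := (del_liveP aK ar neq_rb rL bL).2 live.
rewrite s'E in cover sep euler.
(* Conversely the two pieces are distinct polygons, hence lie in distinct components by [gl_sep]. *)
have nrb : ~~ connect (map_rel (a * phi) a') r b.
  apply/negP => rb; have := sep r b; rewrite !split_mem => /(_ r_fl b_fl rb).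
  have P2 : p1 ++ r :: q2 \in ps' by rewrite mem_cat !inE eqxx !orbT.
  have r2 : r \in p1 ++ r :: q2 by rewrite mem_cat mem_head orbT.
  rewrite (polygons_porbit split_polygons P2 r2) mem_cat inE.
  have [|[_ _ bp1 _ bq] _] := @split_notin b; first by rewrite !inE eqxx orbT.
  by rewrite (negPf bp1) (negPf bq) orbF eq_sym (negPf neq_rb).
have col0 : {in flatten ps, c =1 c0} by move=> d; rewrite -split_mem => /col.
have vtx0 := (del_vertexP phi aK ar neq_rb c).2 vtx.
split=> //.
- have cbr : c b != c r by rewrite !col0 // c0b (pol_col pol).
  exact: (del_edgeP L aK ar cbr).2.
- move=> d; have [x xfl dx] := cover d.
  by exists x; rewrite -?split_mem //; apply: conn'.
- move=> x y xfl yfl /conn.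
  case/or3P=> [xy|/andP[xr by']|/andP[xb ry]].
  + by apply: split_sub => //; apply: sep; rewrite ?split_mem.
  + have yb : y \in porbit phi b by apply: split_sub => //; apply: sep; rewrite ?split_mem.
    have : r \in porbit phi x by apply: split_sub => //; apply: sep; rewrite ?split_mem.
    rewrite porbit_sym (polygons_porbit pol p_ps rp) => xp.
    by rewrite (polygons_porbit pol p_ps xp) -(polygons_porbit pol p_ps bp).
  + have yb : y \in porbit phi r by apply: split_sub => //; apply: sep; rewrite ?split_mem.
    have : b \in porbit phi x by apply: split_sub => //; apply: sep; rewrite ?split_mem.
    rewrite porbit_sym (polygons_porbit pol p_ps bp) => xp.
    by rewrite (polygons_porbit pol p_ps xp) -(polygons_porbit pol p_ps rp).
- by move: euler; rewrite porbE sizeE; lia.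
Qed.

End Split.

(** * Gluing a side of a polygon to a hidden triangle *)

Section Merge.
Variables (phi : {perm D}) (L : {set D}) (ps1 ps2 : seq (seq D)).
Variables (p1 p2 : seq D) (r b : D) (c0 : D -> 'I_3).
Let p := p1 ++ r :: p2.
Let ps := ps1 ++ p :: ps2.
Let b1 := phi b.
Let b2 := phi b1.
Let p' := p1 ++ [:: r, b1, b2, b & p2].
Let ps' := ps1 ++ p' :: ps2.
Let phi' := tperm r b * phi.
Let L' := L :\ r :\ b.
(** Gluing [r] to [b] identifies their ends crosswise, which gives the colours at [b] and [phi b].
    The last corner takes the third colour, equal to [- x - y] because the three elements of Z/3 add
    up to zero. *)
Definition merge_col d : 'I_3 :=
  if d == b then c0 (phi r) else if d == phi b then c0 r
  else if d == phi (phi b) then (- c0 r - c0 (phi r))%R else c0 d.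
Hypotheses (pol : polygons phi L ps c0) (rL : r \in L).
Hypothesis b_out : b \notin flatten ps.

Lemma merge_perm : perm_eq (flatten ps') ([:: b; b1; b2] ++ flatten ps).
Proof.
clear pol rL b_out.
apply/seq.permP => P; rewrite /ps /ps' /p /p' !flatten_cat /= !count_cat /= ?count_cat /=.
lia.
Qed.

Lemma merge_mem x : (x \in flatten ps') = (x \in [:: b; b1; b2]) || (x \in flatten ps).
Proof. by rewrite (perm_mem merge_perm) mem_cat. Qed.

Lemma merge_triangle : [/\ phi b2 = b, uniq [:: b; b1; b2] & porbit phi b =i [:: b; b1; b2]].
Proof.
have [_ b3] := pol_out pol b_out.
have := iter_porbit phi b; rewrite b3 => /= phi3.
have := uniq_traject_porbit phi b; rewrite b3 => uniq3.
by split=> // x; rewrite porbit_traject b3.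
Qed.

Lemma merge_disjoint x : x \in [:: b; b1; b2] -> x \notin flatten ps.
Proof.
have [_ _ porbE] := merge_triangle.
rewrite -porbE => xb; apply: contra b_out => xfl.
by apply: (polygons_eq_porbit pol xfl); rewrite porbit_sym.
Qed.

Lemma merge_in_L x : x \in [:: b; b1; b2] -> x \in L.
Proof. by move/merge_disjoint/(pol_out pol) => []. Qed.

Let p_ps : p \in ps. Proof. by rewrite mem_cat mem_head orbT. Qed.
Let p'_ps' : p' \in ps'. Proof. by rewrite mem_cat mem_head orbT. Qed.
Let rp : r \in p. Proof. by rewrite mem_cat mem_head orbT. Qed.
Let rp' : r \in p'. Proof. by rewrite mem_cat mem_head orbT. Qed.
Let bp' : b \in p'. Proof. by rewrite mem_cat !inE eqxx !orbT. Qed.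
Let r_fl : r \in flatten ps. Proof. by apply/flattenP; exists p. Qed.
Let neq_rb : r != b. Proof. by apply: contraNneq b_out => <-. Qed.
Let bL : b \in L. Proof. by apply: merge_in_L; rewrite mem_head. Qed.
Let phi'_id x : x != r -> x != b -> phi' x = phi x.
Proof. exact: del_phi_id. Qed.
Let phi'r : phi' r = b1. Proof. by rewrite /phi' del_phiE eqxx. Qed.
Let phi'b : phi' b = phi r.
Proof. by rewrite /phi' del_phiE (eq_sym b) (negPf neq_rb) eqxx. Qed.

Lemma merge_notin : [/\ r \notin flatten ps1, r \notin flatten ps2,
  r \notin p1 & r \notin p2].
Proof.
clear rL b_out bL neq_rb.
have cnt : count_mem r (flatten ps) <= 1.
  by rewrite count_uniq_mem ?leq_b1 //; apply: pol_uniq pol.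
rewrite /ps /p !flatten_cat /= !count_cat /= eqxx /= in cnt.
by split; apply/count_memPn; move: cnt;
  move: (count_mem r p1) (count_mem r p2)
    (count_mem r (flatten ps1)) (count_mem r (flatten ps2)); lia.
Qed.

Let neq_r_tri x : x \in [:: b; b1; b2] -> x != r.
Proof. by move/merge_disjoint => x_out; apply: contraNneq x_out => ->. Qed.

Lemma merge_cycle : fcycle phi' p'.
Proof.
have [phib2 uniq3 _] := merge_triangle.
have := pol_cycle pol p_ps; rewrite !fcycle_rotate /= phi'r eqxx /=.
have b1r : b1 != r by apply: neq_r_tri; rewrite !inE eqxx orbT.
have b2r : b2 != r by apply: neq_r_tri; rewrite !inE eqxx !orbT.
move: uniq3; rewrite /= !inE negb_or => /andP[/andP[bb1 bb2] _].
rewrite !phi'_id ?(eq_sym _ b) // phib2 !eqxx /= => path_r.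
apply: (fpath_transfer path_r) => // x xp; apply: phi'_id.
  have [_ _ rp1 rp2] := merge_notin.
  by apply: contraTneq xp => ->; rewrite mem_cat negb_or rp1 rp2.
apply: contraNneq b_out => <-; apply/flattenP; exists p => //.
by move: xp; rewrite !mem_cat !inE => /orP[] ->; rewrite ?orbT.
Qed.

Lemma merge_fl_neq x : x \in flatten ps ->
  [/\ (x == b) = false, (x == b1) = false & (x == b2) = false].
Proof.
move=> xfl; have nx y : y \in [:: b; b1; b2] -> (x == y) = false.
  by move=> /merge_disjoint yfl; apply: contraNF yfl => /eqP <-.
by split; apply: nx; rewrite !inE eqxx ?orbT.
Qed.

Lemma merge_col_fl : {in flatten ps, merge_col =1 c0}.
Proof. by move=> x /merge_fl_neq[nb nb1 nb2]; rewrite /merge_col nb nb1 nb2. Qed.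

Lemma merge_other_id p0 x : p0 \in ps1 ++ ps2 -> x \in p0 -> phi' x = phi x.
Proof.
have [rps1 rps2 _ _] := merge_notin.
rewrite mem_cat => p0ps xp0.
have: x \in flatten ps1 ++ flatten ps2.
  rewrite mem_cat; case/orP: p0ps => p0ps; apply/orP; [left|right];
    by apply/flattenP; exists p0.
rewrite mem_cat => xps; apply: phi'_id; apply: contraTneq xps => ->.
  by rewrite negb_or rps1.
move: b_out; rewrite /ps flatten_cat /= !mem_cat !negb_or => /and3P[-> _ ->].
by [].
Qed.

Let triE : [/\ merge_col b = c0 (phi r), merge_col b1 = c0 r
  & merge_col b2 = (- c0 r - c0 (phi r))%R].
Proof.
have [_ uniq3 _] := merge_triangle; move: uniq3.
rewrite /= !inE negb_or => /and3P[/andP[bb1 bb2] b12 _].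
rewrite /merge_col eqxx !(eq_sym _ b) -/b1 -/b2 (negPf bb1) (negPf bb2) !eqxx.
by rewrite (eq_sym b2) (negPf b12).
Qed.

Lemma third_color (x y : 'I_3) : y != x ->
  [/\ (- x - y)%R != x, y != (- x - y)%R, ((- x - y) - x = - (y - x))%R
    & (y - (- x - y) = - (y - x))%R].
Proof. by case: x y => -[|[|[|//]]] ? [[|[|[|//]]] ?] //; split=> //; apply: val_inj. Qed.

Let col_r : c0 (phi r) != c0 r. Proof. by rewrite (pol_col pol) // rL. Qed.

Lemma merge_polygons : polygons phi' L' ps' merge_col.
Proof.
have [phib2 uniq3 porbE] := merge_triangle.
have [_ uniq3'] := (tt, uniq3); move: uniq3'.
rewrite /= !inE negb_or => /and3P[/andP[bb1 bb2] b12 _].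
have [colb colb1 colb2] := triE.
have b1r : b1 != r by apply: neq_r_tri; rewrite !inE eqxx orbT.
have b2r : b2 != r by apply: neq_r_tri; rewrite !inE eqxx !orbT.
split.
- rewrite (perm_uniq merge_perm) cat_uniq uniq3 (pol_uniq pol) andbT /=.
  by apply/hasPn => x xfl; apply: contraL xfl; apply: merge_disjoint.
- move=> p0; rewrite mem_cat inE orbCA -mem_cat => /predU1P[->|p0ps].
    exact: merge_cycle.
  have := pol_cycle pol (_ : p0 \in ps).
  rewrite mem_cat inE orbCA -mem_cat p0ps orbT => /(_ isT).
  have := merge_other_id p0ps; case: p0 {p0ps} => // x p0 id_p0 path0.
  apply: (fpath_transfer path0); first by rewrite id_p0 ?mem_head.
  by move=> y yp0; rewrite id_p0 // inE yp0 orbT.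
- have := pol_nil pol; rewrite !mem_cat !inE !negb_or => /and3P[-> _ ->].
  by rewrite /p'; case: (p1).
- move=> d; rewrite merge_mem negb_or => /andP[d_tri d_out].
  have [dL d3] := pol_out pol d_out.
  have ndr : d != r by apply: contraNneq d_out => ->.
  have ndb : d != b by apply: contraNneq d_tri => ->; rewrite mem_head.
  rewrite !inE dL ndr ndb; split=> //; rewrite -d3; congr #|pred_of_set _|.
  apply: eq_in_porbit => x xd; rewrite phi'_id //.
    apply: contraNneq d_out => xr; apply: (polygons_eq_porbit pol r_fl).
    by rewrite -xr porbit_sym.
  by apply: contraNneq d_tri => xb; rewrite -porbE -xb porbit_sym.
have [n1 n2 _ _] := third_color col_r.
move=> d; rewrite merge_mem => /orP[|dfl].
  rewrite !inE => /or3P[] /eqP ->.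
  - by rewrite phi'b colb merge_col_fl ?eqxx ?(polygons_closed pol).
  - rewrite phi'_id ?(eq_sym b1 b) // -/b2 colb1 colb2 n1 ?(eq_sym b1 b) bb1 b1r.
    by rewrite merge_in_L // !inE eqxx orbT.
  - rewrite phi'_id ?(eq_sym b2 b) // phib2 colb colb2 n2 ?(eq_sym b2 b) bb2 b2r.
    by rewrite merge_in_L // !inE eqxx !orbT.
rewrite !inE; have [->|ndr] := eqVneq d r.
  by rewrite phi'r colb1 merge_col_fl ?eqxx ?andbF.
have [ndb _ _] := merge_fl_neq dfl.
rewrite ndb phi'_id ?ndb //= !merge_col_fl ?(pol_col pol) //.
exact: polygons_closed pol _.
Qed.

Lemma merge_face_word_other p0 : p0 \in ps1 ++ ps2 ->
  face_word phi' L' merge_col p0 = face_word phi L c0 p0.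
Proof.
move=> p0ps; have p0ps' : p0 \in ps by rewrite mem_cat inE orbCA -mem_cat p0ps orbT.
rewrite del_face_word; last first.
- by apply: contra b_out => bp0; apply/flattenP; exists p0.
- have [rps1 rps2 _ _] := merge_notin; apply/negP => rp0.
  move: p0ps; rewrite mem_cat => /orP[] p0ps.
    by case/negP: rps1; apply/flattenP; exists p0.
  by case/negP: rps2; apply/flattenP; exists p0.
apply/eq_in_map => x; rewrite mem_filter => /andP[_ xp0].
have xfl : x \in flatten ps by apply/flattenP; exists p0.
by rewrite /step !merge_col_fl // (polygons_closed pol).
Qed.

(** A triangle with three distinct colours has three equal steps, and that of [b] is opposite to the
    step of [r]; hence two new letters for the two sides left free. *)
Lemma merge_face_word : face_word phi' L' merge_col p' =
  face_word phi L c0 p1 ++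
  [:: - step phi c0 r, - step phi c0 r & face_word phi L c0 p2]%R.
Proof.
have [phib2 uniq3 porbE] := merge_triangle; move: uniq3.
rewrite /= !inE negb_or => /and3P[/andP[bb1 bb2] b12 _].
have [_ _ rp1 rp2] := merge_notin.
have [colb colb1 colb2] := triE.
have [_ _ n3 n4] := third_color col_r.
have b1r : b1 != r by apply: neq_r_tri; rewrite !inE eqxx orbT.
have b2r : b2 != r by apply: neq_r_tri; rewrite !inE eqxx !orbT.
have b1L : b1 \in L by rewrite merge_in_L // !inE eqxx orbT.
have b2L : b2 \in L by rewrite merge_in_L // !inE eqxx !orbT.
have sub q : {subset q <= p} -> r \notin q ->
    face_word phi' L' merge_col q = face_word phi L c0 q.
  move=> qp rq; have qfl x : x \in q -> x \in flatten ps.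
    by move=> xq; apply/flattenP; exists p => //; apply: qp.
  rewrite del_face_word //; last by apply: contra b_out; apply: qfl.
  apply/eq_in_map => x; rewrite mem_filter => /andP[_ /qfl xfl].
  by rewrite /step !merge_col_fl // (polygons_closed pol).
rewrite /p' face_word_cat sub //; last by move=> x xp1; rewrite mem_cat xp1.
congr (_ ++ _); rewrite /face_word /= !inE !eqxx (eq_sym b1 b) (eq_sym b2 b).
rewrite bb1 bb2 b1r b2r b1L b2L andbF /=.
rewrite {1 2}/step !phi'_id ?(eq_sym b1 b) ?(eq_sym b2 b) // -/b2 phib2.
rewrite colb colb1 colb2 n3 n4; congr [:: _, _ & _].
by apply: sub => // x xp2; rewrite mem_cat inE xp2 !orbT.
Qed.

(** [r] and [b] lie on one cycle of [phi'], so deleting their edge changes no component; Euler's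
    relation loses one edge and one face. *)
Lemma merge_gluing n a c : involutive a -> a r = b ->
  gluing phi L ps c0 n.+1 a c <->
  gluing phi' L' ps' merge_col n (a * tperm r b) c.
Proof.
move=> aK ar; set a' := a * tperm r b.
have a'K : involutive a' by apply: del_aK.
have s'E : a' * phi' = a * phi by apply: del_vertex.
have ab : a b = r by rewrite -ar aK.
have [phib2 uniq3 porbE] := merge_triangle.
have [colb colb1 colb2] := triE.
have conn d h := @del_connect D a phi r b aK ar d h; rewrite -/a' in conn.
have conn' d h := @del_connect_sub D a phi r b aK ar d h; rewrite -/a' in conn'.
have face' x y : y \in porbit phi' x -> connect (map_rel (a * phi) a') x y.
  exact: (del_connect_porbit aK ar).
have sym' : connect_sym (map_rel (a * phi) a') by apply: map_rel_sym.
have porb_p' := polygons_porbit merge_polygons p'_ps'.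
have rb : connect (map_rel (a * phi) a') r b.
  by apply: face'; rewrite porb_p'.
have connE x y : connect (map_rel (a * phi) a) x y = connect (map_rel (a * phi) a') x y.
  apply/idP/idP=> [/conn|]; last exact: conn'.
  case/or3P=> [//|/andP[xr by']|/andP[xb ry]].
    exact: connect_trans xr (connect_trans rb by').
  by apply: connect_trans xb (connect_trans _ ry); rewrite sym'.
have porbsE : (#|porbits phi'| + 1 = #|porbits phi|)%N.
  have := del_porbits phi neq_rb; rewrite -/phi'.
  have -> : r \notin porbit phi b.
    by rewrite porbE; apply: contraTN r_fl; apply: merge_disjoint.
  by rewrite (_ : (~~ false).*2 = 1 + 1)%N // addnA => /addIn.
have sizeE : size ps' = size ps by rewrite !size_cat.
have fl_sub x : x \in flatten ps -> x \in flatten ps'.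
  by rewrite merge_mem => ->; rewrite orbT.
have p'E x : (x \in p') = (x \in [:: b; b1; b2]) || (x \in p).
  rewrite !(mem_cat, inE).
  by case: (x \in p1); case: (x == r); case: (x == b); case: (x == b1); case: (x == b2); case: (x \in p2).
have other x : x \in flatten ps -> x \notin p -> porbit phi' x = porbit phi x.
  move=> /flattenP[p0 p0ps xp0] xnp; apply: eq_in_porbit => z.
  rewrite (polygons_porbit pol p0ps xp0); apply: merge_other_id.
  move: p0ps; rewrite !mem_cat inE => /or3P[->//|/eqP p0E|->]; last by rewrite orbT.
  by rewrite p0E (negPf xnp) in xp0.
split=> [[_ live vtx edge col cover sep euler]|[_ live vtx edge col cover sep euler]].
  have live' := (del_liveP aK ar neq_rb rL bL).1 live.
  have vtx' := (del_vertexP phi aK ar neq_rb c).1 vtx.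
  have cb : c b = c0 (phi r) by rewrite -ar -vtx col // (polygons_closed pol).
  have cb1 : c b1 = c0 r by rewrite vtx ab col.
  have tri_edge x : x \in [:: b; b1; b2] -> c (phi x) != c x.
    by move=> x3; rewrite vtx edge // merge_in_L.
  split=> //.
  - have cbr : c b != c r by rewrite -ar; apply: edge.
    exact: (del_edgeP L aK ar cbr).1.
  - move=> d; rewrite merge_mem => /orP[|dfl]; last by rewrite col // merge_col_fl.
    rewrite !inE => /or3P[] /eqP ->; rewrite ?cb ?cb1 ?colb ?colb1 ?colb2 //.
    (* The colour at [b2] is forced, since it differs from the two known colours of the triangle. *)
    have := tri_edge b1; rewrite !inE eqxx orbT -/b2 cb1 => /(_ isT).
    have := tri_edge b2; rewrite !inE eqxx !orbT phib2 cb => /(_ isT).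
    move: col_r; case: (c b2) => -[|[|[|//]]] ?; case: (c0 r) => -[|[|[|//]]] ?;
      by case: (c0 (phi r)) => -[|[|[|//]]] ? //= *; apply: val_inj.
  - move=> d; have [x xfl dx] := cover d; rewrite s'E.
    by exists x; rewrite -?connE // fl_sub.
  - have main x y : x \in p' -> y \in flatten ps' -> connect (map_rel (a * phi) a) x y -> y \in p'.
      move=> xp'; rewrite merge_mem p'E => /orP[->//|yfl] xy; apply/orP; right.
      have rx : connect (map_rel (a * phi) a) r x.
        by rewrite connE; apply: face'; rewrite porb_p'.
      by rewrite -(polygons_porbit pol p_ps rp) sep // (connect_trans rx).
    have symc : connect_sym (map_rel (a * phi) a) by apply: map_rel_sym.
    move=> x y xfl yfl; rewrite s'E -connE => xy.
    have [xp'|xnp'] := boolP (x \in p'); first by rewrite porb_p' // (main x).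
    have [yp'|ynp'] := boolP (y \in p').
      by case/negP: xnp'; apply: (main y) => //; rewrite symc.
    have split_fl z : z \in flatten ps' -> z \notin p' ->
        z \in flatten ps /\ z \notin p.
      by rewrite merge_mem p'E negb_or; case: (z \in [:: b; b1; b2]).
    have [x_fl xnp] := split_fl x xfl xnp'.
    have [y_fl _] := split_fl y yfl ynp'.
    by rewrite other // sep.
  - by rewrite s'E sizeE; apply/eqP; rewrite -(eqn_add2r 1) -addnA porbsE euler addn1.
have live0 := (del_liveP aK ar neq_rb rL bL).2 live.
rewrite s'E in cover sep euler.
have vtx0 := (del_vertexP phi aK ar neq_rb c).2 vtx.
have col0 : {in flatten ps, c =1 c0}.
  by move=> d dfl; rewrite col ?fl_sub // merge_col_fl.
have cb : c b = c0 (phi r) by rewrite col ?colb // merge_mem mem_head.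
split=> //.
- have cbr : c b != c r by rewrite cb col0.
  exact: (del_edgeP L aK ar cbr).2.
- move=> d; have [x] := cover d; rewrite merge_mem => /orP[x3 dx|xfl dx].
    exists r => //; rewrite connE; apply: connect_trans dx _.
    by rewrite sym'; apply: face'; rewrite porb_p' // p'E x3.
  by exists x => //; rewrite connE.
- move=> x y xfl yfl; rewrite connE => xy.
  have := sep x y (fl_sub _ xfl) (fl_sub _ yfl) xy.
  have [xp|xnp] := boolP (x \in p).
    rewrite porb_p' ?p'E ?xp ?orbT // (polygons_porbit pol p_ps xp) => /orP[|//].
    by move/merge_disjoint; rewrite yfl.
  by rewrite other.
- by rewrite -porbsE addnA euler sizeE addn1.
Qed.

End Merge.

End Polygons.

(** * Counting gluings *)

(** Positions in a word count free darts only; this converts them into cuts of the whole cycle. *)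
Lemma filter_split (T : eqType) (x0 : T) (P : pred T) (s : seq T) i :
  i < size (filter P s) -> exists q1 q2,
  [/\ s = q1 ++ nth x0 (filter P s) i :: q2, filter P q1 = take i (filter P s)
    & filter P q2 = drop i.+1 (filter P s)].
Proof.
elim: s i => //= x s IH i; case: ifP => Px.
  case: i => [|i] /=; first by exists [::], s; rewrite drop0.
  rewrite ltnS => /IH[q1 [q2 [sE f1 f2]]].
  by exists (x :: q1), q2; rewrite /= Px f1 -sE.
by case/IH=> q1 [q2 [sE f1 f2]]; exists (x :: q1), q2; rewrite /= Px f1 -sE.
Qed.

Section Count.
Variable D : finType.
Implicit Types (a phi : {perm D}) (L : {set D}) (x y r b d : D).
Implicit Types (p q : seq D) (ps : seq (seq D)) (c : D -> 'I_3).

Lemma gluingsP phi L ps c0 n (ac : {perm D} * {ffun D -> 'I_3}) :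
  reflect (gluing phi L ps c0 n ac.1 ac.2) (ac \in gluings phi L ps c0 n).
Proof. by rewrite inE; apply: asboolP. Qed.

Lemma polygons_card_porbits phi L ps c :
  polygons phi L ps c -> (forall d, d \in flatten ps) ->
  #|porbits phi| = size ps.
Proof.
move=> pol cover; pose P p := [set x in p].
have uniqP : uniq (map P ps).
  have := pol_uniq pol; have := pol_nil pol; elim: (ps) => //= p qs IH.
  rewrite inE negb_or cat_uniq => /andP[p_nil nil] /and3P[_ disj uniq_qs].
  rewrite IH // andbT; apply/mapP => -[q q_qs eqPQ].
  case: p p_nil disj eqPQ => // x p _ /hasPn disj /setP/(_ x).
  rewrite !inE eqxx /= => /esym xq.
  suff xfl : x \in flatten qs by move: (disj x xfl); rewrite /= mem_head.
  by apply/flattenP; exists q.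
rewrite -(size_map P) -(card_uniqP uniqP); apply: eq_card => A; apply/imsetP/mapP.
  move=> [d _ ->]; have /flattenP[p pps dp] := cover d.
  by exists p => //; apply/setP => x; rewrite inE (polygons_porbit pol pps).
move=> [p pps ->]; case: p pps => [|x p] pps; first by have := pol_nil pol; rewrite pps.
exists x => //; apply/setP => y.
by rewrite inE (polygons_porbit pol pps) ?mem_head.
Qed.

Lemma card_gluings0 phi ps c0 : polygons phi set0 ps c0 ->
  #|gluings phi set0 ps c0 0| = 1%N.
Proof.
move=> pol; have cover d : d \in flatten ps.
  by apply/negPn/negP => /(pol_out pol) []; rewrite inE.
rewrite (_ : gluings _ _ _ _ _ = [set (1, finfun c0)]) ?cards1 //.
apply/setP => -[a c]; rewrite inE [in RHS]inE; apply/asboolP/eqP => /= [gl|[-> ->]].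
  congr (_, _).
    by apply/permP => d; rewrite perm1; have := gl_live gl d; rewrite inE => /negbFE/eqP.
  by apply/ffunP => d; rewrite ffunE (gl_col gl).
split=> [d|d|d|d|d _|d|x y _ _|].
- by rewrite !perm1.
- by rewrite perm1 eqxx inE.
- have := pol_col pol (cover d); rewrite inE => /negbFE/eqP.
  by rewrite perm1 !ffunE.
- by rewrite inE.
- by rewrite ffunE.
- by exists d; rewrite ?connect0.
- rewrite mul1g mem_porbit_fconnect; apply: connect_sub => u v.
  rewrite /map_rel /= perm1 => /orP[] /eqP ->; [exact: fconnect1|exact: connect0].
- by rewrite mul1g addnn (polygons_card_porbits pol).
Qed.

Lemma card_delete_edge (G G' : {set {perm D} * {ffun D -> 'I_3}}) r b :
  (forall a (c : {ffun D -> 'I_3}), (a, c) \in G -> involutive a) ->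
  (forall a (c : {ffun D -> 'I_3}), (a, c) \in G' -> [/\ involutive a, a r = r & a b = b]) ->
  (forall a (c : {ffun D -> 'I_3}), involutive a -> a r = b ->
     (a, c) \in G <-> (a * tperm r b, c) \in G') ->
  #|[set ac in G | ac.1 r == b]| = #|G'|.
Proof.
move=> inv inv' iffG; pose f (ac : {perm D} * {ffun D -> 'I_3}) := (ac.1 * tperm r b, ac.2).
have injf : injective f by move=> [a c] [a2 c2] [/mulIg -> ->].
rewrite -(card_preimset G' injf); apply: eq_card => -[a c].
rewrite !inE /f /=; apply/andP/idP => [[acG /eqP ar]|].
  by apply/iffG => //; apply: inv acG.
move=> acG'; have [a'K a'r a'b] := inv' _ _ acG'.
have aE : a = a * tperm r b * tperm r b by rewrite -mulgA tperm2 mulg1.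
have aK : involutive a by rewrite aE; apply: undel_inv.
have ar : a r = b by rewrite aE permM a'r tpermL.
by split; [apply/iffG|apply/eqP].
Qed.

Lemma face_word_sum phi L c r q z : fpath phi r (rcons q z) ->
  {in q, forall d, (c (phi d) != c d) = (d \in L)} ->
  (\sum_(x <- face_word phi L c q) x = c z - c (phi r))%R.
Proof.
elim: q r => [|y q IH] r /=.
  by move=> /andP[/eqP -> _] _; rewrite big_nil subrr.
case/andP=> /eqP ry path_q col; have colq : {in q, forall d, (c (phi d) != c d) = (d \in L)}.
  by move=> d dq; apply: col; rewrite inE dq orbT.
rewrite /face_word /=; have := col y (mem_head _ _); case: ifP => yL.
  by move=> _; rewrite /= big_cons (IH y) // /step ry addrC addrA subrK.
by move/negbFE/eqP=> cy; rewrite (IH y) // ry cy.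
Qed.

Lemma size_face_words phi L c ps :
  sumn (map size [seq face_word phi L c p | p <- ps]) =
  size [seq d <- flatten ps | d \in L].
Proof. by elim: ps => //= p ps ->; rewrite filter_cat size_cat size_map. Qed.

(** * Counting by the partner of the first free side *)

Section Step.
Variables (n m : nat) (phi : {perm D}) (L : {set D}) (ps1 ps2 : seq (seq D)).
Variables (p1 p2 : seq D) (r : D) (c0 : D -> 'I_3).
Let ps := ps1 ++ (p1 ++ r :: p2) :: ps2.
Let words ps := [seq face_word phi L c0 p | p <- ps].
Let w := face_word phi L c0 p2.
Let e := step phi c0 r.
Hypotheses (pol : polygons phi L ps c0) (rL : r \in L) (cardL : #|L| = n.+1.*2).
Hypothesis card_out : #|~: [set x in flatten ps]| = (3 * m)%N.
Hypotheses (words1 : nonnil (words ps1) = [::]) (word1 : face_word phi L c0 p1 = [::]).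
Hypothesis IH : forall m phi L ps c0, polygons phi L ps c0 -> #|L| = n.*2 ->
  #|~: [set x in flatten ps]| = (3 * m)%N ->
  #|gluings phi L ps c0 n| =
  (3 ^ m * m`! * glue n [seq face_word phi L c0 p | p <- ps])%N.

Let G := gluings phi L ps c0 n.+1.
Let G_ b := [set ac in G | ac.1 r == b].

Let p_ps : p1 ++ r :: p2 \in ps. Proof. by rewrite mem_cat mem_head orbT. Qed.
Let rp : r \in p1 ++ r :: p2. Proof. by rewrite mem_cat mem_head orbT. Qed.
Let r_fl : r \in flatten ps. Proof. by apply/flattenP; exists (p1 ++ r :: p2). Qed.

Lemma card_live_del b : b \in L -> r != b -> #|L :\ r :\ b| = n.*2.
Proof.
move=> bL rb; move: cardL.
by rewrite (cardsD1 r) (cardsD1 b (L :\ r)) rL !inE (eq_sym b) rb bL /= => -[].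
Qed.

(** The count is the same for all hidden darts [b]; summing over the 3m of them will turn 3^(m-1)
    (m-1)! into 3^m m!. *)
Lemma card_gluings_out b : b \notin flatten ps ->
  #|G_ b| = (3 ^ m.-1 * m.-1`! *
    glue n (([:: - e, - e & w]%R) :: nonnil (words ps2)))%N.
Proof.
move=> b_out; have [bL _] := pol_out pol b_out.
have rb : r != b by apply: contraNneq b_out => <-.
set phi' := tperm r b * phi; set L' := L :\ r :\ b.
set p' := p1 ++ [:: r, phi b, phi (phi b), b & p2].
set ps' := ps1 ++ p' :: ps2.
have pol' : polygons phi' L' ps' (merge_col phi r b c0) by apply: merge_polygons.
have -> : #|G_ b| = #|gluings phi' L' ps' (merge_col phi r b c0) n|.
  apply: card_delete_edge => [a c /gluingsP/gl_inv//|a c /gluingsP gl|a c aK ar].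
    split; first exact: gl_inv gl.
      by have := gl_live gl r; rewrite !inE eqxx /= andbF => /negbFE/eqP.
    by have := gl_live gl b; rewrite !inE eqxx /= => /negbFE/eqP.
  have := @merge_gluing D phi L ps1 ps2 p1 p2 r b c0 pol rL b_out n a c aK ar.
  by move=> [h1 h2]; split=> /gluingsP /= gl; apply/gluingsP; [apply: h1|apply: h2].
have [_ uniq3 _] := merge_triangle pol b_out.
rewrite (IH (m := m.-1) pol'); last first.
- have perm' : perm_eq (flatten ps') ([:: b; phi b; phi (phi b)] ++ flatten ps).
    exact: merge_perm.
  have cardC (qs : seq (seq D)) : uniq (flatten qs) ->
      #|~: [set x in flatten qs]| = (#|D| - size (flatten qs))%N.
    move=> uq; rewrite cardsCs setCK; congr (_ - _)%N.
    by rewrite cardsE (card_uniqP uq).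
  rewrite cardC ?(pol_uniq pol') // (perm_size perm') size_cat /=.
  have := card_out; rewrite cardC ?(pol_uniq pol) // => szE.
  by move: szE; move: (size _) #|D| => u v; lia.
- exact: card_live_del.
congr (_ * _)%N; rewrite -glue_nonnil.
have words_other qs : {subset qs <= ps1 ++ ps2} ->
    [seq face_word phi' L' (merge_col phi r b c0) p | p <- qs] = words qs.
  by move=> sub; apply/eq_in_map => q /sub q12; apply: (merge_face_word_other pol).
rewrite map_cat /= !words_other; last 2 first.
- by move=> q qps; rewrite mem_cat qps orbT.
- by move=> q qps; rewrite mem_cat qps.
rewrite (merge_face_word pol _ b_out) // word1 /= nonnil_cat words1.
by rewrite -[in RHS]glue_nonnil /= nonnil_id.
Qed.

Let qs := [seq d <- p2 | d \in L].

Lemma gluings_in_poly b a (c : {ffun D -> 'I_3}) : (a, c) \in G -> a r = b -> b \in flatten ps ->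
  [/\ b \in qs, step phi c0 b = (- e)%R & c0 b = c0 (phi r)].
Proof.
move=> /gluingsP /= gl ar b_fl.
have ab : a b = r by rewrite -ar (gl_inv gl).
have rb : r != b by rewrite eq_sym -ar (gl_live gl).
have bL : b \in L by rewrite -(gl_live gl) ab.
have bE : c0 b = c0 (phi r).
  by rewrite -!(gl_col gl) ?(polygons_closed pol) // (gl_vertex gl) ar.
have rE : c0 (phi b) = c0 r.
  by rewrite -!(gl_col gl) ?(polygons_closed pol) // (gl_vertex gl) ab.
split=> //; last by rewrite /e /step bE rE opprB.
have : b \in porbit phi r by apply: (gl_sep gl) => //; rewrite -ar connect_a.
rewrite (polygons_porbit pol p_ps rp) mem_cat inE eq_sym (negPf rb) /= mem_filter bL /=.
case/orP=> // bp1; have : step phi c0 b \in face_word phi L c0 p1.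
  by apply/map_f; rewrite mem_filter bL.
by rewrite word1.
Qed.

Lemma card_gluings_in i : i < size qs ->
  #|G_ (nth r qs i)| = if nth ord0 w i == (- e)%R then
    (3 ^ m * m`! * glue n (take i w :: drop i.+1 w :: nonnil (words ps2)))%N else 0%N.
Proof.
move=> lt_i; have [q1 [q2 [p2E f1 f2]]] := @filter_split D r (mem L) p2 i lt_i.
rewrite -/qs in p2E f1 f2; move: p2E f1 f2; set b := nth r qs i => p2E f1 f2.
have b_qs : b \in qs by apply: mem_nth.
have bL : b \in L by move: b_qs; rewrite mem_filter => /andP[].
have bp : b \in p1 ++ r :: p2 by rewrite mem_cat inE p2E mem_cat mem_head !orbT.
have b_fl : b \in flatten ps by apply/flattenP; exists (p1 ++ r :: p2).
have wi : nth ord0 w i = step phi c0 b by rewrite (nth_map r).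
have w1 : take i w = face_word phi L c0 q1 by rewrite /w /face_word -map_take -f1.
have w2 : drop i.+1 w = face_word phi L c0 q2 by rewrite /w /face_word -map_drop -f2.
have empty : (step phi c0 b = (- e)%R /\ c0 b = c0 (phi r) -> False) -> #|G_ b| = 0%N.
  move=> no; apply/eqP; rewrite cards_eq0; apply/eqP/setP => -[a c]; rewrite in_set0 /G_ in_set.
  apply/negP => /andP[acG /eqP ar]; apply: no.
  by have [] := gluings_in_poly acG ar b_fl.
case: eqP => [stepb|nstep]; last by apply: empty => -[]; rewrite -wi.
rewrite wi in stepb.
have rE : ps = ps1 ++ (p1 ++ r :: q1 ++ b :: q2) :: ps2 by rewrite /ps -p2E.
have pol2 := pol; rewrite rE in pol2.
(* A letter [- e] does not ensure that the colours at the ends match. When they do not, there is no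
   gluing, and the recursive term vanishes as well because the letters of [take i w] do not add up
   to zero. *)
have [c0b|nc0b] := eqVneq (c0 b) (c0 (phi r)); last first.
  rewrite empty; last by case=> _ /eqP; rewrite (negPf nc0b).
  apply/esym/eqP; rewrite muln_eq0; apply/orP; right; apply/negPn/negP => nz.
  have /(_ _ (mem_head _ _)) := glue_closed nz; rewrite w1.
  have := pol_cycle pol p_ps; rewrite p2E fcycle_rotate -catA cat_cons -cat_rcons.
  rewrite rcons_cat cat_path => /andP[path1 _].
  rewrite (face_word_sum path1); first by move/eqP; rewrite subr_eq0 (negPf nc0b).
  move=> d dq; apply: (pol_col pol); apply/flattenP; exists (p1 ++ r :: p2) => //.
  by rewrite mem_cat inE p2E mem_cat dq !orbT.
have c0r : c0 (phi b) = c0 r.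
  by move: stepb; rewrite /e /step c0b opprB => /addIr.
have [_ rb] := @split_notin D phi L ps1 ps2 p1 q1 q2 r b c0 pol2 r (mem_head _ _).
set phi' := tperm r b * phi; set L' := L :\ r :\ b.
set ps' := ps1 ++ (b :: q1) :: (p1 ++ r :: q2) :: ps2.
have pol' : polygons phi' L' ps' c0 by apply: split_polygons.
have -> : #|G_ b| = #|gluings phi' L' ps' c0 n|.
  apply: card_delete_edge => [a c /gluingsP/gl_inv//|a c /gluingsP gl|a c aK ar].
    split; first exact: gl_inv gl.
      by have := gl_live gl r; rewrite !inE eqxx /= andbF => /negbFE/eqP.
    by have := gl_live gl b; rewrite !inE eqxx /= => /negbFE/eqP.
  have := @split_gluing D phi L ps1 ps2 p1 q1 q2 r b c0 pol2 rL bL c0b c0r n a c cardL aK ar.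
  rewrite -rE => -[h1 h2].
  by split=> /gluingsP /= gl; apply/gluingsP; [apply: h1|apply: h2].
rewrite (IH (m := m) pol'); last first.
- rewrite -card_out; congr #|pred_of_set _|; apply/setP => x; rewrite !inE rE.
  by congr (~~ _); apply: split_mem.
- exact: card_live_del.
congr (_ * _)%N; rewrite -glue_nonnil.
have del_word q : {subset q <= flatten ps1} \/ {subset q <= flatten ps2} \/
    {subset q <= p1} \/ {subset q <= q1} \/ {subset q <= q2} ->
    face_word phi' L' c0 q = face_word phi L c0 q.
  have := @split_notin D phi L ps1 ps2 p1 q1 q2 r b c0 pol2 r (mem_head _ _).
  have := @split_notin D phi L ps1 ps2 p1 q1 q2 r b c0 pol2 b.
  rewrite !inE eqxx orbT => /(_ isT)[[b1 b2 b3 b4 b5] _] [[r1 r2 r3 r4 r5] _] sub.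
  apply: del_face_word.
    by case: sub => [|[|[|[|]]]] sub; [apply: contra r1|apply: contra r2|apply: contra r3|apply: contra r4|apply: contra r5]; apply: sub.
  by case: sub => [|[|[|[|]]]] sub; [apply: contra b1|apply: contra b2|apply: contra b3|apply: contra b4|apply: contra b5]; apply: sub.
rewrite map_cat /=.
have -> : [seq face_word phi' L' c0 p | p <- ps1] = words ps1.
  apply/eq_in_map => q q_ps; apply: del_word; left => x xq.
  by apply/flattenP; exists q.
have -> : [seq face_word phi' L' c0 p | p <- ps2] = words ps2.
  apply/eq_in_map => q q_ps; apply: del_word; right; left => x xq.
  by apply/flattenP; exists q.
have -> : face_word phi' L' c0 (b :: q1) = take i w.
  rewrite w1 -[RHS]del_word; last by do 3!right; left.
  by rewrite /face_word /= !inE eqxx.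
have -> : face_word phi' L' c0 (p1 ++ r :: q2) = drop i.+1 w.
  rewrite w2 -[RHS]del_word; last by do 4!right.
  rewrite face_word_cat del_word; last by right; right; left.
  by rewrite word1 /face_word /= !inE eqxx andbF.
rewrite nonnil_cat words1 cat0s -[in RHS]glue_nonnil.
by congr (glue n _); rewrite /= nonnil_id.
Qed.

Lemma card_gluings_step :
  #|G| = (3 ^ m * m`! * glue n.+1 (words ps))%N.
Proof.
have -> : #|G| = (\sum_b #|G_ b|)%N.
  rewrite -sum1_card (partition_big (fun ac : {perm D} * {ffun D -> 'I_3} => ac.1 r) xpredT) //=.
  by apply: eq_bigr => b _; rewrite -sum1_card; apply: eq_bigl => ac; rewrite !inE.
have headE : nonnil (words ps) = (e :: w) :: nonnil (words ps2).
  by rewrite /words /ps map_cat nonnil_cat words1 /= face_word_cat word1 /face_word /= rL.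
rewrite (glueS n headE) mulnDr (bigID (mem (flatten ps))) /= addnC.
congr (_ + _)%N.
  rewrite (eq_bigr _ card_gluings_out) sum_nat_const.
  have -> : #|[pred b | b \notin flatten ps]| = (3 * m)%N.
    by rewrite -card_out; apply: eq_card => x; rewrite !inE.
  have [m0|m_gt0] := posnP m; last first.
    by rewrite mulnA; congr (_ * _)%N; case: m m_gt0 => // k _; rewrite factS expnS /=; ring.
  (* With no hidden triangle, the triangle term of the recursion must vanish: its words would have
     2n+3 letters, more than the 2n sides of [n] edges. *)
  rewrite m0 !mul0n; apply/esym/eqP; rewrite muln_eq0; apply/orP; right.
  apply/negPn/negP => /glue_parity[k] /= par.
  have szE := sumn_size_nonnil (words ps); rewrite headE /= size_face_words in szE.
  suff szL : size [seq d <- flatten ps | d \in L] = n.+1.*2.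
    by move: szE par; rewrite szL /=; move: (size w) (sumn _) => u v; lia.
  rewrite -cardL -(card_uniqP _) ?filter_uniq ?(pol_uniq pol) //.
  apply: eq_card => x; rewrite mem_filter.
  have : x \in flatten ps; last by move=> ->; rewrite andbT.
  apply/negPn/negP => x_out; move/eqP: card_out; rewrite m0 muln0 cards_eq0.
  by move/eqP/setP/(_ x); rewrite !inE x_out.
rewrite (bigID (mem qs)) /= [X in (_ + X)%N]big1 ?addn0 => [|b /andP[b_fl b_qs]]; last first.
  apply/eqP; rewrite cards_eq0; apply/eqP/setP => -[a c]; rewrite in_set0 /G_ in_set.
  apply/negP => /andP[acG /eqP ar]; case/negP: b_qs.
  by have [] := gluings_in_poly acG ar b_fl.
have qs_fl b : b \in qs -> b \in flatten ps.
  rewrite mem_filter => /andP[_ bp2]; apply/flattenP; exists (p1 ++ r :: p2) => //.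
  by rewrite mem_cat inE bp2 !orbT.
have uniq_qs : uniq qs.
  apply: filter_uniq; have := pol_uniq pol; rewrite /ps flatten_cat /= !cat_uniq /=.
  by case/and3P=> _ _ /and3P[/and3P[_ _ /andP[]]].
rewrite (eq_bigl (mem qs)) => [|b]; last first.
  by rewrite andbC /=; case: (boolP (b \in qs)) => // /qs_fl ->.
rewrite -big_uniq //= (big_nth r) big_mkord.
rewrite (eq_bigr _ (fun (i : 'I_(size qs)) _ => card_gluings_in (ltn_ord i))).
rewrite -big_mkcond big_distrr /=.
have -> : size w = size qs by rewrite size_map.
by [].
Qed.

End Step.

Theorem card_gluings n m phi L ps c0 :
  polygons phi L ps c0 -> #|L| = n.*2 -> #|~: [set x in flatten ps]| = (3 * m)%N ->
  #|gluings phi L ps c0 n| =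
  (3 ^ m * m`! * glue n [seq face_word phi L c0 p | p <- ps])%N.
Proof.
elim: n m phi L ps c0 => [|n IH] m phi L ps c0 pol cardL card_out.
  have L0 : L = set0 by apply/eqP; rewrite -cards_eq0 cardL.
  rewrite L0 in pol *; rewrite card_gluings0 //.
  have m0 : m = 0%N.
    have : #|~: [set x in flatten ps]| = 0%N.
      apply/eqP; rewrite cards_eq0; apply/eqP/setP => x; rewrite !inE.
      by apply/negbTE/negP => /(pol_out pol)[]; rewrite inE.
    by rewrite card_out; lia.
  rewrite m0 /= (_ : nonnil _ = [::]) //; elim: (ps) => //= p qs ->.
  rewrite (_ : face_word _ _ _ _ = [::]) // /face_word (@eq_filter _ _ pred0).
    by rewrite filter_pred0.
  by move=> d; rewrite inE.
(* Without a free side the polygon darts form a union of components, so the free darts of hidden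
   triangles would contradict [gl_cover]. *)
have [hasL|noL] := boolP (has (has (mem L)) ps); last first.
  have no_live x : x \in flatten ps -> x \notin L.
    move/flattenP=> [p pps xp]; apply: contraNN noL => xL.
    by apply/hasP; exists p => //; apply/hasP; exists x.
  have -> : glue n.+1 [seq face_word phi L c0 p | p <- ps] = 0%N.
    rewrite /= (_ : nonnil _ = [::]) //.
    elim: (ps) no_live => //= p qs IHqs no; rewrite IHqs; last first.
      by move=> x xqs; apply: no; rewrite mem_cat xqs orbT.
    rewrite (_ : face_word _ _ _ _ = [::]) // /face_word.
    rewrite (_ : [seq d <- p | d \in L] = [::]) //.
    by apply/eqP; rewrite -[_ == _]negbK -has_filter; apply/hasPn => x xp; apply: no; rewrite mem_cat xp.
  rewrite muln0; apply/eqP; rewrite cards_eq0; apply/eqP/setP => -[a c].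
  rewrite [RHS]inE; apply/negP => /gluingsP /= gl.
  have /set0Pn[r rL] : L != set0 by rewrite -cards_eq0 cardL.
  have [x xfl rx] := gl_cover gl r.
  have sym : connect_sym (map_rel (a * phi) a) by apply/map_rel_sym/(gl_inv gl).
  have cl : closed (map_rel (a * phi) a) (mem (flatten ps)).
    apply: (intro_closed sym) => u v uv ufl.
    have au : a u = u by apply/eqP; rewrite -[_ == _]negbK (gl_live gl) no_live.
    move: uv; rewrite /map_rel /= permM au => /orP[] /eqP -> //.
    exact: polygons_closed pol _.
  have := closed_connect cl rx; rewrite /= xfl => r_fl.
  by move: (no_live r r_fl); rewrite rL.
move defps: ps hasL pol card_out => qs hasL; case/split_find: hasL defps => p ps1 ps2 hasp nops1 _.
case/split_find: hasp => r p1 p2 rL nop1.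
rewrite cat_rcons cat_rcons => pol card_out.
apply: card_gluings_step => //.
  elim: (ps1) nops1 => //= q qs1 IHq; rewrite negb_or => /andP[nq /IHq ->].
  by rewrite /face_word; move: nq; rewrite has_filter negbK => /eqP ->.
by rewrite /face_word; move: nop1; rewrite has_filter negbK => /eqP ->.
Qed.

End Count.

(** * Counting rooted maps *)

Section CycleType.
Variable D : finType.
Implicit Types (phi : {perm D}) (E : {set D}) (x y z d : D).

(** Candidate face permutations of near-triangulations; the support [E] is a parameter so that darts
    can be removed one at a time. *)
Definition rooted_tri E x k : {set {perm D}} :=
  [set phi | [&& perm_on E phi, #|porbit phi x| == k
     & [forall d in E :\: porbit phi x, #|porbit phi d| == 3]]].

Lemma rooted_triP E x k phi :
  reflect [/\ perm_on E phi, #|porbit phi x| = k &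
    {in E, forall d, d \notin porbit phi x -> #|porbit phi d| = 3}]
    (phi \in rooted_tri E x k).
Proof.
rewrite inE; apply: (iffP and3P) => [[onE /eqP xk /forall_inP tri]|[onE xk tri]].
  by split=> // d dE dx; apply/eqP/tri; rewrite !inE dx.
by split=> //; [apply/eqP|apply/forall_inP => d; rewrite !inE => /andP[dx dE]; apply/eqP/tri].
Qed.

(** [tperm x y] inserts the fixed point [y] just after [x]; read backwards, this shortens the root
    cycle by one dart. *)
Lemma porbit_insert phi x y : phi y = y -> x != y ->
  [/\ porbit (tperm x y * phi) x = y |: porbit phi x, y \notin porbit phi x
    & forall d, d \notin porbit (tperm x y * phi) x ->
        porbit (tperm x y * phi) d = porbit phi d].
Proof.
move=> phiy nxy; set psi := tperm x y * phi.
have y_out : y \notin porbit phi x.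
  rewrite porbit_sym mem_porbit_fconnect; apply/negP => /iter_findex.
  have -> : iter (findex phi y x) phi y = y by elim: (findex _ _ _) => //= i ->.
  by move/esym/eqP; rewrite (negPf nxy).
have psiE d : psi d = if d == x then y else if d == y then phi x else phi d.
  by rewrite /psi del_phiE phiy.
have orbE : porbit psi x = y |: porbit phi x.
  have orb_phi d : (d \in porbit phi x) = (d \in fingraph.orbit phi x).
    by rewrite mem_porbit_fconnect fconnect_orbit.
  have cyc_phi := cycle_orbit (@perm_inj _ phi) x; have uniq_phi := fingraph.orbit_uniq phi x.
  move: orb_phi cyc_phi uniq_phi; rewrite /fingraph.orbit -orderSpred trajectS.
  move: (traject _ _ _) => l orb_phi cyc_phi /= /andP[xl _].
  have cyc : fcycle psi [:: x, y & l].
    rewrite /= psiE eqxx /= eqxx /=; apply: (fpath_transfer cyc_phi).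
      by rewrite psiE eq_sym (negPf nxy) eqxx.
    move=> d dl; rewrite psiE; case: eqP => [dx|_]; first by rewrite -dx dl in xl.
    case: eqP => [dy|//]; case/negP: y_out.
    by rewrite orb_phi -dy inE dl orbT.
  apply/setP => d; rewrite (mem_porbit_cycle cyc (mem_head _ _)) !inE orb_phi inE.
  by rewrite orbCA.
split=> // d; rewrite orbE !inE negb_or => /andP[dy dx]; apply: eq_in_porbit => z zd.
rewrite psiE; case: eqP => [zx|_].
  by case/negP: dx; rewrite porbit_sym -zx.
case: eqP => [zy|//]; case/negP: dy; move: zd; rewrite zy.
rewrite porbit_sym mem_porbit_fconnect => /iter_findex.
have -> : iter (findex phi y d) phi y = y by elim: (findex _ _ _) => //= i ->.
by move=> ->.
Qed.

Lemma perm_on_fix E phi y : perm_on E phi -> y \notin E -> phi y = y.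
Proof. by move=> onE yE; apply: out_perm onE yE. Qed.

Lemma rooted_tri_insert E x y k phi : x \in E -> y \in E -> x != y ->
  ((phi \in rooted_tri E x k.+2) && (phi x == y)) =
  (tperm x y * phi \in rooted_tri (E :\ y) x k.+1).
Proof.
move=> xE yE nxy; set phi' := tperm x y * phi.
have phiE : phi = tperm x y * phi' by rewrite /phi' mulgA tperm2 mul1g.
have phi'y : phi x = y -> phi' y = y by move=> xy; rewrite permM tpermR.
have main : phi' y = y -> (phi \in rooted_tri E x k.+2) = (phi' \in rooted_tri (E :\ y) x k.+1).
  move=> fixy; have [orbE y_out orb_other] := porbit_insert fixy nxy.
  rewrite -phiE in orbE orb_other.
  have cardE : #|porbit phi x| = #|porbit phi' x|.+1 by rewrite orbE cardsU1 y_out.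
  apply/rooted_triP/rooted_triP => [[onE xk tri]|[onE xk tri]].
    split.
    - apply/subsetP => d; rewrite unfold_in => d_mv; rewrite !inE.
      have dy : d != y by apply: contraNneq d_mv => ->; rewrite fixy.
      rewrite dy /=; have [-> //|dx] := eqVneq d x.
      apply: (subsetP onE); rewrite unfold_in; move: d_mv.
      by rewrite /phi' permM tpermD // eq_sym.
    - by move: xk; rewrite cardE => -[].
    - move=> d; rewrite !inE => /andP[dy dE] dx.
      have d_out : d \notin porbit phi x by rewrite orbE !inE negb_or dy.
      by rewrite -orb_other // tri.
  split.
  - apply/subsetP => d; rewrite unfold_in => d_mv.
    have [-> //|dx] := eqVneq d x; have [-> //|dy] := eqVneq d y.
    suff : d \in E :\ y by rewrite !inE dy.
    by apply: (subsetP onE); rewrite unfold_in /phi' permM tpermD // eq_sym.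
  - by rewrite cardE xk.
  - move=> d dE dx; rewrite orb_other //; move: dx; rewrite orbE !inE negb_or => /andP[dy dx].
    by apply: tri; rewrite // !inE dy.
apply/andP/idP => [[phi_in /eqP xy]|phi'_in]; first by rewrite -main ?phi'y.
have fixy : phi' y = y.
  by case/rooted_triP: phi'_in => onE _ _; apply: perm_on_fix onE _; rewrite !inE eqxx.
by rewrite main // phi'_in phiE permM tpermL fixy.
Qed.

Lemma porbit_fix phi x : phi x = x -> porbit phi x = [set x].
Proof.
move=> fx; apply/setP => y; rewrite inE mem_porbit_fconnect.
apply/idP/eqP => [/iter_findex <-|->]; last exact: connect0.
by elim: (findex _ _ _) => //= i ->.
Qed.

Lemma card_porbit1 phi x : #|porbit phi x| = 1%N -> phi x = x.
Proof.
move/eqP/cards1P => [z e]; have := porbit_id phi x; rewrite e inE => /eqP xz.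
by have := mem_porbit phi 1 x; rewrite e inE expg1 -xz => /eqP.
Qed.

Lemma rooted_tri1 E x z : x \in E -> z \in E :\ x ->
  rooted_tri E x 1%N = rooted_tri (E :\ x) z 3.
Proof.
move=> xE zE; apply/setP => phi; apply/rooted_triP/rooted_triP => [[onE x1 tri]|[onE z3 tri]].
  have fx := card_porbit1 x1; have orbx := porbit_fix fx.
  have tri' d : d \in E :\ x -> #|porbit phi d| = 3.
    by rewrite !inE => /andP[dx dE]; apply: tri; rewrite // orbx inE.
  split; [|exact: tri'|by move=> d dE _; apply: tri'].
  apply/subsetP => d; rewrite unfold_in => d_mv; rewrite !inE.
  rewrite (subsetP onE) ?unfold_in // andbT.
  by apply: contraNneq d_mv => ->; rewrite fx.
have fx : phi x = x by apply: perm_on_fix onE _; rewrite !inE eqxx.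
have orbx := porbit_fix fx; split.
- by apply: subset_trans onE _; apply: subD1set.
- by rewrite orbx cards1.
- move=> d dE; rewrite orbx inE => dx.
  have dE' : d \in E :\ x by rewrite !inE dx.
  have [dz|/tri->//] := boolP (d \in porbit phi z).
  by move: dz; rewrite -eq_porbit_mem => /eqP ->.
Qed.

(** The root cycle is peeled: the image of [x] has [#|E|.-1] possible values and is then removed.
    When [x] is alone, [rooted_tri1] restarts on a triangle, and the missing factor 3m of the
    factorial is the quotient of 3^m m! by 3^(m-1) (m-1)!. *)
Lemma card_rooted_tri E x k m : x \in E -> #|E| = (k.+1 + 3 * m)%N ->
  (#|rooted_tri E x k.+1| * (3 ^ m * m`!) = #|E|.-1`!)%N.
Proof.
have [e] := ubnP #|E|; elim: e E x k m => // e IH E x k m /ltnSE leE xE cardE.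
case: k => [|k] in cardE *.
  have cardE1 : #|E :\ x| = (3 * m)%N.
    by move: cardE; rewrite (cardsD1 x) xE => /eqP; rewrite eqn_add2l => /eqP.
  case: m => [|m] in cardE cardE1 *.
    have -> : rooted_tri E x 1%N = [set 1].
      have Ex : E = [set x].
        apply/setP => d; rewrite inE; move: cardE1 => /eqP.
        rewrite muln0 cards_eq0 => /eqP/setP/(_ d); rewrite !inE.
        by case: eqP => [->|] //=.
      apply/setP => phi; rewrite [RHS]inE; apply/rooted_triP/eqP => [[onE x1 _]|->].
        apply/permP => d; rewrite perm1; have [->|dx] := eqVneq d x.
          exact: card_porbit1.
        by apply: perm_on_fix onE _; rewrite Ex inE.
      split; first exact: perm_on1.
        by rewrite porbit_fix ?cards1 ?perm1.
      by move=> d; rewrite Ex inE => /eqP ->; rewrite porbit_id.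
    by rewrite cards1 cardE.
  have /set0Pn[z zE] : E :\ x != set0 by rewrite -cards_eq0 cardE1.
  rewrite (rooted_tri1 xE zE).
  have lt : #|E :\ x| < e by apply: leq_trans leE; rewrite (cardsD1 x E) xE.
  have := IH (E :\ x) z 2 m lt zE; rewrite cardE1 => /(_ _) IHz.
  have {}IHz := IHz (mulnS 3 m).
  have fact_pred u : 0 < u -> u`! = (u * u.-1`!)%N by case: u => // u _; rewrite factS.
  have -> : (#|E|.-1 = 3 * m.+1)%N by rewrite cardE.
  by rewrite (fact_pred (3 * m.+1)%N) // -IHz factS expnS; ring.
have cardE1 : #|E :\ x| = (k.+1 + 3 * m)%N.
  by move: cardE; rewrite (cardsD1 x) xE !addSn => /eqP; rewrite eqSS => /eqP.
have -> : #|rooted_tri E x k.+2| = (\sum_(y in E :\ x) #|rooted_tri (E :\ y) x k.+1|)%N.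
  rewrite -sum1_card (partition_big (fun phi : {perm D} => phi x) (mem (E :\ x))) /=.
    apply: eq_bigr => y; rewrite !inE => /andP[yx yE]; rewrite sum1_card.
    have inj : injective (fun phi : {perm D} => tperm x y * phi) by move=> u v /mulgI.
    rewrite -(card_preimset _ inj); apply: eq_card => phi.
    by rewrite [RHS]inE -rooted_tri_insert // eq_sym.
  move=> phi /rooted_triP[onE xk _]; rewrite !inE perm_closed // xE andbT.
  by apply: contraTneq isT => fx; move: xk; rewrite porbit_fix // cards1.
rewrite big_distrl /=.
rewrite (eq_bigr (fun=> (#|E|.-2)`!)) => [|y]; last first.
  rewrite !inE => /andP[yx yE].
  have cardEy : #|E :\ y| = (k.+1 + 3 * m)%N.
    by move: cardE; rewrite (cardsD1 y) yE !addSn => /eqP; rewrite eqSS => /eqP.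
  have lt : #|E :\ y| < e by apply: leq_trans leE; rewrite (cardsD1 y E) yE.
  rewrite IH // ?inE ?xE ?andbT 1?eq_sym //.
  by rewrite [in RHS](cardsD1 y) yE.
by rewrite sum_nat_const cardE1 cardE /= addSn factS.
Qed.

End CycleType.

(** * Colourings of the root face *)

Section Root.
Variable D : finType.
Implicit Types (a phi : {perm D}) (E : {set D}) (x y d : D) (p : seq D).
Implicit Types (c : D -> 'I_3) (e : word).

Lemma rooted_tri_card E x k phi : x \in E -> phi \in rooted_tri E x k.+1 ->
  exists m, #|E| = (k.+1 + 3 * m)%N.
Proof.
have [e] := ubnP #|E|; elim: e E x k phi => // e IH E x k phi /ltnSE leE xE phi_in.
have lt y : y \in E -> #|E :\ y| < e.
  by move=> yE; apply: leq_trans leE; rewrite (cardsD1 y E) yE.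
case: k => [|k] in phi_in *.
  have [E1|/set0Pn[z zE]] := eqVneq (E :\ x) set0.
    by exists 0%N; rewrite (cardsD1 x) xE E1 cards0.
  rewrite (rooted_tri1 xE zE) in phi_in.
  have [m Em] := IH _ _ _ _ (lt x xE) zE phi_in.
  by exists m.+1; rewrite (cardsD1 x) xE Em; lia.
have [onE xk _] := rooted_triP _ _ _ _ phi_in.
have nx : x != phi x.
  by apply: contraTneq isT => /esym fx; move: xk; rewrite porbit_fix // cards1.
have yE : phi x \in E by rewrite perm_closed.
have := rooted_tri_insert k phi xE yE nx; rewrite phi_in eqxx /= => /esym/IH.
case=> [||m Em]; first exact: lt.
  by rewrite !inE nx.
by exists m; rewrite (cardsD1 (phi x)) yE Em.
Qed.

(** Discrete primitive of the word [e] along [p], with value [x] at the first dart. *)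
Definition path_col (x : 'I_3) e p d : 'I_3 :=
  (x + \sum_(y <- take (index d p) e) y)%R.

Lemma step_path_col phi p (x : 'I_3) e : fcycle phi p -> uniq p -> size e = size p ->
  (\sum_(y <- e) y = 0)%R -> [seq step phi (path_col x e p) d | d <- p] = e.
Proof.
case: p => [|r p] cyc uniq_p size_e sum_e.
  by move/eqP: size_e => /nilP ->.
apply: (@eq_from_nth _ ord0); first by rewrite size_map size_e.
rewrite size_map => j lt_j; rewrite (nth_map r) //.
set d := nth r (r :: p) j.
have index_d : index d (r :: p) = j by rewrite index_uniq.
have phid : phi d = nth r p j.
  have dp : d \in r :: p by apply: mem_nth.
  by have /eqP -> := next_cycle cyc dp; rewrite next_nth dp index_d.
have takeE : (\sum_(y <- take j.+1 e) y = \sum_(y <- take j e) y + nth ord0 e j)%R.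
  by rewrite (take_nth ord0) ?size_e // -cats1 big_cat big_seq1.
rewrite /step /path_col index_d phid.
have [lt_jp|le_pj] := ltnP j (size p).
  rewrite (_ : nth r p j = nth r (r :: p) j.+1) // index_uniq //.
  by rewrite takeE addrA [X in (X - _)%R]addrC addrK.
have je : size e = j.+1 by rewrite size_e /=; move: lt_j le_pj => /=; lia.
move: takeE; rewrite -je take_size sum_e => takeE.
rewrite nth_default // /= eqxx take0 big_nil addr0.
apply/eqP; rewrite -subr_eq0 opprD addrA subrr sub0r -opprD oppr_eq0.
by rewrite -takeE.
Qed.

Lemma path_col_unique phi p (x : 'I_3) e c : fcycle phi p -> uniq p ->
  [seq step phi c d | d <- p] = e -> (forall r p', p = r :: p' -> c r = x) ->
  {in p, c =1 path_col x e p}.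
Proof.
case: p => // r p cyc uniq_p <- /(_ _ _ erefl) cr d dp.
suff cE j : j < size (r :: p) -> c (nth r (r :: p) j) =
    (x + \sum_(y <- take j [seq step phi c d | d <- r :: p]) y)%R.
  by rewrite /path_col -cE ?index_mem // nth_index.
elim: j => [|j IH] lt_j; first by rewrite take0 big_nil addr0.
have {}IH := IH (ltnW lt_j).
rewrite (take_nth ord0) ?size_map; last exact: ltnW.
rewrite -cats1 big_cat big_seq1 addrA -IH (nth_map r); last exact: ltnW.
have phij : phi (nth r (r :: p) j) = nth r (r :: p) j.+1.
  have jp : nth r (r :: p) j \in r :: p by apply: mem_nth; apply: ltnW.
  have /eqP -> := next_cycle cyc jp; rewrite next_nth jp index_uniq //.
  exact: ltnW.
by rewrite /step phij addrC subrK.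
Qed.

Lemma step_sum phi p c : fcycle phi p ->
  (\sum_(y <- [seq step phi c d | d <- p]) y = 0)%R.
Proof.
case: p => [|r p]; first by rewrite big_nil.
move=> /= path_p; rewrite big_cons.
have sumE l z s : fpath phi z (rcons l s) ->
    (\sum_(y <- [seq step phi c d | d <- l]) y = c s - c (phi z))%R.
  elim: l z => [|y l IH] z /=; first by case/andP=> /eqP -> _; rewrite big_nil subrr.
  by case/andP=> /eqP zy /IH; rewrite big_cons => ->; rewrite /step zy; ring.
by rewrite (sumE _ _ _ path_p) /step; ring.
Qed.

Lemma polygons_root phi x k p c : phi \in rooted_tri [set: D] x k ->
  fcycle phi p -> uniq p -> x \in p -> {in p, forall d, c (phi d) != c d} ->
  polygons phi [set: D] [:: p] c.
Proof.
case/rooted_triP=> _ _ tri cyc uniq_p xp col.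
have flE : flatten [:: p] = p by rewrite /= cats0.
split; rewrite ?flE //.
- by move=> q; rewrite inE => /eqP ->.
- by rewrite inE eq_sym; case: (p) xp.
- by move=> d dp; rewrite inE; split=> //; apply: tri; rewrite ?inE // (mem_porbit_cycle cyc xp).
- by move=> d dp; rewrite col ?inE.
Qed.

Lemma face_word_setT phi c p : face_word phi [set: D] c p = [seq step phi c d | d <- p].
Proof. by rewrite /face_word (@eq_filter _ _ predT) ?filter_predT // => d; rewrite inE. Qed.

Lemma root_orbit phi x k : phi \in rooted_tri [set: D] x k ->
  let p := fingraph.orbit phi x in
  [/\ fcycle phi p, uniq p, x \in p & size p = k].
Proof.
case/rooted_triP=> _ xk _ /=.
have cyc := cycle_orbit (@perm_inj _ phi) x; have uniq_p := fingraph.orbit_uniq phi x.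
have xp := in_orbit phi x; split=> //.
by rewrite -xk (eq_card (mem_porbit_cycle cyc xp)) (card_uniqP uniq_p).
Qed.

Lemma card_gluings_root phi x k m n p c : phi \in rooted_tri [set: D] x k.+1 ->
  #|D| = n.*2 -> #|D| = (k.+1 + 3 * m)%N ->
  fcycle phi p -> uniq p -> x \in p -> {in p, forall d, c (phi d) != c d} ->
  #|gluings phi [set: D] [:: p] c n| =
  (3 ^ m * m`! * glue n [:: [seq step phi c d | d <- p]])%N.
Proof.
move=> phi_in cardD cardDm cyc uniq_p xp col.
have pol := polygons_root phi_in cyc uniq_p xp col.
rewrite (card_gluings (m := m) pol) /= ?face_word_setT ?cardsT // cats0.
have [_ xk _] := rooted_triP _ _ _ _ phi_in.
have cardp : #|[set z in p]| = k.+1.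
  by rewrite -xk; apply: eq_card => z; rewrite inE (mem_porbit_cycle cyc xp).
by have := cardsC [set z in p]; rewrite cardp cardDm => /eqP; rewrite eqn_add2l => /eqP.
Qed.

End Root.

(** Both sides are realised as numbers of gluings of one and the same polygon, listed from two
    different darts. A face permutation of the right cycle type exists when the sum and parity
    conditions hold; otherwise both sides are zero. *)
Lemma glue_rcons n (z : 'I_3) (w : word) : all (fun y => y != ord0) (z :: w) ->
  glue n [:: rcons w z] = glue n [:: z :: w].
Proof.
move=> nz; case: n => [|n]; first by rewrite /= /nonnil /=; case: (w).
pose good := exists m, [/\ (\sum_(y <- z :: w) y = 0)%R & (size (z :: w) + 3 * m = n.+1.*2)%N].
suff main : good -> glue n.+1 [:: rcons w z] = glue n.+1 [:: z :: w].
  have [g0|nz1] := eqVneq (glue n.+1 [:: z :: w]) 0%N.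
    have [g0'|nz2] := eqVneq (glue n.+1 [:: rcons w z]) 0%N; first by rewrite g0 g0'.
    apply: main; have [m sz] := glue_parity nz2.
    have := glue_closed nz2 (mem_head _ _); rewrite -cats1 big_cat big_seq1 /= addrC => sum0.
    by exists m; split; [rewrite big_cons|move: sz; rewrite /= size_rcons addn0].
  apply: main; have [m sz] := glue_parity nz1.
  by exists m; split; [exact: glue_closed nz1 _ (mem_head _ _)|rewrite -sz /= addn0].
case=> m [sum0 sz]; pose e := z :: w.
pose D := 'I_(n.*2.+2); pose x : D := ord0.
have cardD : #|D| = n.+1.*2 by rewrite card_ord.
have cardDm : #|D| = ((size w).+1 + 3 * m)%N by rewrite cardD -sz.
have /set0Pn[phi phi_in] : rooted_tri [set: D] x (size w).+1 != set0.
  rewrite -card_gt0; have := @card_rooted_tri D [set: D] x (size w) m.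
  rewrite cardsT inE => /(_ isT cardDm) cardE.
  by move: (fact_gt0 #|D|.-1); rewrite -cardE; case: #|_|.
have [cyc uniq_p xp size_p] := root_orbit phi_in.
set p := fingraph.orbit phi x in cyc uniq_p xp size_p.
pose c := path_col ord0 e p.
have stepE : [seq step phi c d | d <- p] = e by apply: step_path_col; rewrite ?size_p.
have col : {in p, forall d, c (phi d) != c d}.
  move=> d dp; rewrite -subr_eq0; apply: (allP nz); rewrite -/e -stepE.
  exact: map_f.
have c1 := card_gluings_root phi_in cardD cardDm cyc uniq_p xp col.
have := @card_gluings_root D phi x (size w) m n.+1 (rot 1 p) c phi_in cardD cardDm.
rewrite rot_cycle rot_uniq mem_rot => /(_ cyc uniq_p xp) c2.
have {}c2 := c2 (fun d dp => col d (etrans (esym (mem_rot 1 p d)) dp)).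
rewrite map_rot stepE in c1 c2.
(* A gluing sees the polygons only through their darts and their number, so rotating the list [p]
   changes nothing. *)
have gE : gluings phi [set: D] [:: rot 1 p] c n.+1 = gluings phi [set: D] [:: p] c n.+1.
  have sub ps ps' : size ps = size ps' -> flatten ps =i flatten ps' ->
      {subset gluings phi [set: D] ps c n.+1 <= gluings phi [set: D] ps' c n.+1}.
    move=> eq_size eq_fl [a k] /gluingsP /= [inv live vtx edge colr cover sep euler].
    apply/gluingsP; split=> //=.
    - by move=> d; rewrite -eq_fl; apply: colr.
    - by move=> d; have [y yfl dy] := cover d; exists y; rewrite -?eq_fl.
    - by move=> y y'; rewrite -!eq_fl; apply: sep.
    - by rewrite -eq_size.
  have eq_fl : flatten [:: rot 1 p] =i flatten [:: p].
    by move=> y; rewrite /= !cats0 mem_rot.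
  apply/setP => u; apply/idP/idP; apply: sub => // y; by rewrite eq_fl.
apply/eqP; rewrite -(eqn_pmul2l (_ : 0 < 3 ^ m * m`!)) ?muln_gt0 ?expn_gt0 ?fact_gt0 //.
by rewrite -c1 -gE c2 /e rot1_cons.
Qed.

Arguments glue : simpl never.

Definition nonzero_word : pred word := all (fun y => y != ord0).

(** * Rooted maps with a given face permutation *)

Section Maps.
Variable n : nat.
Let D := 'I_(ndarts n).
Implicit Types (a phi s : {perm D}) (c : {ffun D -> 'I_3}).

Definition proper_coloring s a c :=
  [forall d, c (s d) == c d] && [forall d, c (a d) != c d].

(** [facep s a = phi] amounts to [s = a^-1 * phi]: the sum over vertex permutations in [Qcoef]
    becomes a sum over face permutations. *)
Definition maps_of phi : {set {perm D} * {ffun D -> 'I_3}} :=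
  [set ac | is_planar_map (ac.1^-1 * phi) ac.1 &&
            proper_coloring (ac.1^-1 * phi) ac.1 ac.2].

Lemma facepE phi a : facep (a^-1 * phi) a = phi.
Proof. by rewrite /facep mulgA mulgV mul1g. Qed.

Lemma maps_ofP phi p (c0 : D -> 'I_3) k a c :
  phi \in rooted_tri [set: D] ord0 k -> fcycle phi p -> ord0 \in p ->
  gluing phi [set: D] [:: p] c0 n.+1 a c <->
  (a, c) \in maps_of phi /\ {in p, c =1 c0}.
Proof.
move=> phi_in cyc p0; have flE : flatten [:: p] = p by rewrite /= cats0.
have aV : involutive a -> a^-1 = a.
  move=> aK; apply/eqP; rewrite eq_invg_mul; apply/eqP/permP => x.
  by rewrite permM aK perm1.
have face_conn s b x y : b * s = phi -> involutive b -> x \in p -> y \in p ->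
    connect (map_rel s b) x y.
  move=> bs bK xp yp; have : y \in porbit phi x by rewrite (mem_porbit_cycle cyc xp).
  rewrite mem_porbit_fconnect -bs; apply: connect_sub => u v /eqP <-.
  exact: map_rel_face.
split=> [[inv live vtx edge col cover sep euler]|].
  split; last by move=> d dp; apply: col; rewrite flE.
  rewrite inE /= /is_planar_map facepE aV //; apply/andP; split.
    apply/and4P; split.
    - by apply/forallP => d; rewrite inv.
    - by apply/forallP => d; rewrite live inE.
    - apply/forallP => d; have [x] := cover d; rewrite flE => xp dx.
      rewrite (map_rel_sym (a * phi) inv); apply: connect_trans dx _.
      by apply: face_conn => //; rewrite mulgA -[X in X * a]aV // mulVg mul1g.
    - by rewrite euler addn2.
  apply/andP; split; apply/forallP => d; last by apply: edge.
  by rewrite permM vtx inv.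
case; rewrite inE /= /is_planar_map facepE => /andP[/and4P[/forallP inv /forallP fpf]].
have {}inv : involutive a by move=> d; apply/eqP/inv.
rewrite aV // => /forallP conn euler /andP[/forallP vtx /forallP edge] col.
split=> //.
- by move=> d; rewrite fpf inE.
- by move=> d; have := vtx (a d); rewrite permM inv => /eqP.
- by move=> d; rewrite flE; apply: col.
- move=> d; exists ord0; first by rewrite flE.
  by rewrite (map_rel_sym (a * phi) inv).
- by move=> x y; rewrite flE => xp yp _; rewrite (mem_porbit_cycle cyc xp).
- by rewrite (eqP euler) addn2.
Qed.

(** The maps are sorted by the colour of the root dart, whence the factor 3, and by the word of
    steps along the root face. Words that do not add up to zero contribute nothing on either
    side. *)
Lemma card_maps_of phi k m : phi \in rooted_tri [set: D] ord0 k.+1 ->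
  #|D| = (k.+1 + 3 * m)%N ->
  #|maps_of phi| = (3 ^ m * m`! *
    (3 * \sum_(e : k.+1.-tuple 'I_3 | nonzero_word e) glue n.+1 [:: tval e]))%N.
Proof.
move=> phi_in cardD; have [cyc uniq_p p0 size_p] := root_orbit phi_in.
set p := fingraph.orbit phi ord0 in cyc uniq_p p0 size_p.
have pE : exists p', p = ord0 :: p'.
  by rewrite /p /fingraph.orbit -orderSpred trajectS; eexists.
have size_word (c : D -> 'I_3) : size [seq step phi c d | d <- p] == k.+1.
  by rewrite size_map size_p.
pose key (ac : {perm D} * {ffun D -> 'I_3}) := (ac.2 ord0, Tuple (size_word ac.2)).
have -> : #|maps_of phi| = (\sum_(xe : 'I_3 * k.+1.-tuple 'I_3)
    #|[set ac in maps_of phi | key ac == xe]|)%N.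
  rewrite -sum1_card (partition_big key xpredT) //=; apply: eq_bigr => xe _.
  by rewrite -sum1_card; apply: eq_bigl => ac; rewrite !inE.
rewrite (eq_bigr (fun xe : 'I_3 * k.+1.-tuple 'I_3 => if nonzero_word xe.2 then
    (3 ^ m * m`! * glue n.+1 [:: tval xe.2])%N else 0%N)); last first.
  move=> [x e] _ /=.
  have keyE a c : (key (a, c) == (x, e)) =
      (c ord0 == x) && ([seq step phi c d | d <- p] == e).
    by rewrite /key xpair_eqE /= -val_eqE.
  have empty : (forall a c, (a, c) \in maps_of phi ->
      [seq step phi c d | d <- p] = e -> False) ->
      #|[set ac in maps_of phi | key ac == (x, e)]| = 0%N.
    move=> no; apply/eqP; rewrite cards_eq0; apply/eqP/setP => -[a c].
    rewrite in_set0 in_set keyE; apply/negP => /and3P[ac_in _ /eqP]; exact: no ac_in.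
  case: ifP => [nz|/negbT nnz]; last first.
    apply: empty => a c ac_in eE; case/negP: nnz; rewrite -eE.
    apply/allP => _ /mapP[d dp ->]; rewrite subr_eq0.
    have flE : flatten [:: p] = p by rewrite /= cats0.
    have := (maps_ofP c a c phi_in cyc p0).2 (conj ac_in (fun _ _ => erefl)).
    by move=> gl; rewrite (gl_vertex gl) (gl_edge gl) // inE.
  have [sum0|nsum0] := eqVneq (\sum_(y <- e) y)%R 0%R; last first.
    rewrite empty => [|a c _ eE]; last first.
      by move: nsum0; rewrite -eE step_sum // eqxx.
    apply/esym/eqP; rewrite muln_eq0; apply/orP; right; apply/negPn/negP => gnz.
    by move: nsum0; rewrite (glue_closed gnz) ?mem_head ?eqxx.
  pose c0 := path_col x e p.
  have stepE : [seq step phi c0 d | d <- p] = e.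
    by apply: step_path_col; rewrite ?size_tuple.
  have col : {in p, forall d, c0 (phi d) != c0 d}.
    move=> d dp; rewrite -subr_eq0; apply: (allP nz); rewrite -stepE.
    exact: map_f.
  have := card_gluings_root (n := n.+1) phi_in _ cardD cyc uniq_p p0 col.
  rewrite card_ord => /(_ erefl); rewrite stepE => <-.
  apply: eq_card => -[a c]; rewrite in_set keyE; apply/andP/gluingsP => /=.
    case=> ac_in /andP[/eqP cx /eqP eE]; apply/(maps_ofP c0 a c phi_in cyc p0).
    split=> //; apply: path_col_unique eE _ => // r p'.
    by case: pE => p'' -> [<-].
  move/(maps_ofP c0 a c phi_in cyc p0) => [ac_in cc0]; split=> //.
  apply/andP; split.
    rewrite cc0 // /c0 /path_col; case: pE => p' ->.
    by rewrite /= take0 big_nil addr0.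
  rewrite -stepE; apply/eqP/eq_in_map => d dp.
  by rewrite /step !cc0 // (fcycle_closed cyc).
rewrite -(pair_bigA _ (fun (x : 'I_3) (e : k.+1.-tuple 'I_3) =>
  if nonzero_word e then (3 ^ m * m`! * glue n.+1 [:: tval e])%N else 0%N)) /=.
by rewrite sum_nat_const card_ord -big_mkcond -big_distrr /=; ring.
Qed.

Lemma maps_sum i :
  (\sum_(s : {perm D}) \sum_(a : {perm D} |
      [&& is_planar_map s a, near_tri s a & root_deg s a == i]) ncol3 s a)%N =
  (\sum_(phi in rooted_tri [set: D] ord0 i) #|maps_of phi|)%N.
Proof.
have typeE phi a : near_tri (a^-1 * phi) a && (root_deg (a^-1 * phi) a == i) =
    (phi \in rooted_tri [set: D] ord0 i).
  rewrite /near_tri /root_deg facepE; apply/andP/rooted_triP.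
    case=> /forallP tri /eqP deg; split=> //; first exact/subsetP.
    by move=> d _ d_out; have /implyP/(_ d_out)/eqP := tri d.
  case=> _ deg tri; split; last exact/eqP.
  by apply/forallP => d; apply/implyP => d_out; apply/eqP/tri; rewrite ?inE.
rewrite (exchange_big_dep xpredT) //=.
have reidx a : (\sum_(s | [&& is_planar_map s a, near_tri s a & root_deg s a == i])
     ncol3 s a = \sum_(phi in rooted_tri [set: D] ord0 i)
       if is_planar_map (a^-1 * phi) a then ncol3 (a^-1 * phi) a else 0)%N.
  rewrite (reindex_onto (fun phi => a^-1 * phi) (fun s => a * s)) /=; last first.
    by move=> s _; rewrite mulgA mulVg mul1g.
  rewrite big_mkcond [RHS]big_mkcond; apply: eq_bigr => phi _.
  rewrite typeE mulgA mulgV mul1g eqxx andbT.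
  by case: (_ \in _); rewrite ?andbT ?andbF.
rewrite (eq_bigr _ (fun a _ => reidx a)) exchange_big /=; apply: eq_bigr => phi _.
rewrite -sum1_card (partition_big (fun ac : {perm D} * {ffun D -> 'I_3} => ac.1) xpredT) //=.
apply: eq_bigr => a _; rewrite /ncol3.
case: ifP => planar; last first.
  rewrite big_pred0 // => -[a' c]; rewrite !inE /=; apply/negP => /andP[/andP[pl _] /eqP aa].
  by move: pl; rewrite aa planar.
rewrite -sum1_card (reindex_onto (fun c => (a, c)) (fun ac => ac.2)) /=; last first.
  by move=> [a' c] /= /andP[_ /eqP ->].
by apply: eq_bigl => c; rewrite !inE /= planar !eqxx !andbT.
Qed.

End Maps.

(** The number of face permutations and the factor of [card_maps_of] multiply to 3 (2N-1)!, which is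
    exactly the normalisation of [Qcoef]. *)
Theorem Qcoef_glue i n :
  Qcoef i n =
  (\sum_(e : i.-tuple 'I_3 | nonzero_word e) glue n [:: tval e])%N%:R%R.
Proof.
case: n => [|n].
  rewrite /Qcoef; case: i => [|i].
    rewrite (big_pred1 [tuple]) //.
      by move=> e; rewrite [e]tuple0; rewrite /= eqxx.
  rewrite big1 // => e _.
  by case/tupleP: e => y e /=.
rewrite /Qcoef maps_sum; case: i => [|k].
  rewrite !big1 ?mulr0 // => [e _|phi /rooted_triP[_ /eqP]]; last first.
    by rewrite (negPf (card_porbit_neq0 _ _)).
  by rewrite [e]tuple0 /=.
case: (pselect (exists m, #|'I_(ndarts n)| = (k.+1 + 3 * m)%N)) => [[m cardD]|no_m]; last first.
  rewrite !big1 ?mulr0 // => [e _|phi phi_in]; last first.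
    by case: no_m; have := rooted_tri_card (in_setT _) phi_in; rewrite cardsT.
  apply/eqP/negPn/negP => /glue_parity[m]; rewrite /= size_tuple addn0 => sz.
  by case: no_m; exists m; rewrite card_ord sz.
rewrite (eq_bigr _ (fun phi phi_in => card_maps_of phi_in cardD)) sum_nat_const.
have := card_rooted_tri (in_setT ord0) (etrans (cardsT _) cardD).
rewrite cardsT card_ord /= => cardE.
rewrite mulnA cardE mulnCA mulnA [X in (_ * X)%R]natrM mulrA mulVf ?mul1r //.
by rewrite pnatr_eq0 muln_eq0 /= -lt0n fact_gt0.
Qed.

Close Scope group_scope.
Local Open Scope ring_scope.

(** * Power series *)

Record pseries (R : Type) := PSeries { pcoef : nat -> R }.

Lemma pseriesP (R : Type) (F G : pseries R) :
  pcoef F =1 pcoef G -> F = G.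
Proof. by case: F G => [f] [g] /funext /= ->. Qed.

HB.instance Definition _ (R : Type) := gen_eqMixin (pseries R).
HB.instance Definition _ (R : Type) := gen_choiceMixin (pseries R).

Section PowerSeriesRing.
Variable R : comNzRingType.
Implicit Types F G H : pseries R.

Fact ps_zero_key : unit. Proof. by []. Qed.
Definition ps_zero : pseries R := locked_with ps_zero_key (PSeries (fun=> 0)).
Fact ps_opp_key : unit. Proof. by []. Qed.
Definition ps_opp F := locked_with ps_opp_key (PSeries (fun n => - pcoef F n)).
Fact ps_add_key : unit. Proof. by []. Qed.
Definition ps_add F G :=
  locked_with ps_add_key (PSeries (fun n => pcoef F n + pcoef G n)).
Fact ps_one_key : unit. Proof. by []. Qed.
Definition ps_one : pseries R :=
  locked_with ps_one_key (PSeries (fun n => (n == 0%N)%:R)).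
Fact ps_mul_key : unit. Proof. by []. Qed.
Definition ps_mul F G := locked_with ps_mul_key
  (PSeries (fun n => \sum_(k < n.+1) pcoef F k * pcoef G (n - k)%N)).

Lemma ps_zeroE n : pcoef ps_zero n = 0.
Proof. by rewrite /ps_zero unlock. Qed.
Lemma ps_oppE F n : pcoef (ps_opp F) n = - pcoef F n.
Proof. by rewrite /ps_opp unlock. Qed.
Lemma ps_addE F G n : pcoef (ps_add F G) n = pcoef F n + pcoef G n.
Proof. by rewrite /ps_add unlock. Qed.
Lemma ps_oneE n : pcoef ps_one n = (n == 0%N)%:R.
Proof. by rewrite /ps_one unlock. Qed.
Lemma ps_mulE F G n :
  pcoef (ps_mul F G) n = \sum_(k < n.+1) pcoef F k * pcoef G (n - k)%N.
Proof. by rewrite /ps_mul unlock. Qed.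

Lemma ps_addA : associative ps_add.
Proof. by move=> F G H; apply: pseriesP => n; rewrite !ps_addE addrA. Qed.
Lemma ps_addC : commutative ps_add.
Proof. by move=> F G; apply: pseriesP => n; rewrite !ps_addE addrC. Qed.
Lemma ps_add0 : left_id ps_zero ps_add.
Proof. by move=> F; apply: pseriesP => n; rewrite ps_addE ps_zeroE add0r. Qed.
Lemma ps_addN : left_inverse ps_zero ps_opp ps_add.
Proof.
by move=> F; apply: pseriesP => n; rewrite ps_addE ps_oppE ps_zeroE addNr.
Qed.

HB.instance Definition _ :=
  GRing.isZmodule.Build (pseries R) ps_addA ps_addC ps_add0 ps_addN.

Definition trunc n F : {poly R} := \poly_(i < n.+1) pcoef F i.

Lemma coef_trunc n F i : (i <= n)%N -> (trunc n F)`_i = pcoef F i.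
Proof. by move=> le_in; rewrite coef_poly ltnS le_in. Qed.

(** Up to degree [n] series multiply like their truncations, so the laws of multiplication come from
    [{poly R}]. *)
Lemma coef_mul_trunc n F G i : (i <= n)%N ->
  pcoef (ps_mul F G) i = (trunc n F * trunc n G)`_i.
Proof.
move=> le_in; rewrite coefM ps_mulE; apply: eq_bigr => k _.
by rewrite !coef_trunc // (leq_trans _ le_in) ?leq_subr // -ltnS ltn_ord.
Qed.

Lemma ps_mulC : commutative ps_mul.
Proof.
by move=> F G; apply: pseriesP => n; rewrite !(@coef_mul_trunc n) // mulrC.
Qed.

Lemma ps_mulA : associative ps_mul.
Proof.
move=> F G H; apply: pseriesP => n.
transitivity ((trunc n F * (trunc n G * trunc n H))`_n).
  rewrite coefM ps_mulE; apply: eq_bigr => k _.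
  have le_kn : (k <= n)%N by rewrite -ltnS.
  by rewrite coef_trunc // -coef_mul_trunc // leq_subr.
rewrite mulrA coefM ps_mulE; apply: eq_bigr => k _.
have le_kn : (k <= n)%N by rewrite -ltnS.
by rewrite coef_trunc ?leq_subr // -coef_mul_trunc.
Qed.

Lemma ps_mul1 : left_id ps_one ps_mul.
Proof.
move=> F; apply: pseriesP => n; rewrite ps_mulE big_ord_recl ps_oneE mul1r subn0.
by rewrite big1 ?addr0 // => i _; rewrite ps_oneE mul0r.
Qed.

Lemma ps_mulD : left_distributive ps_mul ps_add.
Proof.
move=> F G H; apply: pseriesP => n; rewrite ps_addE !ps_mulE -big_split /=.
by apply: eq_bigr => i _; rewrite ps_addE mulrDl.
Qed.

Lemma ps_one_neq0 : ps_one != ps_zero.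
Proof.
apply/eqP => /(congr1 (fun F => pcoef F 0)) /eqP.
by rewrite ps_oneE ps_zeroE oner_eq0.
Qed.

HB.instance Definition _ := GRing.Zmodule_isComNzRing.Build (pseries R)
  ps_mulA ps_mulC ps_mul1 ps_mulD ps_one_neq0.

Lemma coefps0 n : pcoef (0 : pseries R) n = 0. Proof. exact: ps_zeroE. Qed.
Lemma coefps1 n : pcoef (1 : pseries R) n = (n == 0%N)%:R.
Proof. exact: ps_oneE. Qed.
Lemma coefpsD F G n : pcoef (F + G) n = pcoef F n + pcoef G n.
Proof. exact: ps_addE. Qed.
Lemma coefpsN F n : pcoef (- F) n = - pcoef F n. Proof. exact: ps_oppE. Qed.
Lemma coefpsB F G n : pcoef (F - G) n = pcoef F n - pcoef G n.
Proof. by rewrite coefpsD coefpsN. Qed.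
Lemma coefpsM F G n :
  pcoef (F * G) n = \sum_(k < n.+1) pcoef F k * pcoef G (n - k)%N.
Proof. exact: ps_mulE. Qed.
Lemma coefpsMn F k n : pcoef (F *+ k) n = pcoef F n *+ k.
Proof.
by elim: k => [|k IH]; rewrite ?mulr0n ?coefps0 // !mulrS coefpsD IH.
Qed.

Lemma coefps_sum (I : Type) (r : seq I) (P : pred I) (F : I -> pseries R) n :
  pcoef (\sum_(i <- r | P i) F i) n = \sum_(i <- r | P i) pcoef (F i) n.
Proof.
elim/big_rec2: _ => [|i x y _ <-]; first exact: coefps0.
by rewrite coefpsD.
Qed.

Fact psC_key : unit. Proof. by []. Qed.
Definition psC (c : R) : pseries R :=
  locked_with psC_key (PSeries (fun n => if n == 0%N then c else 0)).

Lemma coefpsC c n : pcoef (psC c) n = if n == 0%N then c else 0.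
Proof. by rewrite /psC unlock. Qed.

Lemma psC_is_additive : zmod_morphism psC.
Proof.
move=> a b; apply: pseriesP => n; rewrite coefpsB !coefpsC.
by case: eqP => // _; rewrite subr0.
Qed.
Lemma psC_is_multiplicative : monoid_morphism psC.
Proof.
split=> [|a b].
  by apply: pseriesP => n; rewrite coefpsC coefps1; case: eqP.
apply: pseriesP => n; rewrite coefpsM big_ord_recl big1 ?addr0.
  by rewrite !coefpsC subn0; case: eqP => // _; rewrite mulr0.
by move=> i _; rewrite coefpsC mul0r.
Qed.
HB.instance Definition _ :=
  GRing.isZmodMorphism.Build R (pseries R) psC psC_is_additive.
HB.instance Definition _ :=
  GRing.isMonoidMorphism.Build R (pseries R) psC psC_is_multiplicative.

Lemma coefpsCM c F n : pcoef (psC c * F) n = c * pcoef F n.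
Proof.
rewrite coefpsM big_ord_recl coefpsC subn0 big1 ?addr0 // => i _.
by rewrite coefpsC mul0r.
Qed.

Fact psX_key : unit. Proof. by []. Qed.
Definition psX : pseries R :=
  locked_with psX_key (PSeries (fun n => (n == 1%N)%:R)).

Lemma coefpsX n : pcoef psX n = (n == 1%N)%:R.
Proof. by rewrite /psX unlock. Qed.

Lemma coefpsXM F n : pcoef (psX * F) n = if n is n'.+1 then pcoef F n' else 0.
Proof.
rewrite coefpsM; case: n => [|n]; first by rewrite big_ord1 coefpsX mul0r.
rewrite 2!big_ord_recl !coefpsX mul0r add0r mul1r subSS subn0.
by rewrite big1 ?addr0 // => i _; rewrite coefpsX mul0r.
Qed.

Lemma coefpsXnM F k n :
  pcoef (psX ^+ k * F) n = if (k <= n)%N then pcoef F (n - k)%N else 0.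
Proof.
elim: k n => [|k IH] n; first by rewrite mul1r subn0.
by rewrite exprS -mulrA coefpsXM; case: n => // n; rewrite IH.
Qed.

Lemma coefpsXn k n : pcoef (psX ^+ k) n = (n == k)%:R.
Proof.
rewrite -[_ ^+ k]mulr1 coefpsXnM coefps1.
case: leqP => [le_kn|lt_nk]; last by rewrite (ltn_eqF lt_nk).
by rewrite subn_eq0 eqn_leq le_kn andbT.
Qed.

Lemma psX_inj F G : psX * F = psX * G -> F = G.
Proof.
move=> eqFG; apply: pseriesP => n.
by move/(congr1 (fun H => pcoef H n.+1)): eqFG; rewrite !coefpsXM.
Qed.

Definition pshift F : pseries R := PSeries (fun n => pcoef F n.+1).

Lemma ps_shiftE F : F = psC (pcoef F 0) + psX * pshift F.
Proof.
apply: pseriesP => n; rewrite coefpsD coefpsXM coefpsC.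
by case: n => [|n]; rewrite ?addr0 ?add0r.
Qed.

Fact ps_of_poly_key : unit. Proof. by []. Qed.
Definition ps_of_poly (p : {poly R}) : pseries R :=
  locked_with ps_of_poly_key (PSeries (fun n => p`_n)).

Lemma coefps_poly p n : pcoef (ps_of_poly p) n = p`_n.
Proof. by rewrite /ps_of_poly unlock. Qed.

Lemma ps_of_poly_is_additive : zmod_morphism ps_of_poly.
Proof.
by move=> p q; apply: pseriesP => n; rewrite coefpsB !coefps_poly coefB.
Qed.
Lemma ps_of_poly_is_multiplicative : monoid_morphism ps_of_poly.
Proof.
split=> [|p q]; apply: pseriesP => n.
  by rewrite coefps_poly coefps1 coef1.
rewrite coefpsM coefps_poly coefM; apply: eq_bigr => k _.
by rewrite !coefps_poly.
Qed.
HB.instance Definition _ := GRing.isZmodMorphism.Build {poly R} (pseries R)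
  ps_of_poly ps_of_poly_is_additive.
HB.instance Definition _ := GRing.isMonoidMorphism.Build {poly R} (pseries R)
  ps_of_poly ps_of_poly_is_multiplicative.

Lemma ps_of_polyC c : ps_of_poly c%:P = psC c.
Proof. by apply: pseriesP => n; rewrite coefps_poly coefpsC coefC. Qed.
Lemma ps_of_polyX : ps_of_poly 'X = psX.
Proof. by apply: pseriesP => n; rewrite coefps_poly coefpsX coefX. Qed.
Lemma ps_of_poly_inj : injective ps_of_poly.
Proof.
move=> p q eqpq; apply/polyP => n.
by move/(congr1 (fun F => pcoef F n)): eqpq; rewrite !coefps_poly.
Qed.

Definition eq_upto n F G := forall i, (i < n)%N -> pcoef F i = pcoef G i.

Lemma eq_upto_mul n F F' G G' :
  eq_upto n F F' -> eq_upto n G G' -> eq_upto n (F * G) (F' * G').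
Proof.
move=> eqF eqG i lt_in; rewrite !coefpsM; apply: eq_bigr => k _.
have le_ki : (k <= i)%N by rewrite -ltnS.
by rewrite eqF ?eqG // (leq_ltn_trans _ lt_in) // leq_subr.
Qed.

Lemma eq_upto_add n F F' G G' :
  eq_upto n F F' -> eq_upto n G G' -> eq_upto n (F + G) (F' + G').
Proof. by move=> eqF eqG i lt_in; rewrite !coefpsD eqF ?eqG. Qed.

Lemma eq_upto_psX n F G :
  eq_upto n F G -> eq_upto n.+1 (psX * F) (psX * G).
Proof. by move=> eqFG [|i] lt_in; rewrite !coefpsXM ?eqFG. Qed.

Lemma eq_upto_exp n F G k : eq_upto n F G -> eq_upto n (F ^+ k) (G ^+ k).
Proof.
by move=> eqFG; elim: k => // k IH; rewrite !exprS; apply: eq_upto_mul.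
Qed.

(** Contraction for the X-adic distance: each application gains one correct coefficient, so the
    iterates from 0 converge coefficientwise. *)
Definition contracting (Phi : pseries R -> pseries R) :=
  forall n F G, eq_upto n F G -> eq_upto n.+1 (Phi F) (Phi G).

Lemma contracting_fixpoint Phi : contracting Phi -> exists F, Phi F = F.
Proof.
move=> ctr; pose it k := iter k Phi 0.
have itS k l : eq_upto k (it (k + l)%N) (it k).
  elim: k => [|k IH] i lt_ik //; apply: ctr lt_ik; exact: IH.
exists (PSeries (fun n => pcoef (it n.+1) n)); apply: pseriesP => n.
rewrite -[RHS]/(pcoef (Phi (it n)) n); apply: (ctr n) => // i lt_in.
rewrite -[LHS]/(pcoef (it i.+1) i).
by have := itS i.+1 (n - i.+1)%N i; rewrite subnKC // => ->.
Qed.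

Lemma contracting_unique Phi F G :
  contracting Phi -> Phi F = F -> Phi G = G -> F = G.
Proof.
move=> ctr fixF fixG; apply: pseriesP => n.
suff: eq_upto n.+1 F G by apply.
elim: {n}n.+1 => [//|n IH]; rewrite -fixF -fixG; exact: ctr.
Qed.

Definition ps_unit : {pred pseries R} := fun F => `[< exists G, G * F = 1 >].
Definition ps_inv F : pseries R :=
  if pselect (exists G, G * F = 1) is left ex then sval (cid ex) else F.

Lemma ps_mulVx : {in ps_unit, left_inverse 1 ps_inv *%R}.
Proof.
by move=> F /asboolP ex; rewrite /ps_inv; case: pselect => // {}ex; case: cid.
Qed.
Lemma ps_unitPl F G : G * F = 1 -> ps_unit F.
Proof. by move=> GF; apply/asboolP; exists G. Qed.
Lemma ps_inv_out : {in [predC ps_unit], ps_inv =1 id}.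
Proof.
move=> F nF; rewrite /ps_inv; case: pselect => // ex; case/negP: nF.
by apply/asboolP.
Qed.

HB.instance Definition _ := GRing.ComNzRing_hasMulInverse.Build (pseries R)
  ps_mulVx ps_unitPl ps_inv_out.

End PowerSeriesRing.

(** The product of the lowest nonzero terms is the lowest term of the product. *)
Lemma ps_integral (R : idomainType) (F G : pseries R) :
  F * G = 0 -> (F == 0) || (G == 0).
Proof.
move=> FG0; apply/orP.
case: (pselect (exists n, pcoef F n != 0)) => [exF|nF]; last first.
  left; apply/eqP/pseriesP => n; rewrite coefps0; apply/eqP/negPn/negP => Fn.
  by apply: nF; exists n.
case: (pselect (exists n, pcoef G n != 0)) => [exG|nG]; last first.
  right; apply/eqP/pseriesP => n; rewrite coefps0; apply/eqP/negPn/negP => Gn.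
  by apply: nG; exists n.
have [a Fa mina] := ex_minnP exF; have [b Gb minb] := ex_minnP exG.
have /eqP := congr1 (fun H => pcoef H (a + b)%N) FG0.
rewrite coefps0 coefpsM (bigD1 (inord a)) //= inordK ?ltnS ?leq_addr // addKn.
rewrite big1 => [|i ne_ia]; first by rewrite addr0 mulf_eq0 (negPf Fa) (negPf Gb).
have le_iab : (i <= a + b)%N by rewrite -ltnS.
have [lt_ia|le_ai] := ltnP i a.
  apply/eqP; rewrite mulf_eq0; apply/orP; left; apply/negPn/negP => /mina.
  by rewrite leqNgt lt_ia.
apply/eqP; rewrite mulf_eq0; apply/orP; right; apply/negPn/negP => /minb.
rewrite leqNgt ltn_subLR // ltn_add2r ltn_neqAle le_ai andbT negbK.
by move/eqP=> eq_ai; case/eqP: ne_ia; apply: val_inj; rewrite /= inordK ?ltnS ?leq_addr.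
Qed.

HB.instance Definition _ (R : idomainType) :=
  GRing.ComUnitRing_isIntegral.Build (pseries R) (@ps_integral R).


Section PsMap.
Variables (R S : comNzRingType) (f : {rmorphism R -> S}).

Fact ps_map_key : unit. Proof. by []. Qed.
Definition ps_map (F : pseries R) : pseries S :=
  locked_with ps_map_key (PSeries (fun n => f (pcoef F n))).

Lemma coefps_map F n : pcoef (ps_map F) n = f (pcoef F n).
Proof. by rewrite /ps_map unlock. Qed.

Lemma ps_map_is_additive : zmod_morphism ps_map.
Proof.
move=> F G; apply: pseriesP => n.
by rewrite coefpsB !coefps_map coefpsB rmorphB.
Qed.
Lemma ps_map_is_multiplicative : monoid_morphism ps_map.
Proof.
split=> [|F G]; apply: pseriesP => n.
  by rewrite coefps_map !coefps1 rmorph_nat.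
rewrite coefpsM coefps_map coefpsM rmorph_sum; apply: eq_bigr => k _.
by rewrite rmorphM !coefps_map.
Qed.
HB.instance Definition _ := GRing.isZmodMorphism.Build (pseries R) (pseries S)
  ps_map ps_map_is_additive.
HB.instance Definition _ := GRing.isMonoidMorphism.Build (pseries R) (pseries S)
  ps_map ps_map_is_multiplicative.

Lemma ps_mapC c : ps_map (psC c) = psC (f c).
Proof.
apply: pseriesP => n; rewrite coefps_map !coefpsC.
by case: eqP => // _; rewrite rmorph0.
Qed.

Lemma ps_mapX : ps_map (psX R) = psX S.
Proof. by apply: pseriesP => n; rewrite coefps_map !coefpsX rmorph_nat. Qed.

Lemma ps_map_poly (p : {poly R}) :
  ps_map (ps_of_poly p) = ps_of_poly (map_poly f p).
Proof. by apply: pseriesP => n; rewrite coefps_map !coefps_poly coef_map. Qed.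

End PsMap.

Lemma ps_mulrn_eq0 (R : numDomainType) (F : pseries R) n :
  (F *+ n == 0) = (n == 0%N) || (F == 0).
Proof.
apply/eqP/orP => [Fn0|[/eqP->|/eqP->]]; rewrite ?mulr0n ?mul0rn //.
have [n_eq0|n0] := eqVneq n 0%N; [by left | right].
apply/eqP/pseriesP => k; have /eqP := congr1 (fun G => pcoef G k) Fn0.
by rewrite coefps0 coefpsMn mulrn_eq0 (negPf n0) => /eqP.
Qed.

Section Moments.
(** * Loop equations *)

Local Notation ratps := (pseries rat).
Local Notation t := (psX rat).

Definition word_ser (w : word) : ratps := PSeries (fun n => (glue n [:: w])%:R).

Lemma word_ser_nil : word_ser [::] = 1.
Proof. by apply: pseriesP => -[|n]; rewrite coefps1. Qed.

Lemma word_ser_cons e w : word_ser (e :: w) =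
  t * (word_ser [:: - e, - e & w] +
       \sum_(i < size w) (nth ord0 w i == - e)%:R *
          (word_ser (take i w) * word_ser (drop i.+1 w))).
Proof.
apply: pseriesP => n; rewrite coefpsXM; case: n => [//|n].
rewrite [LHS]/= (glueS n (e := e) (w := w) (ws' := [::])) // natrD coefpsD; congr (_ + _).
rewrite natr_sum coefps_sum big_mkcond; apply: eq_bigr => i _.
case: eqP => _; last by rewrite mul0r coefps0.
rewrite mul1r coefpsM -[[:: _; _]]/([:: take i w] ++ [:: drop i.+1 w]) glue_cat.
by rewrite natr_sum; apply: eq_bigr => k _; rewrite natrM.
Qed.

Lemma word_ser_rcons e w : nonzero_word (e :: w) ->
  word_ser (rcons w e) = word_ser (e :: w).
Proof. by move=> nz; apply: pseriesP => n /=; rewrite glue_rcons. Qed.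

(* The linear functional h on words in the letters 1, -1, extended to words in
   X = [1] + [-1] (encoded by false) and Y = [1] - [-1] (encoded by true). *)
Fixpoint xy_ext (l : seq bool) (h : word -> ratps) : ratps :=
  if l is b :: l' then
    xy_ext l' (fun w => h (1 :: w)) + (-1) ^+ b * xy_ext l' (fun w => h (-1 :: w))
  else h [::].

Lemma eq_xy_ext l h h' : (forall w, nonzero_word w -> h w = h' w) ->
  xy_ext l h = xy_ext l h'.
Proof.
elim: l h h' => [|b l IH] h h' hh' /=; first exact: hh'.
by congr (_ + _ * _); apply: IH => w nz; apply: hh'.
Qed.

Lemma xy_extD l h h' : xy_ext l (fun w => h w + h' w) = xy_ext l h + xy_ext l h'.
Proof. by elim: l h h' => //= b l IH h h'; rewrite !IH; ring. Qed.

Lemma xy_extM l c h : xy_ext l (fun w => c * h w) = c * xy_ext l h.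
Proof. by elim: l h => //= b l IH h; rewrite !IH; ring. Qed.

Lemma xy_ext_rcons l b h : xy_ext (rcons l b) h =
  xy_ext l (fun w => h (rcons w 1)) + (-1) ^+ b * xy_ext l (fun w => h (rcons w (-1))).
Proof. by elim: l h => //= b' l IH h; rewrite !IH; ring. Qed.

(** The sum over cuts of a word is linear in the letter cut out and in both remaining pieces, so it
    passes from sign letters to X and Y. *)
Lemma xy_ext_split l (g : 'I_3 -> ratps) h1 h2 :
  xy_ext l (fun w => \sum_(i < size w)
     g (nth ord0 w i) * (h1 (take i w) * h2 (drop i.+1 w))) =
  \sum_(i < size l) (g 1 + (-1) ^+ nth false l i * g (-1)) *
     (xy_ext (take i l) h1 * xy_ext (drop i.+1 l) h2).
Proof.
elim: l h1 h2 => [|b l IH] h1 h2 /=; first by rewrite !big_ord0.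
have step x : xy_ext l (fun w => \sum_(i < size (x :: w))
     g (nth ord0 (x :: w) i) * (h1 (take i (x :: w)) * h2 (drop i.+1 (x :: w)))) =
   g x * (h1 [::] * xy_ext l h2) + \sum_(i < size l)
     (g 1 + (-1) ^+ nth false l i * g (-1)) *
     (xy_ext (take i l) (fun w => h1 (x :: w)) * xy_ext (drop i.+1 l) h2).
  rewrite mulrA -xy_extM -(IH (fun w => h1 (x :: w))) -xy_extD.
  apply: eq_xy_ext => w _.
  by rewrite big_ord_recl /= drop0 mulrA.
rewrite !step big_ord_recl /= ?take0 ?drop0 /= mulrDr big_distrr /=.
rewrite addrACA -big_split /=; congr (_ + _); first by ring.
by apply: eq_bigr => i _; ring.
Qed.

Definition moment l := xy_ext l word_ser.

Lemma moment_rcons l b : moment (rcons l b) = moment (b :: l).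
Proof.
rewrite /moment xy_ext_rcons /=.
by congr (_ + _ * _); apply: eq_xy_ext => w nz; apply: word_ser_rcons.
Qed.

Lemma xy_ext_word_ser l x : xy_ext l (fun w => word_ser (x :: w)) =
  t * (xy_ext l (fun w => word_ser [:: - x, - x & w]) +
    \sum_(i < size l) (((1 : 'I_3) == - x)%:R + (-1) ^+ nth false l i * ((-1 : 'I_3) == - x)%:R) *
     (moment (take i l) * moment (drop i.+1 l))).
Proof.
rewrite -(xy_ext_split l (fun y => (y == - x)%:R)) -xy_extD -xy_extM.
by apply: eq_xy_ext => w _; rewrite word_ser_cons.
Qed.

(** The triangle move sends X to [-1][-1] + [1][1], which is (XX + YY)/2. In the other move X pairs
    with the letters X only: the factor [1 + (-1) ^+ b] is 2 on X and 0 on Y. *)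
Lemma loop_X l : 2 * moment (false :: l) =
  t * (moment [:: false, false & l] + moment [:: true, true & l]) +
  2 * t * \sum_(i < size l) (1 + (-1) ^+ nth false l i) *
     (moment (take i l) * moment (drop i.+1 l)).
Proof.
rewrite {1 2 3}/moment /= !xy_ext_word_ser opprK.
pose A x y := xy_ext l (fun w => word_ser [:: x, y & w]).
rewrite -!/(A _ _); set S1 := \sum_(i < _) _; set S2 := \sum_(i < _) _.
have -> : \sum_(i < size l) (1 + (-1) ^+ nth false l i) *
     (moment (take i l) * moment (drop i.+1 l)) = S1 + S2.
  by rewrite -big_split; apply: eq_bigr => i _ /=; ring.
by ring.
Qed.

(** Here the triangle move gives [-1][-1] - [1][1] = - (XY + YX)/2, and Y pairs with the letters Y
    only. *)
Lemma loop_Y l : 2 * moment (true :: l) =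
  - t * (moment [:: false, true & l] + moment [:: true, false & l]) -
  2 * t * \sum_(i < size l) (1 - (-1) ^+ nth false l i) *
     (moment (take i l) * moment (drop i.+1 l)).
Proof.
rewrite {1 2 3}/moment /= !xy_ext_word_ser opprK.
pose A x y := xy_ext l (fun w => word_ser [:: x, y & w]).
rewrite -!/(A _ _); set S1 := \sum_(i < _) _; set S2 := \sum_(i < _) _.
have -> : \sum_(i < size l) (1 - (-1) ^+ nth false l i) *
     (moment (take i l) * moment (drop i.+1 l)) = S2 - S1.
  rewrite -sumrB; apply: eq_bigr => i _ /=.
  by case: (nth false l i); ring.
by ring.
Qed.

Definition mom k : ratps := moment (nseq k false).
Definition mom2 a b : ratps := moment (true :: nseq a false ++ true :: nseq b false).

Lemma mom0 : mom 0 = 1. Proof. exact: word_ser_nil. Qed.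

Lemma mom1 : mom 1 = 0.
Proof.
have z (x : 'I_3) : x != 0 -> word_ser [:: x] = 0.
  move=> nx; apply: pseriesP => n; rewrite coefps0; apply/eqP; rewrite pnatr_eq0.
  apply/negPn/negP => /glue_closed/(_ _ (mem_head _ _)); rewrite big_seq1.
  by move/eqP; rewrite (negPf nx).
by rewrite /mom /moment /= !z // mul1r addr0.
Qed.

Lemma mom_rec k : 2 * mom k.+1 = t * (mom k.+2 + mom2 k 0) +
  4 * t * \sum_(i < k) mom i * mom (k - i.+1).
Proof.
rewrite loop_X -[mom k.+2]/(moment [:: false, false & _]).
have -> : moment [:: true, true & nseq k false] = mom2 k 0.
  by rewrite /mom2 -moment_rcons -cats1.
congr (_ + _); rewrite size_nseq !big_distrr /=; apply: eq_bigr => i _.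
rewrite nth_nseq ltn_ord expr0 take_nseq ?drop_nseq; last exact: ltnW.
by rewrite -/(mom _) -/(mom _); ring.
Qed.

Lemma mom2_rec a b : 2 * mom2 a b =
  - t * (mom2 a.+1 b + mom2 a b.+1) - 4 * t * mom a * mom b.
Proof.
rewrite loop_Y; congr (_ - _).
  rewrite addrC; congr (_ * (_ + _)).
  rewrite -moment_rcons -cats1 /= -catA cat_cons cats1.
  by congr (moment (_ :: _ ++ _ :: _)); elim: (b) => //= n ->.
set l := _ ++ _; have size_l : (a < size l)%N by rewrite size_cat size_nseq /= addnS ltnS leq_addr.
rewrite (bigD1 (Ordinal size_l)) //= big1 => [|i ne_ia].
  rewrite /l nth_cat size_nseq ltnn subnn /= take_size_cat ?size_nseq //.
  rewrite -cat_rcons drop_size_cat ?size_rcons ?size_nseq //.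
  by rewrite -/(mom a) -/(mom b); ring.
suff -> : nth false l i = false by rewrite expr0 subrr mul0r.
rewrite /l nth_cat size_nseq nth_nseq; case: ltnP => // le_ai.
have lt_ai : (a < i)%N.
  by rewrite ltn_neqAle le_ai andbT; apply: contra ne_ia => /eqP e; apply/eqP/val_inj.
by rewrite -(subnSK lt_ai) /= nth_nseq if_same.
Qed.

Lemma mom2_sym0 a : mom2 0 a = mom2 a 0.
Proof. by rewrite /mom2 /= -[in LHS]moment_rcons -cats1. Qed.

Lemma xy_ext_nseq k h : xy_ext (nseq k false) h =
  \sum_(e : k.-tuple 'I_3 | nonzero_word e) h e.
Proof.
elim: k h => [|k IH] h /=.
  rewrite (big_pred1 [tuple]) // => e.
  by rewrite [e]tuple0; rewrite /= eqxx.
pose f (xe : 'I_3 * k.-tuple 'I_3) := cons_tuple xe.1 xe.2.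
have bij_f : bijective f.
  exists (fun e => (thead e, behead_tuple e)).
    by move=> [x e]; rewrite /f; congr (_, _); apply: val_inj.
  by move=> e; case/tupleP: e => x e; apply: val_inj; rewrite /= theadE.
rewrite (reindex f) /=; last exact: onW_bij.
rewrite -(pair_big_dep (fun x : 'I_3 => x != ord0) (fun _ (e : k.-tuple 'I_3) => nonzero_word e)
  (fun x (e : k.-tuple 'I_3) => h (x :: e))) /=.
rewrite big_mkcond !big_ord_recl big_ord0 /= addr0 add0r mul1r !IH.
by congr (_ + _); apply: eq_bigr => e _; congr (h (_ :: _)); apply: val_inj.
Qed.

Lemma Qcoef_mom i n : Qcoef i n = pcoef (mom i) n.
Proof. by rewrite Qcoef_glue /mom /moment xy_ext_nseq coefps_sum natr_sum. Qed.
End Moments.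

(** * Separation of variables *)

Section Polynomials.
Variable R : comNzRingType.

(** The left-hand side Psi(M) of the cubic, with [T], [u], [H] for t, y, M. It is stated over any
    ring because it is transported along several morphisms. *)
Definition cubic_lhs (T u H : R) := 4 * T ^+ 3 * u ^+ 5 * H ^+ 3 +
  (T ^+ 3 * u ^+ 2 - 10 * T ^+ 2 * u ^+ 3 - 8 * T * u ^+ 4) * H ^+ 2 +
  (4 * u ^+ 2 + 2 * T * u - 2 * T ^+ 2 + 6 * T ^+ 2 * u ^+ 3) * H +
  2 * T ^+ 2 - 2 * T * u - 4 * u ^+ 2.

(** The value that the first loop equation gives to t y^2 times the generating series of the
    [G k 0]. *)
Definition diag_rhs (T u H : R) :=
  (2 * u - T) * (H - 1) - 4 * T * u ^+ 3 * H ^+ 2.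

End Polynomials.

Lemma rmorph_cubic_lhs (R S : comNzRingType) (f : {rmorphism R -> S}) T u H :
  f (cubic_lhs T u H) = cubic_lhs (f T) (f u) (f H).
Proof.
by rewrite /cubic_lhs !(rmorphB, rmorphD, rmorphM, rmorphXn, rmorph1, rmorph_nat).
Qed.

Lemma rmorph_diag_rhs (R S : comNzRingType) (f : {rmorphism R -> S}) T u H :
  f (diag_rhs T u H) = diag_rhs (f T) (f u) (f H).
Proof.
by rewrite /diag_rhs !(rmorphB, rmorphD, rmorphM, rmorphXn, rmorph1, rmorph_nat).
Qed.

Section Kernel.
Variables (O : comNzRingType) (t : O) (F : nat -> O) (G : nat -> nat -> O).
Hypotheses (F0 : F 0 = 1) (F1 : F 1 = 0).
Hypothesis F_rec : forall k, 2 * F k.+1 = t * (F k.+2 + G k 0) +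
  4 * t * \sum_(i < k) F i * F (k - i.+1)%N.
Hypothesis G_rec : forall a b, 2 * G a b =
  - t * (G a.+1 b + G a b.+1) - 4 * t * F a * F b.
Hypothesis G_sym0 : forall a, G 0 a = G a 0.

Let M : pseries O := PSeries F.
Let g : pseries O := PSeries (fun k => G k 0).
Let y : pseries O := psX O.
Let tau : pseries O := psC t.

Lemma diag_eq : tau * y ^+ 2 * g = diag_rhs tau y M.
Proof.
rewrite /diag_rhs.
have -> : (2 * y - tau) * (M - 1) - 4 * tau * y ^+ 3 * M ^+ 2 =
  (y * (M - 1)) *+ 2 - tau * (M - 1) - (tau * (y ^+ 3 * (M * M))) *+ 4 by ring.
rewrite -mulrA; apply: pseriesP => n.
rewrite !coefpsB !coefpsMn !coefpsCM !coefpsXnM coefpsXM !coefpsB.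
case: n => [|[|k]]; rewrite ?coefpsB ?coefps1 /= ?F0 ?F1 ?subrr ?mulr0 ?mul0rn ?subr0 //.
rewrite !subSS subn0; have := F_rec k; case: k => [|k] /= recF.
  by rewrite mulr0 mul0rn subr0 -mulr_natl recF big_ord0; ring.
rewrite -mulr_natl recF subn1 coefpsM /=.
set sum := \sum_(i < k.+1) _; rewrite -/sum.
by ring.
Qed.

(** Two variables: y1 is the inner one and y2 the outer one. [psC] embeds series in y1, [in2] copies
    a series into y2. *)
Let y1 : pseries (pseries O) := psC y.
Let y2 : pseries (pseries O) := psX _.
Let tt : pseries (pseries O) := psC tau.
Let in2 (H : pseries O) : pseries (pseries O) := ps_map (@psC O) H.
Let GG : pseries (pseries O) := PSeries (fun b => PSeries (fun a => G a b)).
Let kappa := 2 * y1 * y2 + tt * (y1 + y2).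

Lemma coef_in2 H b : pcoef (in2 H) b = psC (pcoef H b).
Proof. exact: coefps_map. Qed.

Lemma kernel_eq : GG * kappa =
  tt * (y1 * psC g + y2 * in2 g) - 4 * tt * y1 * y2 * psC M * in2 M.
Proof.
have -> : GG * kappa = (y1 * (y2 * GG)) *+ 2 + tt * (y1 * GG) + tt * (y2 * GG).
  by rewrite /kappa; ring.
have -> : tt * (y1 * psC g + y2 * in2 g) - 4 * tt * y1 * y2 * psC M * in2 M =
  tt * (y1 * psC g) + tt * (y2 * in2 g) - (tt * (y1 * (psC M * (y2 * in2 M)))) *+ 4.
  by ring.
apply: pseriesP => b; apply: pseriesP => a.
rewrite !(coefpsD, coefpsN, coefpsMn, coefpsCM, coefpsXM, coefpsC, coefps_map).
case: b => [|b]; case: a => [|a];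
  rewrite ?coefps0 ?coefpsXM /= ?G_sym0 ?mulr0 ?coefps0 ?coef_in2 ?coefpsC /=; try by ring.
have := G_rec a b; rewrite mulr_natl mulr2n => ->.
rewrite (mulrC M) coefpsCM /=; ring.
Qed.

Let eM := cubic_lhs tau y M.

Let M1 : pseries (pseries O) := psC M.
Let M2 := in2 M.

(* With x = 1/y and w = y M, the kernel relation reads
   (x1 + x2 + 2/t) * (...) = w1^2 + w1 w2 + w2^2 + (linear terms); completing the
   square by w = omega + alpha(x), with 12 t^2 alpha = 8 + 10 t x - t^2 x^2, and
   multiplying by omega1 - omega2 (= Lambda up to a monomial) separates the
   variables. *)
Lemma separation : exists K : pseries (pseries O),
  12 * (y1 * y2 * (y2 ^+ 2 * psC eM - y1 ^+ 2 * in2 eM)) = K * kappa.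
Proof.
pose Lambda := 12 * tt ^+ 2 * y1 ^+ 2 * y2 ^+ 2 * (y1 * M1 - y2 * M2) -
  10 * tt * y1 * y2 * (y2 - y1) + tt ^+ 2 * (y2 ^+ 2 - y1 ^+ 2).
(* [Q] is the quotient by [kappa] of the separated difference plus [Lambda] times the right-hand
   side of [kerB], once [diag1] and [diag2] have eliminated [g]. *)
pose Q := 4 * tt^+2 * y1^+4 * y2 * M1^+2 - 4 * tt^+2 * y1^+3 * y2^+2 * M1^+2
  - 8 * tt^+2 * y1^+3 * y2^+2 * M1 * M2 + 12 * tt^+2 * y1^+3 * y2^+2 * M1
  + 8 * tt^+2 * y1^+2 * y2^+3 * M1 * M2 + 4 * tt^+2 * y1^+2 * y2^+3 * M2^+2
  - 12 * tt^+2 * y1^+2 * y2^+3 * M2 + tt^+2 * y1^+2 * M2 - tt^+2 * y1^+2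
  - 4 * tt^+2 * y1 * y2^+4 * M2^+2 + tt^+2 * y1 * y2 * M1 - tt^+2 * y1 * y2 * M2
  - tt^+2 * y2^+2 * M1 + tt^+2 * y2^+2 - 48 * tt * y1^+4 * y2^+2 * M1^+2
  + 48 * tt * y1^+2 * y2^+4 * M2^+2 - 2 * tt * y1^+2 * y2 * M1
  + 10 * tt * y1^+2 * y2 * M2 - 8 * tt * y1^+2 * y2 - 10 * tt * y1 * y2^+2 * M1
  + 2 * tt * y1 * y2^+2 * M2 + 8 * tt * y1 * y2^+2 + 24 * y1^+2 * y2^+2 * M1
  - 24 * y1^+2 * y2^+2 * M2.
exists (Q - y1 * y2 * GG * Lambda).
have diag1 : tt * y1 ^+ 2 * psC g = diag_rhs tt y1 M1.
  by rewrite -!rmorphXn -!rmorphM diag_eq rmorph_diag_rhs.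
have diag2 : tt * y2 ^+ 2 * in2 g = diag_rhs tt y2 M2.
  have := congr1 in2 diag_eq.
  by rewrite /in2 rmorph_diag_rhs 2!rmorphM rmorphXn /= ps_mapX ps_mapC.
have e1 : psC eM = cubic_lhs tt y1 M1.
  exact: (rmorph_cubic_lhs (@psC (pseries O)) tau y M).
have e2 : in2 eM = cubic_lhs tt y2 M2.
  have <- : in2 y = y2 by apply: ps_mapX.
  have <- : in2 tau = tt by apply: ps_mapC.
  exact: (rmorph_cubic_lhs (ps_map (@psC O)) tau y M).
have kerB : y1 * y2 * GG * kappa =
    y2 * (tt * y1 ^+ 2 * psC g) + y1 * (tt * y2 ^+ 2 * in2 g) -
    4 * tt * y1 ^+ 2 * y2 ^+ 2 * M1 * M2.
  by rewrite -mulrA kernel_eq -/M1 -/M2; ring.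
rewrite mulrBl (_ : y1 * y2 * GG * Lambda * kappa = Lambda * (y1 * y2 * GG * kappa)).
  by rewrite kerB diag1 diag2 e1 e2 /diag_rhs /cubic_lhs /Q /Lambda /kappa; ring.
by ring.
Qed.

(** Divisibility by the kernel, read on coefficients. The first part comes from the terms free of
    y2; in the second, the factor y1 y2 shifts both indices by one. *)
Lemma kernel_coef (e : pseries O) (K : pseries (pseries O)) :
  12 * (y1 * y2 * (y2 ^+ 2 * psC e - y1 ^+ 2 * in2 e)) = K * kappa ->
  let k b a := pcoef (pcoef K b) a in
  (forall a, t * k 0 a = 0) /\
  forall b a, 2 * k b a + t * (k b.+1 a + k b a.+1) =
    12 * (if b == 2 then pcoef e a else 0) - 12 * (if a == 2 then pcoef e b else 0).
Proof.
move=> eqK k; pose n2 (n : nat) : pseries (pseries O) := psC (psC n%:R).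
have n2E n : n2 n = n%:R by rewrite /n2 !rmorph_nat.
have sepE : n2 12 * (y1 * (y2 ^+ 3 * psC e)) - n2 12 * (psC (y ^+ 3) * (y2 * in2 e)) =
    n2 2 * (y1 * (y2 * K)) + (tt * (y1 * K) + tt * (y2 * K)).
  have -> : n2 2 * (y1 * (y2 * K)) + (tt * (y1 * K) + tt * (y2 * K)) = K * kappa.
    by rewrite /kappa n2E; ring.
  by rewrite -eqK n2E rmorphXn /=; ring.
have coefE b a : 12 * pcoef (pcoef (y1 * (y2 ^+ 3 * psC e)) b) a -
    12 * pcoef (pcoef (psC (y ^+ 3) * (y2 * in2 e)) b) a =
    2 * pcoef (pcoef (y1 * (y2 * K)) b) a + (t * pcoef (pcoef (y1 * K) b) a +
    t * pcoef (pcoef (y2 * K) b) a).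
  have := congr1 (fun H => pcoef (pcoef H b) a) sepE.
  by rewrite !coefpsB !coefpsD !coefpsCM.
have coef3 (R : comNzRingType) (c : R) a :
    pcoef (psX R ^+ 3 * psC c) a.+1 = if a == 2 then c else 0.
  by rewrite coefpsXnM; case: a => [|[|[|a]]] //=; rewrite coefpsC.
split=> [a|b a].
  have := coefE 0%N a.+1.
  rewrite !(coefpsCM y) !(coefpsCM (y ^+ 3)) !coefpsXM coefpsXnM /= mulr0 !coefps0.
  by rewrite !mulr0 subr0 add0r addr0 => <-.
have := coefE b.+1 a.+1.
rewrite !(coefpsCM y) !(coefpsCM (y ^+ 3)) !coefpsXM coef_in2 !coef3 -mulrDr => <-.
by case: (b == 2); case: (a == 2); rewrite ?coefps0.
Qed.
End Kernel.

(** The root - t y1 / (t + 2 y1) of the kernel is not a power series over Q[[t]], so it is not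
    substituted. Divisibility by the kernel suffices: the cofactor has so many zero coefficients
    that [e] has none beyond y^2, and the values of [F 0] and [F 1] make [e] divisible by y^2. *)
Lemma mom_cubic (F : nat -> pseries rat) (G : nat -> nat -> pseries rat) :
  let t := psX rat in
  F 0 = 1 -> F 1 = 0 ->
  (forall k, 2 * F k.+1 = t * (F k.+2 + G k 0) +
     4 * t * \sum_(i < k) F i * F (k - i.+1)%N) ->
  (forall a b, 2 * G a b = - t * (G a.+1 b + G a b.+1) - 4 * t * F a * F b) ->
  (forall a, G 0 a = G a 0) ->
  cubic_lhs (psC t) (psX _) (PSeries F) =
    psC (t ^+ 3 - 2 * t ^+ 2 * F 2) * psX _ ^+ 2.
Proof.
move=> t F0 F1 F_rec G_rec G_sym; set e := cubic_lhs _ _ _.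
have [K sepK] := separation F0 F1 F_rec G_rec G_sym.
pose k b a := pcoef (pcoef K b) a.
have [k0 rec] : (forall a, t * k 0%N a = 0) /\ forall b a,
    2 * k b a + t * (k b.+1 a + k b a.+1) =
    12 * (if b == 2%N then pcoef e a else 0) - 12 * (if a == 2%N then pcoef e b else 0).
  exact: kernel_coef sepK.
have muln_inj (n : nat) (H H' : pseries rat) : n.+1%:R * H = n.+1%:R * H' -> H = H'.
  by rewrite !mulr_natl => /eqP; rewrite -subr_eq0 -mulrnBl ps_mulrn_eq0 subr_eq0 => /eqP.
have tI (H : pseries rat) : t * H = 0 -> H = 0.
  by move=> tH; apply: psX_inj; rewrite mulr0.
(* In this range [2 * k b a] is t times other coefficients of the same range, hence [k b a] is
   divisible by every power of t. *)
have far b a : (3 <= b)%N -> (3 <= a)%N -> k b a = 0.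
  move=> le3b le3a; apply: pseriesP => n; rewrite coefps0.
  elim: n b a le3b le3a => [|n IH] b a le3b le3a; have := rec b a;
    rewrite !gtn_eqF // !mulr0 subrr mulr_natl => /(congr1 (fun H => pcoef H _)).
    move/(_ 0%N); rewrite coefpsD coefpsMn coefpsXM coefps0 addr0 => /eqP.
    by rewrite mulrn_eq0 => /eqP.
  move/(_ n.+1); rewrite coefpsD coefpsMn coefpsXM coefps0 coefpsD !IH ?leqW //.
  by rewrite !addr0 => /eqP; rewrite mulrn_eq0 => /eqP.
(* From [k 0 a = 0] the relation propagates upwards in [b], as long as its right-hand side is
   zero. *)
have near b a : (b <= 2)%N -> (3 <= a)%N -> k b a = 0.
  elim: b a => [|b IH] a le_b le3a; first exact/tI/k0.
  have := rec b a; rewrite (ltn_eqF le_b) (gtn_eqF le3a) !mulr0 subrr.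
  by rewrite !IH ?(ltnW le_b) ?leqW // mulr0 add0r addr0 => /tI.
have e_far a : (3 <= a)%N -> pcoef e a = 0.
  move=> le3a; have := rec 2%N a; rewrite eqxx (gtn_eqF le3a) mulr0 subr0.
  have n1 := near 2%N a isT le3a; have n2 := near 2%N a.+1 isT (leqW le3a).
  rewrite n1 n2 (far 3%N a isT le3a).
  rewrite !mulr0 !addr0 mulr0 addr0 => /esym e0.
  by apply: (muln_inj 11%N); rewrite mulr0.
pose y := psX (pseries rat); pose tau := psC t; pose M := PSeries F.
pose M' := pshift (pshift M).
have M_E : M = 1 + y ^+ 2 * M'.
  rewrite (ps_shiftE M) (ps_shiftE (pshift M)) /= F0 F1 rmorph1 rmorph0 add0r.
  by rewrite expr2 mulrA.
(* The quotient of [e] by y^2: the terms of [cubic_lhs] of lower order in y are cancelled by writing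
   M = 1 + y^2 M'. *)
pose e' := 4 * tau ^+ 3 * y ^+ 3 * M ^+ 3 +
  (tau ^+ 3 - 10 * tau ^+ 2 * y - 8 * tau * y ^+ 2) * M ^+ 2 +
  (4 + 6 * tau ^+ 2 * y) * M - 4 + (2 * tau * y - 2 * tau ^+ 2) * M'.
have eE : e = y ^+ 2 * e'.
  by rewrite /e /cubic_lhs /e' -/y -/tau -/M M_E; ring.
rewrite eE mulrC; congr (_ * _); apply: pseriesP => n.
rewrite coefpsC; case: n => [|n] /=; last first.
  by rewrite -(e_far n.+3) // eE coefpsXnM.
have -> : e' = psC (t ^+ 3 - 2 * t ^+ 2 * F 2) + y * (4 * tau ^+ 3 * y ^+ 2 * M ^+ 3 +
  (- 10 * tau ^+ 2 - 8 * tau * y) * M ^+ 2 + 6 * tau ^+ 2 * M + 2 * tau * M' +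
  tau ^+ 3 * (2 + y ^+ 2 * M') * y * M' + 4 * y * M' - 2 * tau ^+ 2 * pshift M').
  have -> : psC (t ^+ 3 - 2 * t ^+ 2 * F 2) = tau ^+ 3 - 2 * tau ^+ 2 * psC (F 2).
    by rewrite rmorphB rmorphXn 2!rmorphM rmorphXn rmorph_nat.
  rewrite /e'.
  have M'E : M' = psC (F 2) + y * pshift M' by rewrite {1}(ps_shiftE M').
  rewrite M_E; set N := pshift M' in M'E *; rewrite M'E; ring.
by rewrite coefpsD coefpsXM addr0 coefpsC.
Qed.

(** * Rational parametrisation *)

(* Rational parametrisation, by s, of the cubic curve over Q(t, q), q = 1 + 2S. *)
Lemma cubic_param (R : idomainType) (t q y s M : R) :
  let S := t ^+ 3 * q ^+ 2 in
  let E := 1 + t ^+ 2 * q * s in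
  let D := 1 + 2 * t ^+ 2 * q * s + 2 * t * q * s ^+ 2 + 2 * t ^+ 3 * q ^+ 2 * s ^+ 3 in
  q = 1 + 2 * S -> y * D = s * E -> M * E ^+ 2 = D * (1 - t ^+ 4 * q ^+ 3 * s ^+ 2) ->
  D != 0 -> E != 0 ->
  cubic_lhs t y M = (t ^+ 3 - 4 * t ^+ 3 * (1 + S - S ^+ 2)) * y ^+ 2.
Proof.
move=> S E D qE yD ME D0 E0; apply/eqP; rewrite -subr_eq0.
(* After this multiplication [M] and [y] can be grouped into [M * E ^+ 2] and [y * D], which the
   hypotheses express by [t], [q], [s]. *)
set P := _ - _; suff : D ^+ 2 * E ^+ 6 * P = 0.
  by move/eqP; rewrite !mulf_eq0 ?expf_eq0 /= (negPf D0) (negPf E0).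
have DE : D = 1 + 2 * t ^+ 2 * q * s + 2 * t * q * s ^+ 2 + 2 * t ^+ 3 * q ^+ 2 * s ^+ 3.
  by [].
have EE : E = 1 + t ^+ 2 * q * s by [].
clearbody D E.
pose g := 1 - t ^+ 4 * q ^+ 3 * s ^+ 2; rewrite -/g in ME.
pose e4 := 4 * t ^+ 3 * (1 + S - S ^+ 2) - t ^+ 3 - 4.
have -> : D ^+ 2 * E ^+ 6 * P = D ^+ 2 * (4 * t ^+ 3 * y ^+ 5 * (M * E ^+ 2) ^+ 3 +
  (t ^+ 3 * y ^+ 2 - 10 * t ^+ 2 * y ^+ 3 - 8 * t * y ^+ 4) * (M * E ^+ 2) ^+ 2 * E ^+ 2 +
  (4 * y ^+ 2 + 2 * t * y - 2 * t ^+ 2 + 6 * t ^+ 2 * y ^+ 3) * (M * E ^+ 2) * E ^+ 4 +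
  (2 * t ^+ 2 - 2 * t * y + e4 * y ^+ 2) * E ^+ 6).
  by rewrite /P /cubic_lhs /e4; ring.
rewrite ME.
have -> : D ^+ 2 * (4 * t ^+ 3 * y ^+ 5 * (D * g) ^+ 3 +
  (t ^+ 3 * y ^+ 2 - 10 * t ^+ 2 * y ^+ 3 - 8 * t * y ^+ 4) * (D * g) ^+ 2 * E ^+ 2 +
  (4 * y ^+ 2 + 2 * t * y - 2 * t ^+ 2 + 6 * t ^+ 2 * y ^+ 3) * (D * g) * E ^+ 4 +
  (2 * t ^+ 2 - 2 * t * y + e4 * y ^+ 2) * E ^+ 6) =
  4 * t ^+ 3 * (y * D) ^+ 5 * g ^+ 3 +
  (t ^+ 3 * (y * D) ^+ 2 * D ^+ 2 - 10 * t ^+ 2 * (y * D) ^+ 3 * D -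
   8 * t * (y * D) ^+ 4) * g ^+ 2 * E ^+ 2 +
  (4 * (y * D) ^+ 2 * D + 2 * t * (y * D) * D ^+ 2 - 2 * t ^+ 2 * D ^+ 3 +
   6 * t ^+ 2 * (y * D) ^+ 3) * g * E ^+ 4 +
  (2 * t ^+ 2 * D ^+ 2 - 2 * t * (y * D) * D + e4 * (y * D) ^+ 2) * E ^+ 6.
  by ring.
rewrite yD.
(* What remains vanishes only modulo the relation between [q] and [t]; [c] is the cofactor of that
   relation, up to [E ^+ 4]. *)
pose c :=
  2 * t^+14 * q^+6 * s^+6 - 4 * t^+13 * q^+7 * s^+10 - 2 * t^+12 * q^+6 *
  s^+8 + 8 * t^+12 * q^+5 * s^+5 - 20 * t^+11 * q^+6 * s^+9 + t^+11 * q^+5 *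
  s^+6 - 3 * t^+11 * q^+4 * s^+6 - 26 * t^+10 * q^+5 * s^+7 + 12 * t^+10 *
  q^+4 * s^+4 - 40 * t^+9 * q^+5 * s^+8 + 8 * t^+9 * q^+4 * s^+8 - 4 * t^+9
  * q^+4 * s^+5 - 12 * t^+9 * q^+3 * s^+5 - 44 * t^+8 * q^+4 * s^+6 - 6 *
  t^+8 * q^+3 * s^+6 + 8 * t^+8 * q^+3 * s^+3 - 32 * t^+7 * q^+4 * s^+7 + 24
  * t^+7 * q^+3 * s^+7 - 6 * t^+7 * q^+3 * s^+4 - 22 * t^+7 * q^+2 * s^+4 -
  24 * t^+6 * q^+3 * s^+5 - 2 * t^+6 * q^+2 * s^+5 + 2 * t^+6 * q^+2 * s^+2
  - 8 * t^+5 * q^+3 * s^+6 + 40 * t^+5 * q^+2 * s^+6 - 2 * t^+5 * q^+2 *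
  s^+3 - 4 * t^+5 * q * s^+6 - 16 * t^+5 * q * s^+3 - 4 * t^+4 * q^+2 * s^+4
  + 8 * t^+4 * q * s^+4 + 32 * t^+3 * q * s^+5 - 4 * t^+3 * s^+5 - 4 * t^+3
  * s^+2 + 4 * t^+2 * s^+3 + 8 * t * s^+4.
transitivity (E ^+ 4 * (c * (q - (1 + 2 * S)))); last by rewrite -qE subrr !mulr0.
rewrite DE /c /e4 /g /S; rewrite EE; ring.
Qed.

Section EqUpto.
Variable R : comNzRingType.
Implicit Types F G H : pseries R.

Lemma eq_upto_refl n F : eq_upto n F F. Proof. by []. Qed.

Lemma eq_upto_opp n F G : eq_upto n F G -> eq_upto n (- F) (- G).
Proof. by move=> eqFG i lt_in; rewrite !coefpsN eqFG. Qed.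

Lemma contracting_psX (c : pseries R) h :
  (forall n F G, eq_upto n F G -> eq_upto n (h F) (h G)) ->
  contracting (fun F => c + psX R * h F).
Proof.
by move=> congr_h n F G eqFG; apply/eq_upto_add/eq_upto_psX/congr_h.
Qed.
End EqUpto.

Ltac eq_upto_tac := repeat first [apply: eq_upto_refl | assumption
  | apply: eq_upto_add | apply: eq_upto_opp | apply: eq_upto_exp | apply: eq_upto_mul].

Lemma cubic_solution (O : idomainType) (t q : O) : let S := t ^+ 3 * q ^+ 2 in
  q = 1 + 2 * S -> exists M : pseries O, pcoef M 0 = 1 /\
  cubic_lhs (psC t) (psX O) M =
  psC (t ^+ 3 - 4 * t ^+ 3 * (1 + S - S ^+ 2)) * psX O ^+ 2.
Proof.
move=> S qE; pose y := psX O; pose T := psC t; pose Q := psC q.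
(* The equation [y * D = s * E] with [s = y * r], divided by y and solved for the leading [r], is a
   fixed point equation contracting in y. *)
pose h r := 2 * T ^+ 2 * Q * r + 2 * T * Q * y * r ^+ 2 +
  2 * T ^+ 3 * Q ^+ 2 * y ^+ 2 * r ^+ 3 + - (T ^+ 2 * Q * r ^+ 2).
have [|r rE] := @contracting_fixpoint _ (fun r => 1 + y * h r).
  by apply: contracting_psX => n F G eqFG; rewrite /h; eq_upto_tac.
(* [u] is the inverse of [E], used to write [M] without denominator. *)
have [|u uE] := @contracting_fixpoint _ (fun u => 1 + y * - (T ^+ 2 * Q * r * u)).
  by apply: contracting_psX => n F G eqFG; eq_upto_tac.
pose s := y * r; pose E := 1 + T ^+ 2 * Q * s.
pose D := 1 + 2 * T ^+ 2 * Q * s + 2 * T * Q * s ^+ 2 + 2 * T ^+ 3 * Q ^+ 2 * s ^+ 3.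
have DE : D = r * E.
  transitivity (1 + y * h r + T ^+ 2 * Q * y * r ^+ 2); last by rewrite rE /E /s; ring.
  by rewrite /D /h /s; ring.
have Eu : E * u = 1.
  by rewrite -[RHS](addrK (y * - (T ^+ 2 * Q * r * u))) uE /E /s; ring.
have head1 (c F : pseries O) : pcoef (1 + y * F) 0 = 1.
  by rewrite coefpsD coefps1 coefpsXM addr0.
have r0 : pcoef r 0 = 1 by rewrite -rE head1.
have u0 : pcoef u 0 = 1 by rewrite -uE head1.
have neq0 F : pcoef F 0 = 1 -> F != 0.
  by move=> F0; apply/eqP => F_0; move/eqP: F0; rewrite F_0 coefps0 eq_sym oner_eq0.
have E0 : E != 0 by apply: contraTneq isT => E_0; move/eqP: Eu; rewrite E_0 mul0r eq_sym oner_eq0.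
have D0 : D != 0 by rewrite DE; apply: mulf_neq0; [apply: neq0 r0 | exact: E0].
have coef0M (F G : pseries O) : pcoef (F * G) 0 = pcoef F 0 * pcoef G 0.
  by rewrite coefpsM big_ord1.
exists (r * u * (1 - T ^+ 4 * Q ^+ 3 * s ^+ 2)); split.
  rewrite !coef0M r0 u0 !mul1r coefpsB coefps1.
  have -> : T ^+ 4 * Q ^+ 3 * s ^+ 2 = y * (T ^+ 4 * Q ^+ 3 * r * s) by rewrite /s; ring.
  by rewrite coefpsXM subr0.
have QE : Q = 1 + 2 * (T ^+ 3 * Q ^+ 2).
  by rewrite -!rmorphXn -rmorphM -(rmorph_nat (@psC O)) -rmorphM -(rmorph1 (@psC O)) -rmorphD -qE.
rewrite (@cubic_param _ T Q y s _ QE) //.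
- congr (_ * _); rewrite /S !(rmorphB, rmorphD, rmorphM, rmorphXn, rmorph1, rmorph_nat).
  by [].
- by rewrite -/D DE /s -/E; ring.
rewrite -/D -/E DE; transitivity (r * E * (E * u) * (1 - T ^+ 4 * Q ^+ 3 * s ^+ 2)).
  by ring.
by rewrite Eu mulr1.
Qed.

(** * Uniqueness of the solution of the cubic as a power series *)

Section Uniqueness.
Variable K : numDomainType.
Let R := pseries (pseries K).
Let t := psX K.
Implicit Types F G : R.

(** Congruence modulo t^n: t is the inner variable, y the outer one. *)
Definition agree n F G := forall k, eq_upto n (pcoef F k) (pcoef G k).

Lemma agreeD n F F' G G' : agree n F F' -> agree n G G' -> agree n (F + G) (F' + G').
Proof. by move=> eqF eqG k; rewrite !coefpsD; apply: eq_upto_add. Qed.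

Lemma agreeM n F F' G G' : agree n F F' -> agree n G G' -> agree n (F * G) (F' * G').
Proof.
move=> eqF eqG k i lt_in; rewrite !coefpsM !coefps_sum; apply: eq_bigr => j _.
exact: eq_upto_mul.
Qed.

Lemma agree_refl n F : agree n F F. Proof. by []. Qed.

Lemma agreeX n F F' k : agree n F F' -> agree n (F ^+ k) (F' ^+ k).
Proof.
move=> eqF; elim: k => [|k IH].
  rewrite expr0.
  rewrite expr0.
  exact: agree_refl.
rewrite exprS.
rewrite exprS.
exact: agreeM.
Qed.

Lemma agree_t n F F' : agree n F F' -> agree n.+1 (psC t * F) (psC t * F').
Proof. by move=> eqF k; rewrite !coefpsCM; apply/eq_upto_psX. Qed.

(** [cubic_lhs] is 4 y^2 (H - 1) + t W(H), so H modulo t^n determines its coefficients modulo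
    t^(n+1). The constants only touch y^2, that is the constant term of H, which is prescribed;
    hence they may differ a priori. *)
Lemma cubic_unique (c c' : pseries K) F G : pcoef F 0 = 1 -> pcoef G 0 = 1 ->
  cubic_lhs (psC t) (psX _) F = psC c * psX _ ^+ 2 ->
  cubic_lhs (psC t) (psX _) G = psC c' * psX _ ^+ 2 -> F = G.
Proof.
move=> F0 G0 eqF eqG; pose y : R := psX _; pose T : R := psC t.
pose W H := 4 * T ^+ 2 * y ^+ 5 * H ^+ 3 +
  (T ^+ 2 * y ^+ 2 - 10 * T * y ^+ 3 - 8 * y ^+ 4) * H ^+ 2 +
  (2 * y - 2 * T + 6 * T * y ^+ 3) * H + (2 * T - 2 * y).
have split H : cubic_lhs T y H = (y ^+ 2 * (H - 1)) *+ 4 + T * W H.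
  by rewrite /cubic_lhs /W; ring.
rewrite split in eqF; rewrite split in eqG.
suff main n : agree n F G.
  by apply: pseriesP => k; apply: pseriesP => n; apply: (main n.+1).
elim: n => [//|n IH]; have WW : agree n (W F) (W G).
  rewrite /W; repeat lazymatch goal with
    | |- agree _ ?A ?A => exact: agree_refl
    | |- agree _ (_ + _) _ => apply: agreeD
    | |- agree _ (_ * _) _ => apply: agreeM
    | |- agree _ (_ ^+ _) _ => apply: agreeX
    | _ => exact: IH
    end.
have TW := agree_t WW.
case=> [|k]; first by rewrite F0 G0.
have coefE H (d : pseries K) : (y ^+ 2 * (H - 1)) *+ 4 + T * W H = psC d * y ^+ 2 ->
    pcoef H k.+1 *+ 4 = - pcoef (T * W H) k.+3.
  move/(congr1 (fun H' => pcoef H' k.+3)).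
  rewrite coefpsD coefpsMn coefpsXnM /= coefpsB coefps1 subr0 (coefpsCM d) coefpsXn mulr0.
  by move/eqP; rewrite addr_eq0 => /eqP.
move=> i lt_in.
have eF : pcoef (pcoef F k.+1) i *+ 4 = - pcoef (pcoef (T * W F) k.+3) i.
  by rewrite -coefpsMn (coefE _ _ eqF) coefpsN.
have eG : pcoef (pcoef G k.+1) i *+ 4 = - pcoef (pcoef (T * W G) k.+3) i.
  by rewrite -coefpsMn (coefE _ _ eqG) coefpsN.
by apply: (@pmulrnI _ 4) => //; rewrite eF eG (TW k.+3 i lt_in).
Qed.
End Uniqueness.

(** * Coefficients *)

Section Scale.
Variables (O : comNzRingType) (a : O).

Fact ps_scale_key : unit. Proof. by []. Qed.
Definition ps_scale (F : pseries O) : pseries O :=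
  locked_with ps_scale_key (PSeries (fun k => a ^+ k * pcoef F k)).

Lemma coefps_scale F k : pcoef (ps_scale F) k = a ^+ k * pcoef F k.
Proof. by rewrite /ps_scale unlock. Qed.

Lemma ps_scale_is_additive : zmod_morphism ps_scale.
Proof.
by move=> F G; apply: pseriesP => k; rewrite coefpsB !coefps_scale coefpsB mulrBr.
Qed.
Lemma ps_scale_is_multiplicative : monoid_morphism ps_scale.
Proof.
split=> [|F G]; apply: pseriesP => k.
  by rewrite coefps_scale coefps1; case: k => [|k]; rewrite ?mulr1 ?mulr0.
rewrite coefps_scale !coefpsM big_distrr /=; apply: eq_bigr => i _.
rewrite !coefps_scale -{1}(subnKC (ltnSE (ltn_ord i))) exprD; ring.
Qed.
HB.instance Definition _ := GRing.isZmodMorphism.Build (pseries O) (pseries O)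
  ps_scale ps_scale_is_additive.
HB.instance Definition _ := GRing.isMonoidMorphism.Build (pseries O) (pseries O)
  ps_scale ps_scale_is_multiplicative.

Lemma ps_scaleC c : ps_scale (psC c) = psC c.
Proof.
apply: pseriesP => k; rewrite coefps_scale coefpsC.
by case: k => [|k]; rewrite ?mul1r ?mulr0.
Qed.

Lemma ps_scaleX : ps_scale (psX O) = psC a * psX O.
Proof.
apply: pseriesP => k; rewrite coefps_scale coefpsCM coefpsX.
by case: eqP => [->|_]; rewrite ?expr1 ?mulr0.
Qed.
End Scale.

(** With y = t u, and after division by t^2, the variable t enters the cubic through T = t^3 only;
    and t^3 is a rational function of S. This is why t^i Q_i is the right normalisation. *)
Definition scaled_lhs (R : comNzRingType) (T u H : R) := 4 * T ^+ 2 * u ^+ 5 * H ^+ 3 +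
  T * (u ^+ 2 - 10 * u ^+ 3 - 8 * u ^+ 4) * H ^+ 2 +
  (4 * u ^+ 2 + 2 * u - 2 + 6 * T * u ^+ 3) * H + 2 - 2 * u - 4 * u ^+ 2.

Lemma cubic_scaled (R : comNzRingType) (t u H : R) :
  cubic_lhs t (t * u) H = t ^+ 2 * scaled_lhs (t ^+ 3) u H.
Proof. by rewrite /cubic_lhs /scaled_lhs; ring. Qed.

Lemma scale_cubic (O : idomainType) (t c : O) (M : pseries O) : t != 0 ->
  cubic_lhs (psC t) (psX O) M = psC c * psX O ^+ 2 ->
  scaled_lhs (psC (t ^+ 3)) (psX O) (ps_scale t M) = psC c * psX O ^+ 2.
Proof.
move=> t0 cubicM; have Ct0 : psC t != 0.
  apply/eqP => Ct; case/eqP: t0; have := congr1 (fun F => pcoef F 0) Ct.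
  by rewrite coefpsC coefps0.
apply: (mulfI (expf_neq0 2 Ct0)).
have := congr1 (ps_scale t) cubicM; rewrite rmorph_cubic_lhs rmorphM rmorphXn /=.
rewrite !ps_scaleC ps_scaleX cubic_scaled.
have <- : psC (t ^+ 3) = psC t ^+ 3 by rewrite rmorphXn.
by move=> ->; ring.
Qed.

Section Closure.
Variables (O : comNzRingType) (P : O -> Prop).
Hypotheses (P1 : P 1) (PB : forall a b, P a -> P b -> P (a - b)).
Hypotheses (PM : forall a b, P a -> P b -> P (a * b)).
Hypothesis P_half : forall a, P (a *+ 2) -> P a.

Let P0 : P 0. Proof. by rewrite -(subrr 1); apply: PB. Qed.
Let PN a : P a -> P (- a). Proof. by move=> Pa; rewrite -[- a]sub0r; apply: PB. Qed.
Let PD a b : P a -> P b -> P (a + b).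
Proof. by move=> Pa Pb; rewrite -[b]opprK; apply/PB/PN. Qed.
Let Pn n : P n%:R.
Proof. by elim: n => // n IH; rewrite mulrS; apply: PD. Qed.

Let ok n (F : pseries O) := forall i, (i < n)%N -> P (pcoef F i).

Let okD n F G : ok n F -> ok n G -> ok n (F + G).
Proof. by move=> okF okG i lt_in; rewrite coefpsD; apply/PD/okG => //; apply: okF. Qed.
Let okN n F : ok n F -> ok n (- F).
Proof. by move=> okF i lt_in; rewrite coefpsN; apply/PN/okF. Qed.
Let okM n F G : ok n F -> ok n G -> ok n (F * G).
Proof.
move=> okF okG i lt_in; rewrite coefpsM; apply: big_ind => //= k _.
have le_ki : (k <= i)%N by rewrite -ltnS.
apply: PM; [apply: okF | apply: okG].
  exact: leq_ltn_trans lt_in.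
exact: leq_ltn_trans (leq_subr _ _) lt_in.
Qed.
Let ok1 n : ok n 1. Proof. by move=> i _; rewrite coefps1. Qed.
Let okX n F k : ok n F -> ok n (F ^+ k).
Proof.
move=> okF; elim: k => [|k IH]; first by rewrite expr0; apply: ok1.
by rewrite exprS; apply: okM.
Qed.
Let okn n k : ok n k%:R.
Proof.
elim: k => [|k IH]; first by move=> i _; rewrite coefps0.
by rewrite mulrS; apply: okD => //; apply: ok1.
Qed.
Let okC n a : P a -> ok n (psC a).
Proof. by move=> Pa i _; rewrite coefpsC; case: eqP. Qed.
Let oky n : ok n (psX O). Proof. by move=> i _; rewrite coefpsX. Qed.
Let ok_psX n F : ok n F -> ok n.+1 (psX O * F).
Proof. by move=> okF [|i] lt_in; rewrite coefpsXM //; apply: okF. Qed.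

(** The cubic gives twice each coefficient as a polynomial in [T], [c] and earlier coefficients, so
    only 2 is ever inverted. [P] is abstract in order to cover both rational functions of S and
    elements of Q(t) + Q(t) S. *)
Lemma scaled_closed (T c : O) (N : pseries O) : P T -> P c ->
  scaled_lhs (psC T) (psX O) N = psC c * psX O ^+ 2 -> forall k, P (pcoef N k).
Proof.
move=> PT Pc eqN; pose y := psX O; pose TT := psC T.
pose W := (2 + 4 * y + 6 * TT * y ^+ 2) * N + TT * (y + - (10 * y ^+ 2) + - (8 * y ^+ 3)) * N ^+ 2
  + 4 * TT ^+ 2 * y ^+ 4 * N ^+ 3.
have NE : N *+ 2 = 2 + - (2 * y) + - (4 * y ^+ 2) + - (psC c * y ^+ 2) + y * W.
  rewrite -/y in eqN; rewrite -eqN /scaled_lhs /W -/TT; ring.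
suff main n : ok n N by move=> k; apply: (main k.+1).
elim: n => // n IH; suff : ok n.+1 (N *+ 2).
  by move=> ok2 i lt_in; apply: P_half; rewrite -coefpsMn; apply: ok2.
have okT m : ok m (psC T) by apply: okC.
have okc m : ok m (psC c) by apply: okC.
have okW : ok n W.
  rewrite /W; repeat lazymatch goal with
    | |- ok _ N => exact: IH
    | |- ok _ (_ + _) => apply: okD
    | |- ok _ (- _) => apply: okN
    | |- ok _ (_ * _) => apply: okM
    | |- ok _ (_ ^+ _) => apply: okX
    | |- ok _ (psC _) => first [exact: okT | exact: okc]
    | |- ok _ (psX _) => exact: oky
    | |- ok _ y => exact: oky
    | |- ok _ TT => exact: okT
    | _ => exact: okn
    end.
rewrite NE; apply: okD; last exact: ok_psX.
repeat lazymatch goal with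
    | |- ok _ (_ + _) => apply: okD
    | |- ok _ (- _) => apply: okN
    | |- ok _ (_ * _) => apply: okM
    | |- ok _ (_ ^+ _) => apply: okX
    | |- ok _ (psC _) => first [exact: okT | exact: okc]
    | |- ok _ y => exact: oky
    | _ => exact: okn
    end.
Qed.
End Closure.

(** The coefficient of y^3 in the cubic: [c] is absent from it. *)
Lemma cubic_coef3 (O : comNzRingType) (t c : O) (M : pseries O) :
  pcoef M 0 = 1 -> pcoef M 1 = 0 ->
  cubic_lhs (psC t) (psX O) M = psC c * psX O ^+ 2 ->
  2 * t * pcoef M 2 = 4 * t ^+ 2 + 2 * t ^+ 2 * pcoef M 3.
Proof.
move=> M0 M1 eqM; pose y := psX O.
pose n1 := 4 * t ^+ 3; pose n2 := t ^+ 3; pose n3 := 10 * t ^+ 2; pose n4 := 8 * t.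
pose n5 : O := 4; pose n6 := 2 * t; pose n7 := 2 * t ^+ 2; pose n8 := 6 * t ^+ 2.
have E : psC n1 * (y ^+ 5 * M ^+ 3) + psC n2 * (y ^+ 2 * M ^+ 2) +
    - (psC n3 * (y ^+ 3 * M ^+ 2)) + - (psC n4 * (y ^+ 4 * M ^+ 2)) +
    psC n5 * (y ^+ 2 * M) + psC n6 * (y * M) + - (psC n7 * M) +
    psC n8 * (y ^+ 3 * M) + psC n7 + - (psC n6 * y) + - (psC n5 * y ^+ 2) =
    psC c * y ^+ 2.
  rewrite -eqM /cubic_lhs /n1 /n2 /n3 /n4 /n5 /n6 /n7 /n8.
  rewrite !(rmorphXn, rmorphM, rmorph_nat) /= -/y; ring.
have := congr1 (fun F => pcoef F 3) E.
rewrite !coefpsD !coefpsN.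
rewrite (coefpsCM n1) (coefpsCM n2) (coefpsCM n3) (coefpsCM n4) !(coefpsCM n5).
rewrite !(coefpsCM n6) !(coefpsCM n7) !(coefpsCM n8) (coefpsCM c) (coefpsC n7).
rewrite !coefpsXnM coefpsXM !coefpsXn coefpsX /= !subSS !subn0.
have -> : pcoef (M ^+ 2) 1 = 0.
  by rewrite expr2 coefpsM !big_ord_recl big_ord0 /= /bump /= subn0 subnn M1; ring.
have -> : pcoef (M ^+ 2) 0 = 1 by rewrite expr2 coefpsM big_ord1 M0 mulr1.
rewrite M0 M1 /n1 /n2 /n3 /n4 /n5 /n6 /n7 /n8 => /eqP; rewrite -subr_eq0 => /eqP coef0.
apply/eqP; rewrite -subr_eq0; apply/eqP; rewrite -[RHS]coef0; ring.
Qed.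

Lemma psX_neq0 (R : comNzRingType) : psX R != 0.
Proof.
apply/eqP => /(congr1 (fun F => pcoef F 1)) /eqP.
by rewrite coefpsX coefps0 oner_eq0.
Qed.

Section Param.
Local Notation t := (psX rat).
Variable S : pseries rat.
Hypothesis S_eq : S = t ^+ 3 * (1 + 2 * S) ^+ 2.

Let q := 1 + 2 * S.
Let M := PSeries mom.
Definition e_coef := t ^+ 3 - 4 * t ^+ 3 * (1 + S - S ^+ 2).

Lemma two_inj : injective (fun F : pseries rat => 2 * F).
Proof.
move=> F G; rewrite !mulr_natl => /eqP.
by rewrite -subr_eq0 -mulrnBl ps_mulrn_eq0 subr_eq0 => /eqP.
Qed.

(** Two solutions of the cubic with a priori different constants coincide by [cubic_unique];
    equating the constants then yields [mom 2]. *)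
Lemma mom_param : mom 2 = 2 * t * (1 + S - S ^+ 2) /\
  cubic_lhs (psC t) (psX _) M = psC e_coef * psX _ ^+ 2.
Proof.
have cubicM := mom_cubic mom0 mom1 mom_rec mom2_rec mom2_sym0.
have qE : q = 1 + 2 * (t ^+ 3 * q ^+ 2) by rewrite -S_eq.
have [M' [M'0 cubicM']] := cubic_solution qE.
rewrite -S_eq -/e_coef in cubicM'.
have eqM : M = M'.
  by apply: (@cubic_unique rat _ _ M M' _ M'0 cubicM cubicM'); rewrite /= mom0.
split; last by rewrite eqM.
have e_eq : t ^+ 3 - 2 * t ^+ 2 * mom 2 = e_coef.
  have := congr1 (fun F => pcoef F 2) (etrans (esym cubicM) (etrans (congr1 _ eqM) cubicM')).
  rewrite (coefpsCM (t ^+ 3 - _)) (coefpsCM e_coef) !coefpsXn !mulr1.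
  exact.
apply: two_inj; apply: psX_inj; apply: psX_inj.
apply: (addrI (t ^+ 3 - 2 * t ^+ 2 * mom 2)).
by rewrite {2}e_eq /e_coef; ring.
Qed.

Lemma mom_three : mom 3 = 2 * S * (1 - S).
Proof.
have [m2 cubicM] := mom_param.
have := @cubic_coef3 _ t _ M mom0 mom1 cubicM; rewrite [pcoef M 2]/= [pcoef M 3]/= m2 => eq3.
apply: two_inj; apply: psX_inj; apply: psX_inj.
apply: (addrI (4 * t ^+ 2)); transitivity (4 * t ^+ 2 + 2 * t ^+ 2 * mom 3); first by ring.
by rewrite -eq3; ring.
Qed.

Lemma mom_closed (P : pseries rat -> Prop) :
  P 1 -> (forall a b, P a -> P b -> P (a - b)) ->
  (forall a b, P a -> P b -> P (a * b)) -> (forall a, P (a *+ 2) -> P a) ->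
  P (t ^+ 3) -> P S -> forall k, P (t ^+ k * mom k).
Proof.
move=> P1 PB PM P_half PT PS k.
have [_ /(scale_cubic (psX_neq0 _)) scaled] := mom_param.
have := scaled_closed P1 PB PM P_half PT _ scaled k; rewrite coefps_scale; apply.
have P0 : P 0 by rewrite -(subrr 1); apply: PB.
have PD a b : P a -> P b -> P (a + b).
  by move=> Pa Pb; rewrite -[b]opprK -[- b]sub0r; apply: (PB _ _ Pa (PB _ _ P0 Pb)).
have P4 : P 4.
  have -> : (4 : pseries rat) = 1 + 1 + 1 + 1 by ring.
  exact: (PD _ _ (PD _ _ (PD _ _ P1 P1) P1) P1).
rewrite /e_coef; apply: (PB _ _ PT); apply: (PM _ _ (PM _ _ P4 PT)).
exact: (PB _ _ (PD _ _ P1 PS) (PM _ _ PS PS)).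
Qed.

End Param.

(** * Irreducibility *)

Section NoRationalRoot.
Variables (K : fieldType) (t e : K).
Hypotheses (two0 : 2 != 0 :> K) (t0 : t != 0).

(** Coefficients of the cubic as polynomials in y over [K], the term c y^2 being absorbed by
    [e = - 4 - c]. *)
Definition cub0 : {poly K} := 2 * t%:P ^+ 2 - 2 * t%:P * 'X + e%:P * 'X ^+ 2.
Definition cub1 : {poly K} :=
  4 * 'X ^+ 2 + 2 * t%:P * 'X - 2 * t%:P ^+ 2 + 6 * t%:P ^+ 2 * 'X ^+ 3.
Definition cub2 : {poly K} :=
  t%:P ^+ 3 * 'X ^+ 2 - 10 * t%:P ^+ 2 * 'X ^+ 3 - 8 * t%:P * 'X ^+ 4.
Definition cub3 : {poly K} := 4 * t%:P ^+ 3 * 'X ^+ 5.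

Lemma polyCX_eq0 (a : K) (Q : {poly K}) : a%:P + 'X * Q = 0 -> a = 0 /\ Q = 0.
Proof.
move=> aQ; have a0 : a = 0.
  by have := congr1 (fun p : {poly K} => p`_0) aQ; rewrite coefD coefC coefXM /= addr0 coef0.
split=> //; move/eqP: aQ; rewrite a0 add0r mulf_eq0 polyX_eq0 /=; exact: eqP.
Qed.

Let pow2 n : (2 ^ n)%:R != 0 :> K.
Proof. by rewrite natrX expf_neq0. Qed.

(** The first four equations leave three candidates: a = 0 with b = c = 0 or with b = 2/t and c =
    2/t^2, and a = -1/4 with b = 1/(2t) and c = 0. On each of them the fifth one reduces to a
    nonzero multiple of t^2. *)
Lemma no_small_root (a b c : K) :
  4 * t ^+ 3 * a ^+ 3 + t ^+ 3 * a ^+ 2 = 0 ->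
  12 * t ^+ 3 * a ^+ 2 * b + 2 * t ^+ 3 * a * b - 10 * t ^+ 2 * a ^+ 2 - 2 * t ^+ 2 * a = 0 ->
  12 * t ^+ 3 * (a * b ^+ 2 + a ^+ 2 * c) + t ^+ 3 * (2 * a * c + b ^+ 2)
    - 20 * t ^+ 2 * a * b - 8 * t * a ^+ 2 + 2 * t * a - 2 * t ^+ 2 * b = 0 ->
  4 * t ^+ 3 * (b ^+ 3 + 6 * a * b * c) + 2 * t ^+ 3 * b * c
    - 10 * t ^+ 2 * (b ^+ 2 + 2 * a * c) - 16 * t * a * b + 4 * a + 2 * t * b - 2 * t ^+ 2 * c = 0 ->
  12 * t ^+ 3 * (b ^+ 2 * c + a * c ^+ 2) + t ^+ 3 * c ^+ 2 - 20 * t ^+ 2 * b * c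
    - 8 * t * (b ^+ 2 + 2 * a * c) + 4 * b + 2 * t * c + 6 * t ^+ 2 * a + 2 * t ^+ 2 = 0 ->
  False.
Proof.
move=> k0 k1 k2 k3 k4; have four0 : 4 != 0 :> K by exact: (pow2 2).
have fin n m : (2 ^ n)%:R * t ^+ m = 0 -> False.
  by apply/eqP; rewrite mulf_neq0 ?expf_neq0.
have tI m x : t ^+ m * x = 0 -> x = 0.
  by move/eqP; rewrite mulf_eq0 expf_eq0 (negPf t0) andbF /= => /eqP.
have /tI : t ^+ 3 * (a ^+ 2 * (4 * a + 1)) = 0 by rewrite -[RHS]k0; ring.
move/eqP; rewrite mulf_eq0 expf_eq0 /= => /orP[] /eqP a_eq.
  rewrite {}a_eq in k1 k2 k3 k4.
  have /tI/eqP : t ^+ 2 * (b * (t * b - 2)) = 0 by rewrite -[RHS]k2; ring.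
  rewrite mulf_eq0 subr_eq0 => /orP[] /eqP b_eq.
    rewrite {}b_eq in k3 k4.
    have c0 : c = 0.
      apply: (tI 2) => //; apply/eqP; rewrite -(mulrI_eq0 _ (mulfI two0)).
      by apply/eqP; rewrite -oppr0 -[in RHS]k3; ring.
    by apply: (@fin 1 2)%N; rewrite -[RHS]k4 c0; ring.
  have b_div : b = 2 / t by rewrite -b_eq; field.
  rewrite {}b_div in k3 k4.
  have c_div : c = 2 / t ^+ 2.
    apply: (mulfI (mulf_neq0 two0 (expf_neq0 2 t0))); apply/eqP.
    by rewrite -subr_eq0; apply/eqP; rewrite -[RHS]k3; field.
  by apply: (@fin 1 3)%N; rewrite -(mulr0 t) -[in RHS]k4 c_div; field.
have a_div : a = - 4^-1.
  by apply: (mulfI four0); apply/eqP; rewrite -subr_eq0 -[in eqbRHS]a_eq mulrN divff // opprK eqxx.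
rewrite {}a_div in k1 k2 k3 k4.
have b_div : b = (2 * t)^-1.
  apply: (mulfI (mulf_neq0 two0 (expf_neq0 3 t0))); apply/eqP.
  by rewrite -subr_eq0; apply/eqP; rewrite -(mulr0 8) -[in RHS]k1; field; rewrite ?two0 ?t0 ?four0.
rewrite {}b_div in k2 k3 k4.
have c0 : c = 0.
  apply: (tI 3); apply: (mulfI four0); rewrite !mulr0.
  by rewrite -(mulr0 16) -[in RHS]k2; field; rewrite ?two0 ?t0 ?four0.
by apply: (@fin 1 2)%N; rewrite -(mulr0 4) -[in RHS]k4 c0; field; rewrite ?two0 ?t0 ?four0.
Qed.

(** If the degree of [N] exceeded 2, the cubic term would dominate all others. For smaller degree
    the five lowest coefficients are incompatible, whatever [e] is: it first enters with X^6. *)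
Lemma no_poly_root (N : {poly K}) :
  4 * t%:P ^+ 3 * N ^+ 3 +
  (t%:P ^+ 3 - 10 * t%:P ^+ 2 * 'X - 8 * t%:P * 'X ^+ 2) * N ^+ 2 +
  'X * cub1 * N + 'X ^+ 4 * cub0 != 0.
Proof.
apply/eqP => eqN.
have szN : (size N <= 3)%N.
  rewrite leqNgt; apply/negP => N_big.
  pose R : {poly K} := (t%:P ^+ 3 - 10 * t%:P ^+ 2 * 'X - 8 * t%:P * 'X ^+ 2) * N ^+ 2 +
    'X * cub1 * N + 'X ^+ 4 * cub0.
  have eqR : (4 * t ^+ 3)%:P * N ^+ 3 = - R.
    by apply/eqP; rewrite -subr_eq0 opprK -[eqbRHS]eqN /R !(rmorphM, rmorphXn, rmorph_nat); apply/eqP; ring.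
  have : size ((4 * t ^+ 3)%:P * N ^+ 3) = size (- R) by rewrite eqR.
  have four_t : 4 * t ^+ 3 != 0 by rewrite mulf_neq0 ?expf_neq0 //; exact: (pow2 2).
  rewrite mul_polyC size_scale // size_polyN; apply/eqP.
  have N0 : N != 0 by apply: contraTneq N_big => ->; rewrite size_poly0.
  have sN2 := size_exp N 2; have sN3 := size_exp N 3.
  have : (0 < size (N ^+ 3))%N by rewrite size_poly_gt0 expf_neq0.
  have : (0 < size (N ^+ 2))%N by rewrite size_poly_gt0 expf_neq0.
  have size3 (P Q : {poly K}) s : (size P <= s)%N -> (size (P * Q)%R <= (s + size Q).-1)%N.
    by move=> le_Ps; apply: leq_trans (size_polyMleq P Q) _; lia.
  have s2 : (size (t%:P ^+ 3 - 10 * t%:P ^+ 2 * 'X - 8 * t%:P * 'X ^+ 2)%R <= 3)%N.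
    have -> : t%:P ^+ 3 - 10 * t%:P ^+ 2 * 'X - 8 * t%:P * 'X ^+ 2 =
        Poly [:: t ^+ 3; - (10 * t ^+ 2); - (8 * t)].
      by rewrite /= !cons_poly_def; ring.
    exact: size_Poly.
  have s1 : (size ('X * cub1)%R <= 5)%N.
    have -> : 'X * cub1 = Poly [:: 0; - (2 * t ^+ 2); 2 * t; 4; 6 * t ^+ 2].
      by rewrite /= /cub1 !cons_poly_def; ring.
    exact: size_Poly.
  have s0 : (size ('X ^+ 4 * cub0)%R <= 7)%N.
    have -> : 'X ^+ 4 * cub0 = Poly [:: 0; 0; 0; 0; 2 * t ^+ 2; - (2 * t); e].
      by rewrite /= /cub0 !cons_poly_def; ring.
    exact: size_Poly.
  have := size3 _ (N ^+ 2) _ s2; have := size3 _ N _ s1.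
  have : (size R <= maxn (maxn (size ((t%:P ^+ 3 - 10 * t%:P ^+ 2 * 'X - 8 * t%:P * 'X ^+ 2) * N ^+ 2)%R)
      (size ('X * cub1 * N)%R)) (size ('X ^+ 4 * cub0)%R))%N.
    by rewrite /R (leq_trans (size_polyD _ _)) // geq_max leq_maxr andbT leq_max size_polyD.
  move: sN2 sN3 N_big s0; clearbody R.
  move: (size (N ^+ 2)) (size (N ^+ 3)) (size R) (size N) => u2 u3 r u1.
  move: (size (_ * N ^+ 2)) (size (_ * N)) (size (_ * cub0)) => a2 a1 a0; lia.
pose a := N`_0; pose b := N`_1; pose c := N`_2.
have NE : N = a%:P + b%:P * 'X + c%:P * 'X ^+ 2.
  apply/polyP => i; rewrite !coefD coefC !coefCM coefX coefXn.
  case: i => [|[|[|i]]]; rewrite ?mulr0 ?mulr1 ?addr0 ?add0r //.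
  exact/leq_sizeP/(leq_trans szN).
have E : (4 * t ^+ 3 * a ^+ 3 + t ^+ 3 * a ^+ 2)%:P + 'X * (
  (12 * t ^+ 3 * a ^+ 2 * b + 2 * t ^+ 3 * a * b - 10 * t ^+ 2 * a ^+ 2 - 2 * t ^+ 2 * a)%:P + 'X * (
  (12 * t ^+ 3 * (a * b ^+ 2 + a ^+ 2 * c) + t ^+ 3 * (2 * a * c + b ^+ 2)
    - 20 * t ^+ 2 * a * b - 8 * t * a ^+ 2 + 2 * t * a - 2 * t ^+ 2 * b)%:P + 'X * (
  (4 * t ^+ 3 * (b ^+ 3 + 6 * a * b * c) + 2 * t ^+ 3 * b * c
    - 10 * t ^+ 2 * (b ^+ 2 + 2 * a * c) - 16 * t * a * b + 4 * a + 2 * t * b - 2 * t ^+ 2 * c)%:P + 'X * (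
  (12 * t ^+ 3 * (b ^+ 2 * c + a * c ^+ 2) + t ^+ 3 * c ^+ 2 - 20 * t ^+ 2 * b * c
    - 8 * t * (b ^+ 2 + 2 * a * c) + 4 * b + 2 * t * c + 6 * t ^+ 2 * a + 2 * t ^+ 2)%:P + 'X * (
  (12 * t ^+ 3 * b * c ^+ 2 - 10 * t ^+ 2 * c ^+ 2 - 16 * t * b * c + 4 * c + 6 * t ^+ 2 * b - 2 * t)%:P +
  'X * (4 * t ^+ 3 * c ^+ 3 - 8 * t * c ^+ 2 + 6 * t ^+ 2 * c + e)%:P))))) = 0.
  by rewrite -[RHS]eqN NE /cub1 /cub0; ring.
have [k0 {}E] := polyCX_eq0 E; have [k1 {}E] := polyCX_eq0 E.
have [k2 {}E] := polyCX_eq0 E; have [k3 {}E] := polyCX_eq0 E.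
have [k4 _] := polyCX_eq0 E; exact: (no_small_root k0 k1 k2 k3 k4).
Qed.

(** Multiplied by X^4, the cubic becomes an equation for X^3 n / d with constant leading coefficient
    4 t^3. Such a fraction is integral over K[X], hence a polynomial, which [no_poly_root]
    excludes. *)
Lemma no_root (n d : {poly K}) : d != 0 ->
  cub3 * n ^+ 3 + cub2 * n ^+ 2 * d + cub1 * n * d ^+ 2 + cub0 * d ^+ 3 != 0.
Proof.
move=> d0; apply/eqP => root_nd; pose g := gcdp ('X ^+ 3 * n) d.
have g0 : g != 0 by rewrite gcdp_eq0 negb_and d0 orbT.
have [N nE] : exists N, 'X ^+ 3 * n = N * g by apply/dvdpP/dvdp_gcdl.
have [D dE] : exists D, d = D * g by apply/dvdpP/dvdp_gcdr.
have D0 : D != 0 by move: d0; rewrite dE mulf_eq0 negb_or => /andP[].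
have copND : coprimep N D.
  have : coprimep (N * g %/ gcdp (N * g) (D * g)) (D * g %/ gcdp (N * g) (D * g)).
    by apply: coprimep_div_gcd; rewrite -dE d0 orbT.
  by rewrite -nE -dE -/g nE dE !mulpK.
pose B2 := t%:P ^+ 3 - 10 * t%:P ^+ 2 * 'X - 8 * t%:P * 'X ^+ 2.
have eqND : 4 * t%:P ^+ 3 * N ^+ 3 + B2 * N ^+ 2 * D + 'X * cub1 * N * D ^+ 2 +
    'X ^+ 4 * cub0 * D ^+ 3 = 0.
  apply: (mulfI (expf_neq0 3 g0)); rewrite mulr0 -(mulr0 ('X ^+ 4)) -[in RHS]root_nd.
  transitivity (4 * t%:P ^+ 3 * (N * g) ^+ 3 + B2 * (N * g) ^+ 2 * (D * g) +
    'X * cub1 * (N * g) * (D * g) ^+ 2 + 'X ^+ 4 * cub0 * (D * g) ^+ 3); first by ring.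
  by rewrite -nE -dE /B2 /cub3 /cub2; ring.
have D_dvd : D %| (4 * t ^+ 3) *: N ^+ 3.
  apply/dvdpP; exists (- (B2 * N ^+ 2 + 'X * cub1 * N * D + 'X ^+ 4 * cub0 * D ^+ 2)).
  rewrite -mul_polyC !(rmorphM, rmorphXn, rmorph_nat); apply/eqP.
  by rewrite -subr_eq0 -[eqbRHS]eqND; apply/eqP; ring.
have four_t : 4 * t ^+ 3 != 0 by rewrite mulf_neq0 ?expf_neq0 //; exact: (pow2 2).
have D1 : size D = 1%N.
  move: D_dvd; rewrite dvdpZr // => D_dvd; apply/eqP; rewrite -dvdp1.
  by rewrite -(Gauss_dvdpr 1 (_ : coprimep D (N ^+ 3))) ?mulr1 // coprimep_expr // coprimep_sym.
have [k k0 Dk] : exists2 k, k != 0 & D = k%:P by apply/size_poly1P/eqP.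
have /eqP[] := no_poly_root (k^-1%:P * N).
apply: (mulfI (expf_neq0 3 D0)); rewrite mulr0 -[RHS]eqND Dk.
have kN : N = k%:P * (k^-1%:P * N) by rewrite mulrA -polyCM divff ?mul1r.
by rewrite -/B2 [in RHS]kN; ring.
Qed.

Variable M : pseries K.
Local Notation "p %:S" := (ps_of_poly p) (at level 2, format "p %:S").
Hypothesis cubM : cub3%:S * M ^+ 3 + cub2%:S * M ^+ 2 + cub1%:S * M + cub0%:S = 0.

Lemma lin_indep (n d : {poly K}) : d%:S * M + n%:S = 0 -> d = 0 /\ n = 0.
Proof.
move=> dMn; have [d0|d0] := eqVneq d 0.
  by split=> //; apply: ps_of_poly_inj; rewrite rmorph0 -[RHS]dMn d0 rmorph0 mul0r add0r.
have dM : d%:S * M = (- n)%:S.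
  by apply/eqP; rewrite -subr_eq0 rmorphN opprK dMn.
move: (no_root (- n) d0) => /eqP[]; apply: ps_of_poly_inj; move: cubM.
move: (cub3) (cub2) (cub1) (cub0) (- n) dM => c3 c2 c1 c0 n' dM cM.
rewrite rmorph0 -(mulr0 (d%:S ^+ 3)) -[in RHS]cM !(rmorphD, rmorphM, rmorphXn) /= -dM; ring.
Qed.

Lemma quad_indep (a0 a1 a2 : {poly K}) :
  a2%:S * M ^+ 2 + a1%:S * M + a0%:S = 0 -> [/\ a2 = 0, a1 = 0 & a0 = 0].
Proof.
move=> quadM; have [a20|a20] := eqVneq a2 0.
  have [|-> ->] := @lin_indep a0 a1; last by [].
  by rewrite -[RHS]quadM a20 rmorph0 mul0r add0r.
(* Pseudo-division: a2^2 times the cubic is (l M + r) (a2 M^2 + a1 M + a0) + f1 M + f0. If the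
   remainder vanishes, - r / l is a rational root. *)
pose l := a2 * cub3; pose r := a2 * cub2 - a1 * cub3.
pose f1 := a2 ^+ 2 * cub1 - a1 * r - a0 * l; pose f0 := a2 ^+ 2 * cub0 - a0 * r.
have [f1_0 f0_0] : f1 = 0 /\ f0 = 0.
  apply: lin_indep; transitivity (a2%:S ^+ 2 * 0 - (l%:S * M + r%:S) * 0 : pseries K).
    rewrite -[in X in X - _]cubM /f1 /f0 /l /r -[in X in _ - X]quadM.
    move: (cub3) (cub2) (cub1) (cub0) => c3 c2 c1 c0.
    by rewrite !(rmorphD, rmorphB, rmorphM, rmorphXn) /=; ring.
  by rewrite !mulr0 subr0.
have l0 : l != 0.
  rewrite mulf_neq0 // /cub3 mulf_neq0 ?expf_neq0 ?polyX_eq0 // mulf_neq0 ?expf_neq0 ?polyC_eq0 //.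
  by rewrite -[4]polyC_natr polyC_eq0; exact: (pow2 2).
case/eqP: (no_root (- r) l0); apply: (mulfI (expf_neq0 2 a20)); rewrite mulr0.
transitivity ((a2 * r ^+ 2 - a1 * r * l + a0 * l ^+ 2) * (l * - r + r * l) +
  (f1 * - r + f0 * l) * l ^+ 2); first by rewrite /f1 /f0 /l /r; ring.
by rewrite f1_0 f0_0; ring.
Qed.

End NoRationalRoot.

Lemma cubic_quad_indep (K : fieldType) (t c : K) (M : pseries K) :
  2 != 0 :> K -> t != 0 ->
  cubic_lhs (psC t) (psX K) M = psC c * psX K ^+ 2 ->
  forall a0 a1 a2 : {poly K},
  ps_of_poly a2 * M ^+ 2 + ps_of_poly a1 * M + ps_of_poly a0 = 0 ->
  [/\ a2 = 0, a1 = 0 & a0 = 0].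
Proof.
move=> two0 t0 cubM; apply: (quad_indep (e := - 4 - c) two0 t0).
rewrite /cub3 /cub2 /cub1 /cub0.
apply: (addIr (psC c * psX K ^+ 2)); rewrite add0r -[RHS]cubM /cubic_lhs -!ps_of_polyC -!ps_of_polyX; ring.
Qed.

Lemma horner_map_small (D O : comNzRingType) (f : {rmorphism D -> O}) (p : {poly D}) x :
  (size p <= 3)%N -> (map_poly f p).[x] = f p`_2 * x ^+ 2 + f p`_1 * x + f p`_0.
Proof.
move=> szp; rewrite (@horner_coef_wide _ 3); last exact: leq_trans (size_poly _ _) szp.
by rewrite !big_ord_recr big_ord0 /= !coef_map /=; ring.
Qed.

Lemma cubic_lhs_map (R S : comNzRingType) (f : {rmorphism R -> S}) (t c : R) M :
  cubic_lhs (psC t) (psX R) M = psC c * psX R ^+ 2 ->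
  cubic_lhs (psC (f t)) (psX S) (ps_map f M) = psC (f c) * psX S ^+ 2.
Proof.
move/(congr1 (ps_map f)); rewrite (rmorph_cubic_lhs (ps_map f)) rmorphM rmorphXn /=.
by rewrite !ps_mapC !ps_mapX.
Qed.

(** * Elimination of S and division by the cubic *)

Section Cubic.
Variables (D : idomainType) (T Y : D).
Hypotheses (two0 : 2 != 0 :> D) (T0 : T != 0) (Y0 : Y != 0).

Definition cubic_poly : {poly D} := cubic_lhs T%:P Y%:P 'X.

Let c0 := 2 * T ^+ 2 - 2 * T * Y - 4 * Y ^+ 2.
Let c1 := 4 * Y ^+ 2 + 2 * T * Y - 2 * T ^+ 2 + 6 * T ^+ 2 * Y ^+ 3.
Let c2 := T ^+ 3 * Y ^+ 2 - 10 * T ^+ 2 * Y ^+ 3 - 8 * T * Y ^+ 4.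
Let c3 := 4 * T ^+ 3 * Y ^+ 5.

Let c3_neq0 : c3 != 0.
Proof.
have four0 : 4 != 0 :> D by rewrite (natrM _ 2 2) mulf_neq0.
by rewrite !mulf_neq0 ?expf_neq0.
Qed.

Let cubic_polyE : cubic_poly = Poly [:: c0; c1; c2; c3].
Proof.
by rewrite /= !cons_poly_def /cubic_poly /cubic_lhs /c0 /c1 /c2 /c3; ring.
Qed.

Lemma size_cubic_poly : size cubic_poly = 4%N.
Proof. by rewrite cubic_polyE (@PolyK _ 0). Qed.

Lemma horner_cubic_poly (O : comNzRingType) (f : {rmorphism D -> O}) x :
  (map_poly f cubic_poly).[x] = cubic_lhs (f T) (f Y) x.
Proof.
rewrite /cubic_poly (rmorph_cubic_lhs (map_poly f)) -[LHS]/(horner_eval x _).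
rewrite (rmorph_cubic_lhs (horner_eval x)) /= /horner_eval map_polyX !map_polyC.
by rewrite hornerX !hornerC.
Qed.

(** With B = Psi + 4 T^3 Y^2 one has B = - (8 T^3 - 1) s Y^2; this is the quadratic equation of [s]
    multiplied by (8 T^3 - 1)^2 Y^4 and rewritten in B. *)
Definition sextic_poly : {poly D} :=
  (4 * T ^+ 3) *: (cubic_poly + (4 * T ^+ 3 * Y ^+ 2)%:P) ^+ 2 -
  ((4 * T ^+ 3 - 1) * (8 * T ^+ 3 - 1) * Y ^+ 2) *:
     (cubic_poly + (4 * T ^+ 3 * Y ^+ 2)%:P) +
  (T ^+ 3 * (8 * T ^+ 3 - 1) ^+ 2 * Y ^+ 4)%:P.

Lemma size_sextic_poly : size sextic_poly = 7%N.
Proof.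
have szB : size (cubic_poly + (4 * T ^+ 3 * Y ^+ 2)%:P)%R = 4%N.
  by rewrite size_polyDl size_cubic_poly // (leq_ltn_trans (size_polyC_leq1 _)).
have T4 : 4 * T ^+ 3 != 0.
  by rewrite mulf_neq0 ?expf_neq0 // (natrM _ 2 2) mulf_neq0.
rewrite /sextic_poly; move: (cubic_poly + _) szB => B szB.
have szB2 : size ((4 * T ^+ 3) *: B ^+ 2) = 7%N.
  have := size_exp B 2; rewrite size_scale // szB.
  have : size (B ^+ 2) != 0%N.
    by rewrite size_poly_eq0 expf_neq0 // -size_poly_eq0 szB.
  by lia.
have szR : (size (- ((4 * T ^+ 3 - 1) * (8 * T ^+ 3 - 1) * Y ^+ 2 *: B)) <= 4)%N.
  by rewrite size_polyN (leq_trans (size_scale_leq _ _)) ?szB.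
have szL : size ((4 * T ^+ 3) *: B ^+ 2 - (4 * T ^+ 3 - 1) * (8 * T ^+ 3 - 1) * Y ^+ 2 *: B) = 7%N.
  by rewrite size_polyDl szB2 // (leq_ltn_trans szR).
by rewrite size_polyDl szL // (leq_ltn_trans (size_polyC_leq1 _)).
Qed.

Lemma horner_sextic_poly (O : comNzRingType) (f : {rmorphism D -> O}) x s :
  4 * f T ^+ 3 * s ^+ 2 + (4 * f T ^+ 3 - 1) * s + f T ^+ 3 = 0 ->
  cubic_lhs (f T) (f Y) x =
    (- (4 * f T ^+ 3) - (8 * f T ^+ 3 - 1) * s) * f Y ^+ 2 ->
  (map_poly f sextic_poly).[x] = 0.
Proof.
move=> s_quad; rewrite -horner_cubic_poly => cub_x.
rewrite /sextic_poly; move: cubic_poly cub_x => C cub_x.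
have horner_f a b d e :
    (map_poly f (a *: (C + d%:P) ^+ 2 - b *: (C + d%:P) + e%:P)).[x] =
    f a * ((map_poly f C).[x] + f d) ^+ 2 - f b * ((map_poly f C).[x] + f d) + f e.
  rewrite rmorphD rmorphB /= !map_polyZ rmorphXn !rmorphD /= !map_polyC /=.
  by rewrite !(hornerD, hornerN, hornerZ, horner_exp, hornerC).
rewrite horner_f.
rewrite cub_x !(rmorphD, rmorphB, rmorphN, rmorphM, rmorphXn, rmorph_nat, rmorph1) /=.
rewrite -(mulr0 ((8 * f T ^+ 3 - 1) ^+ 2 * f Y ^+ 4)) -[in RHS]s_quad; ring.
Qed.

Lemma horner_sextic_poly_ps (O : comNzRingType) (f : {rmorphism D -> pseries O})
    x (t s : O) :
  f T = psC t -> f Y = psX O -> 4 * t ^+ 3 * s ^+ 2 + (4 * t ^+ 3 - 1) * s + t ^+ 3 = 0 ->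
  cubic_lhs (psC t) (psX O) x =
    psC (- (4 * t ^+ 3) - (8 * t ^+ 3 - 1) * s) * psX O ^+ 2 ->
  (map_poly f sextic_poly).[x] = 0.
Proof.
move=> fT fY s_quad cub_x; apply: (@horner_sextic_poly _ _ _ (psC s)).
  rewrite fT -(rmorph0 (@psC O)) -s_quad.
  by rewrite !(rmorphD, rmorphB, rmorphN, rmorphM, rmorphXn, rmorph_nat, rmorph1).
rewrite fT fY cub_x; congr (_ * _).
by rewrite !(rmorphD, rmorphB, rmorphN, rmorphM, rmorphXn, rmorph_nat, rmorph1).
Qed.

(* Dividing by the cubic leaves a quadratic relation, which [cubic_quad_indep] kills. *)
Lemma cubic_division (K : fieldType) (t c : K) (M : pseries K)
    (j : {rmorphism D -> {poly K}}) (P : {poly D}) :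
  2 != 0 :> K -> t != 0 -> j T = t%:P -> j Y = 'X ->
  cubic_lhs (psC t) (psX K) M = psC c * psX K ^+ 2 ->
  (size P <= 6)%N -> (map_poly (@ps_of_poly K \o j) P).[M] = 0 ->
  exists q r k, [/\ k != 0, k *: P = q * cubic_poly + r &
    forall i, j r`_i + c%:P * 'X ^+ 2 * j q`_i = 0].
Proof.
move=> two0K t0 jT jY cubM szP PM; have cubic0 : cubic_poly != 0.
  by rewrite -size_poly_eq0 size_cubic_poly.
pose q := P %/ cubic_poly; pose r := P %% cubic_poly.
pose k := lead_coef cubic_poly ^+ scalp P cubic_poly.
have k0 : k != 0 by rewrite expf_neq0 // lead_coef_eq0.
have divE : k *: P = q * cubic_poly + r by exact: Pdiv.Idomain.divp_eq.
exists q, r, k; split=> //.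
have szr : (size r <= 3)%N.
  by rewrite -ltnS -size_cubic_poly ltn_modp.
have szq : (size q <= 3)%N by rewrite /q size_divp // size_cubic_poly leq_subLR.
have := congr1 (fun p => (map_poly (@ps_of_poly K \o j) p).[M]) divE.
rewrite /= map_polyZ hornerZ PM mulr0 rmorphD rmorphM /= hornerD hornerM.
rewrite horner_cubic_poly !horner_map_small //= jT jY ps_of_polyC ps_of_polyX cubM.
move=> /esym quadM.
have [] := @cubic_quad_indep K t c M two0K t0 cubM
  (j r`_0 + c%:P * 'X ^+ 2 * j q`_0) (j r`_1 + c%:P * 'X ^+ 2 * j q`_1)
  (j r`_2 + c%:P * 'X ^+ 2 * j q`_2).
  rewrite -[RHS]quadM !(rmorphD, rmorphM) /= ps_of_polyC ps_of_polyX; ring.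
move=> e2 e1 e0 [|[|[|i]]] //.
by rewrite (leq_sizeP _ _ szr) ?(leq_sizeP _ _ szq) // !rmorph0 mulr0 addr0.
Qed.

End Cubic.

(** * Series of the theorem *)

Lemma seriesEqP F G : seriesEq F G <-> PSeries F = PSeries G.
Proof.
split=> [eqFG|eqFG n]; first exact: pseriesP.
by have := congr1 (fun H => pcoef H n) eqFG.
Qed.

Lemma ps_sconst c : PSeries (sconst c) = psC c.
Proof. by apply: pseriesP => n; rewrite coefpsC. Qed.

Lemma ps_sX : PSeries sX = psX rat.
Proof. by apply: pseriesP => n; rewrite coefpsX. Qed.

Lemma ps_sadd F G : PSeries (sadd F G) = PSeries F + PSeries G.
Proof. by apply: pseriesP => n; rewrite coefpsD. Qed.

Lemma ps_sscale c F : PSeries (sscale c F) = psC c * PSeries F.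
Proof. by apply: pseriesP => n; rewrite coefpsCM. Qed.

Lemma ps_smul F G : PSeries (smul F G) = PSeries F * PSeries G.
Proof. by apply: pseriesP => n; rewrite coefpsM. Qed.

Lemma ps_spow F k : PSeries (spow F k) = PSeries F ^+ k.
Proof. by elim: k => [|k IH]; rewrite ?ps_sconst ?rmorph1 //= ps_smul IH exprS. Qed.

Lemma ps_sshift i F : PSeries (sshift i F) = psX rat ^+ i * PSeries F.
Proof. by apply: pseriesP => n; rewrite coefpsXnM. Qed.

Lemma ps_sevalQ a F : PSeries (sevalQ a F) = (map_poly (@psC rat) a).[PSeries F].
Proof.
rewrite (@horner_coef_wide _ (size a)) ?size_poly //; apply: pseriesP => n.
rewrite coefps_sum; apply: eq_bigr => k _; rewrite coef_map coefpsCM -ps_spow //.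
Qed.

Lemma ps_sevalQt p F :
  PSeries (sevalQt p F) = (map_poly (@ps_of_poly rat) p).[PSeries F].
Proof.
rewrite (@horner_coef_wide _ (size p)) ?size_poly //; apply: pseriesP => n.
rewrite coefps_sum; apply: eq_bigr => k _; rewrite coef_map /= -ps_spow.
rewrite -[smul _ _ n]/(pcoef (PSeries (smul (ser_of_poly p`_k) (spow F k))) n) ps_smul.
by congr (pcoef (_ * _) n); apply: pseriesP => m; rewrite coefps_poly.
Qed.

Lemma ps_Qi i : PSeries (Qi i) = mom i.
Proof. by apply: pseriesP => n; rewrite /= /Qi Qcoef_mom. Qed.

Lemma ps_neq0 (R : comNzRingType) (F : pseries R) :
  F != 0 -> exists n, pcoef F n != 0.
Proof.
move=> F0; apply: contrapT => nex; case/eqP: F0; apply: pseriesP => n.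
by rewrite coefps0; apply/eqP/negPn/negP => Fn; apply: nex; exists n.
Qed.

Local Notation t := (psX rat).

Lemma S_eqP S : S_eq S <-> PSeries S = t ^+ 3 * (1 + 2 * PSeries S) ^+ 2.
Proof.
rewrite /S_eq seriesEqP ps_smul !ps_spow ps_sX ps_sadd ps_sconst ps_sscale.
by rewrite rmorph1 rmorph_nat.
Qed.

Lemma S_contracting : contracting (fun F : pseries rat => t ^+ 3 * (1 + 2 * F) ^+ 2).
Proof.
move=> n F G eqFG; rewrite [t ^+ 3]exprS -[X in eq_upto _ X]mulrA -[X in eq_upto _ _ X]mulrA; apply: eq_upto_psX.
apply: eq_upto_mul => //; apply: eq_upto_exp; apply: eq_upto_add => //.
exact: eq_upto_mul.
Qed.

(** * Coefficients as elements of Q(S) and of Q(t) + Q(t) S *)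

Section AlgebraicParametrization.
Variable S : pseries rat.
Hypothesis S_def : S = t ^+ 3 * (1 + 2 * S) ^+ 2.

Lemma S0 : pcoef S 0 = 0.
Proof. by rewrite S_def coefpsXnM. Qed.

Lemma S_quad : 4 * t ^+ 3 * S ^+ 2 + (4 * t ^+ 3 - 1) * S + t ^+ 3 = 0.
Proof. by rewrite -[RHS](subrr S) [X in _ = X - _]S_def; ring. Qed.

Local Notation "A .(S)" := (map_poly (@psC rat) A).[S] (at level 2).

Definition rational_in_S (f : pseries rat) :=
  exists A B : {poly rat}, B.(S) != 0 /\ B.(S) * f = A.(S).

Lemma mom_rational_in_S k : rational_in_S (t ^+ k * mom k).
Proof.
apply: (mom_closed S_def).
- by exists 1, 1; rewrite rmorph1 hornerC mulr1 oner_eq0.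
- move=> a b [A [B [B0 Ba]]] [A' [B' [B'0 Bb]]].
  exists (A * B' - A' * B), (B * B').
  rewrite !(rmorphB, rmorphM) /= !(hornerD, hornerN, hornerM, hornerXn, hornerX, hornerC) mulf_neq0 //; split=> //.
  by rewrite -Ba -Bb; ring.
- move=> a b [A [B [B0 Ba]]] [A' [B' [B'0 Bb]]]; exists (A * A'), (B * B').
  rewrite !rmorphM /= !(hornerD, hornerN, hornerM, hornerXn, hornerX, hornerC) mulf_neq0 //; split=> //.
  by rewrite -Ba -Bb; ring.
- move=> a [A [B [B0 Ba]]]; exists A, (B *+ 2); rewrite rmorphMn /= hornerMn.
  by rewrite ps_mulrn_eq0 negb_or B0; split; rewrite // -Ba mulrnAl mulrnAr.
(* The equation of [S] gives t^3 = S / (1 + 2 S)^2, whose denominator has constant term 1. *)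
- exists 'X, ((1 + 'X *+ 2) ^+ 2).
  rewrite rmorphXn rmorphD rmorphMn rmorph1 /= map_polyX horner_exp hornerD hornerMn hornerX hornerC -mulr_natl; split.
    apply: expf_neq0; apply/eqP => /(congr1 (fun F => pcoef F 0)) /eqP.
    by rewrite coefpsD coefps1 mulr_natl coefpsMn S0 mul0rn addr0 coefps0 oner_eq0.
  by rewrite mulrC -S_def.
by exists 'X, 1; rewrite rmorph1 map_polyX !(hornerD, hornerN, hornerM, hornerXn, hornerX, hornerC) mul1r oner_eq0.
Qed.

Definition linear_in_S (f : pseries rat) := exists u v d : {poly rat},
  d != 0 /\ ps_of_poly d * f = ps_of_poly u + ps_of_poly v * S.

Lemma mom_linear_in_S k : linear_in_S (mom k).
Proof.
have tE : t = ps_of_poly 'X by rewrite ps_of_polyX.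
suff [u [v [d [d0 E]]]] : linear_in_S (t ^+ k * mom k).
  exists u, v, (d * 'X ^+ k); rewrite mulf_neq0 ?expf_neq0 ?polyX_eq0 //; split=> //.
  by rewrite -E rmorphM rmorphXn /= -tE mulrA.
apply: (mom_closed S_def).
- by exists 1, 0, 1; rewrite oner_eq0 rmorph1 rmorph0 mulr1 mul0r addr0.
- move=> a b [u [v [d [d0 E]]]] [u' [v' [d' [d'0 E']]]].
  exists (u * d' - u' * d), (v * d' - v' * d), (d * d'); rewrite mulf_neq0 //; split=> //.
  rewrite !(rmorphB, rmorphM) /=.
  transitivity (ps_of_poly d' * (ps_of_poly d * a) - ps_of_poly d * (ps_of_poly d' * b)).
    by ring.
  by rewrite E E'; ring.
- move=> a b [u [v [d [d0 E]]]] [u' [v' [d' [d'0 E']]]].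
  (* The square of [S] is reduced by [S_quad], whose leading coefficient 4 t^3 joins the
     denominator. *)
  exists (4 * 'X ^+ 3 * (u * u') - v * v' * 'X ^+ 3),
    (4 * 'X ^+ 3 * (u * v' + u' * v) - v * v' * (4 * 'X ^+ 3 - 1)), (4 * 'X ^+ 3 * (d * d')).
  have four0 : 4 * 'X ^+ 3 != 0 :> {poly rat}.
    by rewrite mulf_neq0 ?expf_neq0 ?polyX_eq0 // -polyC_natr polyC_eq0.
  rewrite (mulf_neq0 four0 (mulf_neq0 d0 d'0)); split=> //.
  rewrite !(rmorphB, rmorphD, rmorphM, rmorphXn, rmorph_nat, rmorph1) /= -tE.
  transitivity (4 * t ^+ 3 * ((ps_of_poly d * a) * (ps_of_poly d' * b))).
    by ring.
  rewrite E E'; apply/eqP; rewrite -subr_eq0; apply/eqP.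
  by rewrite -(mulr0 (ps_of_poly v * ps_of_poly v')) -[in RHS]S_quad; ring.
- move=> a [u [v [d [d0 E]]]]; exists u, v, (d *+ 2); rewrite -mulr_natl mulf_neq0 //.
    by rewrite rmorphM rmorph_nat -E /= -[a *+ 2]mulr_natl mulrCA mulrA.
  by rewrite -polyC_natr polyC_eq0.
- by exists ('X ^+ 3), 0, 1; rewrite oner_eq0 rmorph1 rmorph0 rmorphXn /= -tE mul1r mul0r addr0.
by exists 0, 1, 1; rewrite oner_eq0 rmorph1 rmorph0 add0r.
Qed.

Lemma mom_quadratic k : exists p : {poly {poly rat}},
  [/\ p != 0, (size p <= 3)%N & (map_poly (@ps_of_poly rat) p).[mom k] = 0].
Proof.
have [u [v [d [d0 E]]]] := mom_linear_in_S k.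
have tE : t = ps_of_poly 'X by rewrite ps_of_polyX.
(* Substituting v S = d M - u in v^2 times the equation of [S]; the leading coefficient 4 t^3 d^2 is
   nonzero even when v = 0. *)
pose c0 := 4 * 'X ^+ 3 * u ^+ 2 - (4 * 'X ^+ 3 - 1) * (u * v) + 'X ^+ 3 * v ^+ 2.
pose c1 := - (8 * 'X ^+ 3 * (d * u)) + (4 * 'X ^+ 3 - 1) * (d * v).
pose c2 := 4 * 'X ^+ 3 * d ^+ 2.
exists (c0%:P + c1%:P * 'X + c2%:P * 'X ^+ 2).
have pE : c0%:P + c1%:P * 'X + c2%:P * 'X ^+ 2 = Poly [:: c0; c1; c2].
  by rewrite /= !cons_poly_def; ring.
split.
- apply/eqP => /(congr1 (fun p : {poly {poly rat}} => p`_2)) /eqP.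
  rewrite pE coef_Poly /= coef0 /c2 mulf_eq0 expf_eq0 (negPf d0) orbF.
  by rewrite mulf_eq0 expf_eq0 polyX_eq0 orbF /= -polyC_natr polyC_eq0.
- by rewrite pE; exact: size_Poly.
rewrite !(rmorphD, rmorphM, rmorphXn) /= map_polyX !map_polyC !(hornerD, hornerN, hornerM, hornerXn, hornerX, hornerC) /=.
rewrite -(mulr0 (ps_of_poly v ^+ 2)) -[in RHS]S_quad.
transitivity (4 * t ^+ 3 * (ps_of_poly d * mom k - ps_of_poly u) ^+ 2 +
  (4 * t ^+ 3 - 1) * ps_of_poly v * (ps_of_poly d * mom k - ps_of_poly u) +
  t ^+ 3 * ps_of_poly v ^+ 2); first by rewrite /c0 /c1 /c2 tE; ring.
by rewrite E; ring.
Qed.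

End AlgebraicParametrization.

(** The indices are exchanged: y becomes the outer variable and t the inner one, as the cubic
    requires. *)
Definition bps (F : bseries) : pseries (pseries rat) :=
  PSeries (fun m => PSeries (fun n => F n m)).

Lemma bseriesEqP F G : bseriesEq F G <-> bps F = bps G.
Proof.
split=> [eqFG|eqFG n m]; first by apply: pseriesP => m; apply: pseriesP => n; apply: eqFG.
by have := congr1 (fun H => pcoef (pcoef H m) n) eqFG.
Qed.

Lemma bps_bzero : bps bzero = 0.
Proof. by apply: pseriesP => m; rewrite coefps0; apply: pseriesP => n; rewrite coefps0. Qed.

Lemma bps_bmul F G : bps (bmul F G) = bps F * bps G.
Proof.
apply: pseriesP => m; rewrite coefpsM; apply: pseriesP => n; rewrite coefps_sum.
rewrite [LHS]/= /bmul exchange_big; apply: eq_bigr => b _.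
by rewrite coefpsM.
Qed.

Lemma bps_bpow F k : bps (bpow F k) = bps F ^+ k.
Proof.
elim: k => [|k IH] /=; last by rewrite bps_bmul IH exprS.
apply: pseriesP => m; apply: pseriesP => n; rewrite expr0 coefps1 /= /bconst1.
by case: m => [|m]; rewrite ?coefps1 ?coefps0 ?andbT ?andbF.
Qed.

(** In [bser_of_poly] the outer indeterminate is t and the inner one y; [swapXY] restores the order
    of [bps]. *)
Definition bps_of_poly (q : {poly {poly rat}}) : pseries (pseries rat) :=
  ps_of_poly (map_poly (@ps_of_poly rat) (swapXY q)).

HB.instance Definition _ := GRing.RMorphism.copy bps_of_poly
  (@ps_of_poly (pseries rat) \o map_poly (@ps_of_poly rat) \o @swapXY rat).

Lemma bps_bser q : bps (bser_of_poly q) = bps_of_poly q.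
Proof.
apply: pseriesP => m; rewrite coefps_poly coef_map; apply: pseriesP => n.
by rewrite coefps_poly coef_swapXY.
Qed.

Lemma bps_bevalQty P F : bps (bevalQty P F) = (map_poly bps_of_poly P).[bps F].
Proof.
rewrite (@horner_coef_wide _ (size P)) ?size_poly //.
apply: pseriesP => m; rewrite coefps_sum; apply: pseriesP => n; rewrite coefps_sum.
rewrite [LHS]/= /bevalQty; apply: eq_bigr => k _.
rewrite -[bmul _ _ n m]/(pcoef (pcoef (bps (bmul (bser_of_poly P`_k) (bpow F k))) m) n).
by rewrite bps_bmul bps_bser bps_bpow coef_map.
Qed.

Lemma bps_Qty : bps Qty = PSeries mom.
Proof. by apply: pseriesP => m; apply: ps_Qi. Qed.

(** * Independence of 1 and c over Q(t), and base field for the minimality *)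

Section S_independence.
Variable S : pseries rat.
Hypothesis S_def : S = t ^+ 3 * (1 + 2 * S) ^+ 2.
Local Notation "p %:S" := (ps_of_poly p) (at level 2, format "p %:S").

(* The discriminant [1 - 8 t^3] of the quadratic equation of [S] is not a square, having odd degree. *)
Lemma S_irrational (a b : {poly rat}) : a%:S + b%:S * S = 0 -> b = 0.
Proof.
move=> abS; have bS : b%:S * S = (- a)%:S.
  by rewrite rmorphN; apply/eqP; rewrite -subr_eq0 opprK addrC abS.
have tE : t = 'X%:S by rewrite ps_of_polyX.
have quad : 4 * 'X ^+ 3 * a ^+ 2 - (4 * 'X ^+ 3 - 1) * a * b + 'X ^+ 3 * b ^+ 2 = 0.
  apply: ps_of_poly_inj; rewrite rmorph0 -(mulr0 (b%:S ^+ 2)) -[in RHS](S_quad S_def).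
  transitivity (4 * t ^+ 3 * (- a)%:S ^+ 2 + (4 * t ^+ 3 - 1) * (- a)%:S * b%:S + t ^+ 3 * b%:S ^+ 2).
    rewrite tE !(rmorphD, rmorphB, rmorphN, rmorphM, rmorphXn, rmorph_nat, rmorph1) /=; ring.
  by rewrite -bS; ring.
(* Completing the square; 1 - 8 X^3 is the discriminant (4 X^3 - 1)^2 - 16 X^6. *)
have disc : (8 * 'X ^+ 3 * a - (4 * 'X ^+ 3 - 1) * b) ^+ 2 = (1 - 8 * 'X ^+ 3) * b ^+ 2.
  by apply/eqP; rewrite -subr_eq0 -(mulr0 (16 * 'X ^+ 3)) -[in eqbRHS]quad; apply/eqP; ring.
apply/eqP; apply: contraT => b0.
have szD : size (1 - 8 * 'X ^+ 3 : {poly rat}) = 4%N.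
  have -> : 1 - 8 * 'X ^+ 3 = Poly [:: 1; 0; 0; - 8] :> {poly rat}.
    by rewrite /= !cons_poly_def rmorphN rmorph_nat rmorph0 rmorph1; ring.
  by rewrite (@PolyK _ 0).
have D0 : (1 - 8 * 'X ^+ 3 : {poly rat}) != 0 by rewrite -size_poly_eq0 szD.
move: disc; set l := 8 * 'X ^+ 3 * a - _ => disc.
have := congr1 (fun p : {poly rat} => size p) disc.
rewrite /= [in RHS]size_mul ?expf_neq0 // szD.
have l0 : l ^+ 2 != 0 by rewrite disc mulf_neq0 ?expf_neq0.
have := size_exp l 2; have := size_exp b 2.
move: l0; rewrite -size_poly_eq0; have : size (b ^+ 2) != 0%N by rewrite size_poly_eq0 expf_neq0.
by move: (size (l ^+ 2)) (size (b ^+ 2)) (size l) (size b) => x y z w; lia.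
Qed.

Lemma e_coefE : e_coef S = - (4 * t ^+ 3) - (8 * t ^+ 3 - 1) * S.
Proof.
apply/eqP; rewrite -subr_eq0; apply/eqP; rewrite -[RHS](S_quad S_def) /e_coef; ring.
Qed.

Lemma e_coef_independent (u v : {poly rat}) :
  u%:S + e_coef S * v%:S = 0 -> v = 0 /\ u = 0.
Proof.
rewrite e_coefE => uv.
have /eqP : - (8 * 'X ^+ 3 - 1) * v = 0.
  apply: (@S_irrational (u - 4 * 'X ^+ 3 * v)); rewrite -[RHS]uv.
  rewrite !(rmorphD, rmorphB, rmorphN, rmorphM, rmorphXn, rmorph_nat, rmorph1) /= ps_of_polyX; ring.
rewrite mulf_eq0 oppr_eq0 => /orP[|/eqP v0].
  rewrite subr_eq0 => /eqP /(congr1 (fun p : {poly rat} => p`_0)) /eqP.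
  by rewrite mulr_natl coefMn coefXn coef1.
by split=> //; apply: ps_of_poly_inj; rewrite rmorph0 -[RHS]uv v0 rmorph0 mulr0 addr0.
Qed.

(** The fractions of Q[[t]] contain t and S, hence c: over this field the cubic has coefficients in
    K[y]. *)
Let K : fieldType := {fraction pseries rat}.
Definition to_frac : {rmorphism pseries rat -> K} := @tofrac (pseries rat).

Lemma to_frac_eq0 x : (to_frac x == 0) = (x == 0).
Proof. exact: tofrac_eq0. Qed.

Definition frac_of_poly (q : {poly {poly rat}}) : {poly K} :=
  map_poly to_frac (map_poly (@ps_of_poly rat) (swapXY q)).

HB.instance Definition _ := GRing.RMorphism.copy frac_of_poly
  (map_poly to_frac \o map_poly (@ps_of_poly rat) \o @swapXY rat).

Lemma frac_of_poly_independent (U V : {poly {poly rat}}) :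
  frac_of_poly U + (to_frac (e_coef S))%:P * 'X ^+ 2 * frac_of_poly V = 0 ->
  U = 0 /\ V = 0.
Proof.
move=> UV; have coefE m n : (frac_of_poly m)`_n = to_frac ((swapXY m)`_n)%:S.
  by rewrite !coef_map.
have V0 : swapXY V = 0.
  (* The coefficient of y^(m+2) pairs a coefficient of [U] with c times the coefficient of y^m in
     [V]; by [e_coef_independent] both vanish. *)
  apply/polyP => m; have /eqP := congr1 (fun p : {poly K} => p`_(2 + m)) UV.
  rewrite coefD -mulrA coefCM coefXnM addKn !coefE coef0.
  rewrite [(_ < _)%N]ltnNge leq_addr /= -rmorphM -rmorphD to_frac_eq0 => /eqP.
  by case/e_coef_independent => -> _; rewrite coef0.
have {}V0 : V = 0 by rewrite -[V]swapXYK V0 rmorph0.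
split=> //; rewrite -[U]swapXYK; apply/eqP; rewrite -(rmorph0 swapXY); apply/eqP; congr swapXY.
apply/polyP => m; have /eqP := congr1 (fun p : {poly K} => p`_m) UV.
rewrite V0 rmorph0 mulr0 addr0 coefE !coef0 to_frac_eq0 => /eqP Um.
by apply: ps_of_poly_inj; rewrite Um rmorph0.
Qed.

End S_independence.

Lemma bps_of_polyX : bps_of_poly 'X = psC t.
Proof. by rewrite /bps_of_poly swapXY_X map_polyC /= ps_of_polyC ps_of_polyX. Qed.

Lemma bps_of_polyY : bps_of_poly 'X%:P = psX _.
Proof. by rewrite /bps_of_poly swapXY_polyC map_polyX map_polyX ps_of_polyX. Qed.

Lemma frac_of_polyX : frac_of_poly 'X = (to_frac t)%:P.
Proof. by rewrite /frac_of_poly swapXY_X !map_polyC /= ps_of_polyX. Qed.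

Lemma frac_of_polyY : frac_of_poly 'X%:P = 'X.
Proof. by rewrite /frac_of_poly swapXY_polyC !map_polyX. Qed.

Lemma frac_of_polyE q : ps_of_poly (frac_of_poly q) = ps_map to_frac (bps_of_poly q).
Proof. by rewrite /bps_of_poly ps_map_poly. Qed.

Theorem theorem13p2 :
  (* Q(3,0,t,1,1;0,y) is algebraic of degree 6 over Q(t,y) *)
  ((exists P : {poly {poly {poly rat}}},
      P != 0 /\ size P = 7%N /\ bseriesEq (bevalQty P Qty) bzero) /\
   (forall P : {poly {poly {poly rat}}},
      P != 0 -> bseriesEq (bevalQty P Qty) bzero -> (7 <= size P)%N)) /\
  (* Q_1 = 0 *)
  seriesEq (Qi 1) (sconst 0) /\
  (* for i >= 2, Q_i has degree at most 2 over Q(t) *)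
  (forall i : nat, (2 <= i)%N ->
     exists p : {poly {poly rat}},
       p != 0 /\ (size p <= 3)%N /\ seriesEq (sevalQt p (Qi i)) (sconst 0)) /\
  (* S exists and is unique *)
  (exists S : series, S 0%N = 0 /\ S_eq S) /\
  (forall S1 S2 : series, S1 0%N = 0 -> S_eq S1 -> S2 0%N = 0 -> S_eq S2 ->
     seriesEq S1 S2) /\
  (forall S : series, S 0%N = 0 -> S_eq S ->
     (* t^i Q_i is a rational function (over Q) of S *)
     (forall i : nat, (2 <= i)%N ->
        exists A B : {poly rat},
          (exists n, sevalQ B S n != 0) /\
          seriesEq (smul (sevalQ B S) (sshift i (Qi i))) (sevalQ A S)) /\
     seriesEq (Qi 2)
       (sscale 2 (smul sX (sadd (sadd (sconst 1) S) (sscale (-1) (spow S 2))))) /\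
     seriesEq (Qi 3) (sscale 2 (smul S (sadd (sconst 1) (sscale (-1) S))))).
Proof.
have [S S_fix] := contracting_fixpoint S_contracting.
have S_def : S = t ^+ 3 * (1 + 2 * S) ^+ 2 by rewrite S_fix.
have two0 : 2 != 0 :> {poly {poly rat}} by rewrite -!polyC_natr !polyC_eq0.
have X0 : 'X != 0 :> {poly {poly rat}} by rewrite polyX_eq0.
have Y0 : 'X%:P != 0 :> {poly {poly rat}} by rewrite polyC_eq0 polyX_eq0.
have [_ cubM] := mom_param S_def.
have quadS := S_quad S_def.
have eE := e_coefE S_def.
split; first split.
- have szP := size_sextic_poly two0 X0 Y0.
  exists (sextic_poly 'X 'X%:P); split; last split=> //.
    by rewrite -size_poly_eq0 szP.
  apply/bseriesEqP; rewrite bps_bevalQty bps_Qty bps_bzero.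
  apply: (@horner_sextic_poly_ps _ _ _ _ _ _ t S bps_of_polyX bps_of_polyY quadS).
  by rewrite -eE.
- move=> P P0 /bseriesEqP; rewrite bps_bevalQty bps_Qty bps_bzero => PM.
  rewrite ltnNge; apply/negP => szP.
  have two0F : 2 != 0 :> {fraction pseries rat}.
    rewrite -(rmorph_nat to_frac) to_frac_eq0; apply/eqP.
    move/(congr1 (fun F => pcoef F 0)) => /eqP.
    by rewrite coefpsMn coefps1 coefps0.
  have t0F : to_frac t != 0 by rewrite to_frac_eq0 psX_neq0.
  have cubF := cubic_lhs_map to_frac cubM.
  have PF : (map_poly (@ps_of_poly _ \o frac_of_poly) P).[ps_map to_frac (PSeries mom)] = 0.
    have -> : map_poly (@ps_of_poly _ \o frac_of_poly) P =
        map_poly (ps_map to_frac) (map_poly bps_of_poly P).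
      by rewrite -map_poly_comp; apply: eq_map_poly => q; apply: frac_of_polyE.
    by rewrite horner_map /= PM rmorph0.
  (* Each relation [qr0] over K[y] splits along 1 and c, so quotient and remainder are both zero and
     [k *: P = 0]. *)
  have [q [r [k [k0 divE qr0]]]] := cubic_division two0 X0 Y0 two0F t0F
    frac_of_polyX frac_of_polyY cubF szP PF.
  have qr i := frac_of_poly_independent S_def (qr0 i).
  have q0 : q = 0 by apply/polyP => i; rewrite coef0; case: (qr i).
  have r0 : r = 0 by apply/polyP => i; rewrite coef0; case: (qr i).
  move/eqP: divE; rewrite q0 r0 mul0r addr0 scale_poly_eq0 (negPf k0); exact/negP.
split; first by apply/seriesEqP; rewrite ps_Qi ps_sconst rmorph0 mom1.
split.
  move=> i _; have [p [p0 szp pM]] := mom_quadratic S_def i.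
  exists p; split=> //; split=> //.
  by apply/seriesEqP; rewrite ps_sevalQt ps_Qi pM ps_sconst rmorph0.
have eta (F : pseries rat) : PSeries (pcoef F) = F by case: F.
split; first by exists (pcoef S); split; [exact: (S0 S_def) | apply/S_eqP; rewrite eta].
split.
  move=> S1 S2 _ /S_eqP S1_def _ /S_eqP S2_def; apply/seriesEqP.
  exact: (contracting_unique S_contracting (esym S1_def) (esym S2_def)).
move=> {S_fix S_def cubM quadS eE}S _ /S_eqP S_def; split; last split.
- move=> i _; have [A [B [B0 AB]]] := mom_rational_in_S S_def i.
  exists A, B; split; first by move: B0; rewrite -ps_sevalQ => /ps_neq0.
  by apply/seriesEqP; rewrite ps_smul ps_sshift !ps_sevalQ ps_Qi.
- apply/seriesEqP; rewrite ps_Qi ps_sscale ps_smul ps_sX !ps_sadd ps_sscale ps_spow ps_sconst.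
  by rewrite (mom_param S_def).1 rmorph1 rmorphN1 rmorph_nat; ring.
apply/seriesEqP; rewrite ps_Qi ps_sscale ps_smul !ps_sadd ps_sscale ps_sconst.
by rewrite (mom_three S_def) rmorph1 rmorphN1 rmorph_nat; ring.
Qed.
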